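(* Let $p,k\ge 1$ and $n_1,\dots,n_k\ge p$ be integers. For $j=1,\dots,k$ let $B_j>O$ be a constant $n_j\times n_j$ Hermitian positive definite matrix. Let $\alpha_1,\dots,\alpha_{k+1},\delta\in\mathbb{C}$ satisfy $\Re(\alpha_j+n_j)>p-1$ for $j=1,\dots,k$, $\Re(\alpha_{k+1})>p-1$, and $\Re(\alpha_{k+1}+\delta)>p-1$. Let $E[\cdot]$ denote the average over the rectangular complex matrix-variate type-2 Dirichlet measure with these parameters, and let $$\phi_8(\tilde X_1,\dots,\tilde X_k)=|\det(I+\tilde X_1^{*}B_1\tilde X_1+\cdots+\tilde X_k^{*}B_k\tilde X_k)|^{-\delta}.$$ Then $$E[\phi_8]=\frac{\tilde\Gamma_p(\alpha_{k+1}+\delta)}{\tilde\Gamma_p(\alpha_{k+1})}\,\frac{\tilde\Gamma_p(\alpha_1+\cdots+\alpha_{k+1}+n_1+\cdots+n_k)}{\tilde\Gamma_p(\alpha_1+\cdots+\alpha_{k+1}+n_1+\cdots+n_k+\delta)}.$$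
   Context: For Hermitian matrices, $A>O$ means $A$ is positive definite; $I$ is the $p\times p$ identity; $\tilde X^{*}$ is the conjugate transpose. For an $n\times p$ complex matrix variable $\tilde X=(x_{ij}+\mathrm{i}\,y_{ij})$ with distinct entries, $d\tilde X=\prod_{i,j}dx_{ij}\,dy_{ij}$ (Lebesgue measure on $\mathbb{R}^{2np}$). $|\det(\cdot)|$ is the absolute value of the determinant. The complex matrix-variate gamma function is $\tilde\Gamma_p(\alpha)=\pi^{p(p-1)/2}\,\Gamma(\alpha)\Gamma(\alpha-1)\cdots\Gamma(\alpha-(p-1))$ for $\Re(\alpha)>p-1$. The rectangular complex matrix-variate type-2 Dirichlet measure, with parameters $\Re(\alpha_j+n_j)>p-1$ ($j=1,\dots,k$), $\Re(\alpha_{k+1})>p-1$, has density $$f_4(\tilde X_1,\dots,\tilde X_k)=\tilde G_k\left(\prod_{j=1}^k|\det(\tilde X_j^{*}B_j\tilde X_j)|^{\alpha_j}\right)|\det(I+\tilde X_1^{*}B_1\tilde X_1+\cdots+\tilde X_k^{*}B_k\tilde X_k)|^{-(\alpha_1+\cdots+\alpha_{k+1}+n_1+\cdots+n_k)}$$ on the set of tuples with $\tilde X_j$ a complex $n_j\times p$ matrix of full rank $p$, where $$\tilde G_k=\left\{\prod_{j=1}^k|\det(B_j)|^{p}\,\frac{\tilde\Gamma_p(n_j)}{\pi^{n_jp}\,\tilde\Gamma_p(\alpha_j+n_j)}\right\}\frac{\tilde\Gamma_p(\alpha_1+\cdots+\alpha_{k+1}+n_1+\cdots+n_k)}{\tilde\Gamma_p(\alpha_{k+1})}.$$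 The Dirichlet average of $\phi$ is $E[\phi]=\int\phi\,f_4\,d\tilde X_1\cdots d\tilde X_k$. *)

(* Defs.v *)
From HB Require Import structures.
From mathcomp Require Import all_boot all_order all_algebra.
From mathcomp Require Import all_classical all_reals all_analysis.
From mathcomp Require Import complex.

Set Implicit Arguments.
Unset Strict Implicit.
Unset Printing Implicit Defensive.
Import Order.TTheory GRing.Theory Num.Theory.
Import numFieldNormedType.Exports.

Local Open Scope classical_set_scope.
Local Open Scope ring_scope.
Local Open Scope complex_scope.
Local Open Scope sesquilinear_scope.

Section tuple_measure.
Context d (T : measurableType d) (R : realType).

Definition tuple_cons n (x : T * n.-tuple T) : n.+1.-tuple T :=
  [the n.+1.-tuple T of x.1 :: x.2].

Lemma measurable_tuple_cons n : measurable_fun setT (@tuple_cons n).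
Proof. exact: measurable_cons. Qed.

Variable m : {sigma_finite_measure set T -> \bar R}.

Section step.
Variables (n : nat) (mu : {sigma_finite_measure set (n.-tuple T) -> \bar R}).

Definition measure_cons : set (n.+1.-tuple T) -> \bar R :=
  pushforward (m \x mu)%E (@tuple_cons n).

Let measure_cons0 : measure_cons set0 = 0%E.
Proof. by rewrite /measure_cons /pushforward preimage_set0 measure0. Qed.

Let measure_cons_ge0 A : (0 <= measure_cons A)%E.
Proof. exact: (measure_ge0 (m \x mu)%E). Qed.

Let measure_cons_sigma_additive : semi_sigma_additive measure_cons.
Proof.
move=> F mF tF mUF; rewrite /measure_cons /pushforward preimage_bigcup.
have mc := @measurable_tuple_cons n.
apply: measure_semi_sigma_additive.
- by move=> i; rewrite -[X in measurable X]setTI; exact: mc.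
- apply/trivIsetP => /= i j _ _ ij; rewrite -preimage_setI.
  by move/trivIsetP : tF => /(_ _ _ _ _ ij) ->//; rewrite preimage_set0.
- by rewrite -preimage_bigcup -[X in measurable X]setTI; exact: mc.
Qed.

HB.instance Definition _ := isMeasure.Build _ _ _ measure_cons
  measure_cons0 measure_cons_ge0 measure_cons_sigma_additive.

Let measure_cons_sigma_finite : sigma_finite setT measure_cons.
Proof.
(* the library's sigma-finite instance on products only applies to products of
   subprobabilities *)
have [F FT Foo] : sigma_finite setT (m \x mu)%E.
  have /sigma_finiteP[F [TF ndF Foo]] := sigma_finiteT m.
  have /sigma_finiteP[G [TG ndG Goo]] := sigma_finiteT mu.
  exists (fun i => F i `*` G i).
    rewrite -setXTT TF TG predeqE => -[x y]; split.
      move=> [/= [i _ Fix] [j _ Gjy]]; exists (maxn i j) => //; split.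
      - by move: x Fix; exact/subsetPset/ndF/leq_maxl.
      - by move: y Gjy; exact/subsetPset/ndG/leq_maxr.
    by move=> [i _ []/= ? ?]; split; exists i.
  move=> i; have [? ?] := Foo i; have [? ?] := Goo i.
  split; first exact: measurableX.
  by rewrite product_measure1E// lte_mul_pinfty// ge0_fin_numE.
pose uncons (t : n.+1.-tuple T) : T * n.-tuple T :=
  (thead t, [tuple of behead t]).
have unK x : uncons (tuple_cons x) = x.
  case: x => a t; rewrite /uncons /tuple_cons theadE /=.
  by congr (_, _); apply/val_inj.
have mun : measurable_fun setT uncons.
  apply/measurable_fun_pairP; split.
    exact: (measurable_tnth ord0).
  exact: measurable_behead.
exists (fun i => uncons @^-1` F i).
  by rewrite -preimage_bigcup -FT preimage_setT.
move=> i; have [mFi Fioo] := Foo i; split.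
  by rewrite -[X in measurable X]setTI; exact: mun.
rewrite /measure_cons /pushforward -comp_preimage.
rewrite (_ : uncons \o _ = id) ?preimage_id//.
by apply/funext => x /=; rewrite unK.
Qed.

HB.instance Definition _ := Measure_isSigmaFinite.Build _ _ _ measure_cons
  measure_cons_sigma_finite.

End step.

Fixpoint tuple_measure n : {sigma_finite_measure set (n.-tuple T) -> \bar R} :=
  match n with
  | 0 => \d_([tuple] : 0.-tuple T)
  | n'.+1 => measure_cons (tuple_measure n')
  end.

Lemma tuple_measure_box n (A : 'I_n -> set T) :
  (forall i, measurable (A i)) ->
  tuple_measure n [set t | forall i, A i (tnth t i)] =
  (\prod_(i < n) m (A i))%E.
Proof.
elim: n A => [|n IH] A mA.
  rewrite big_ord0 /= diracE mem_set//; by case.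
rewrite big_ord_recl -IH //.
rewrite -product_measure1E//; last first.
  rewrite (_ : [set t | _] =
     \bigcap_(i in [set: 'I_n]) ((@tnth n T)^~ i @^-1` A (lift ord0 i))).
    apply: fin_bigcap_measurable => // i _.
    by rewrite -[X in measurable X]setTI; exact: measurable_tnth.
  by apply/seteqP; split => t /= H i; [move=> _|]; exact: H.
congr (product_measure1 _ _ _); apply/seteqP; split => -[a t] /= H.
  split; first by have := H ord0; rewrite /tuple_cons (tnth_nth a).
  by move=> i; have := H (lift ord0 i); rewrite !(tnth_nth a).
case: H => Ha Ht i; case: (unliftP ord0 i) => [j|] ->.
  by have := Ht j; rewrite !(tnth_nth a).
by rewrite (tnth_nth a).
Qed.

End tuple_measure.

(* Lebesgue measure on R^n. *)
Definition lebesgue_tuple (R : realType) (n : nat) :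
    {sigma_finite_measure set (n.-tuple (measurableTypeR R)) -> \bar R} :=
  tuple_measure (@lebesgue_measure R) n.

Section complex_analysis.
Variable R : realType.

Section integral.
Context d (T : measurableType d).
Variables (mu : {measure set T -> \bar R}) (D : set T) (f : T -> R[i]).

Definition cintegrable : Prop :=
  mu.-integrable D (EFin \o (fun x => complex.Re (f x))) /\
  mu.-integrable D (EFin \o (fun x => complex.Im (f x))).

Definition cintegral : R[i] :=
  (\int[mu]_(x in D) complex.Re (f x)) +i*
  (\int[mu]_(x in D) complex.Im (f x)).

End integral.

(* The principal power x ^ z = exp (z * ln x), meant for x > 0. *)
Definition cpow (x : R) (z : R[i]) : R[i] :=
  (x `^ complex.Re z * cos (complex.Im z * ln x)) +i*
  (x `^ complex.Re z * sin (complex.Im z * ln x)).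

(* Euler's integral; it converges exactly for Re z > 0. *)
Definition cGamma (z : R[i]) : R[i] :=
  cintegral (@lebesgue_measure R) `]0, +oo[
    (fun x => cpow x (z - 1) * (expR (- x))%:C).

(* The complex matrix-variate gamma function, meant for Re z > p - 1. *)
Definition mvGamma (p : nat) (z : R[i]) : R[i] :=
  (pi ^+ (p * p.-1)./2)%:C * \prod_(i < p) cGamma (z - i%:R).

Definition hermposdefmx n (A : 'M[R[i]]_n) : Prop :=
  A \is hermsymmx /\
  forall v : 'cV[R[i]]_n, v != 0 -> 0 < (v^t* *m A *m v) 0 0.

Definition absdet n (A : 'M[R[i]]_n) : R := Normc.normc (\det A).

End complex_analysis.

Section dirichlet.
Variables (R : realType) (p k : nat) (n : 'I_k -> nat).
Local Notation C := R[i].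

Definition mxfamily : Type := forall j : 'I_k, 'M[C]_(n j, p).

(* The real coordinates of a family of matrices: (j, (r, c, b)) stands for the
   real (b = false) or imaginary (b = true) part of entry (r, c) of matrix j. *)
Definition rcoord : finType := {j : 'I_k & ('I_(n j) * 'I_p * bool)%type}.

Definition mx_of_coords (x : #|rcoord|.-tuple (measurableTypeR R)) : mxfamily :=
  fun j => \matrix_(r, c)
    let coord b : R := tnth x (enum_rank
      (Tagged (fun j => ('I_(n j) * 'I_p * bool)%type) (r, c, b) : rcoord)) in
    coord false +i* coord true.

Definition fullrank : set mxfamily := [set X | forall j, \rank (X j) = p].

Definition mxfamily_integrable (phi : mxfamily -> C) : Prop :=
  cintegrable (lebesgue_tuple R #|rcoord|) (mx_of_coords @^-1` fullrank)
    (phi \o mx_of_coords).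

Definition mxfamily_integral (phi : mxfamily -> C) : C :=
  cintegral (lebesgue_tuple R #|rcoord|) (mx_of_coords @^-1` fullrank)
    (phi \o mx_of_coords).

Variable B : forall j : 'I_k, 'M[C]_(n j).

Definition quadmx (X : mxfamily) (j : 'I_k) : 'M[C]_p :=
  (X j)^t* *m B j *m X j.

Definition absdet1D (X : mxfamily) : R :=
  absdet (1%:M + \sum_(j < k) quadmx X j).

(* [alpha j] is the j-th parameter for j <= k, [beta] the (k+1)-st one. *)
Variables (alpha : 'I_k -> C) (beta : C).

Definition dirichlet_total : C :=
  \sum_(j < k) alpha j + beta + \sum_(j < k) (n j)%:R.

Definition dirichlet_const : C :=
  \prod_(j < k) ((absdet (B j) ^+ p)%:C *
    (mvGamma p (n j)%:R /
      ((pi ^+ (n j * p))%:C * mvGamma p (alpha j + (n j)%:R)))) *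
  (mvGamma p dirichlet_total / mvGamma p beta).

Definition dirichlet_density (X : mxfamily) : C :=
  dirichlet_const * (\prod_(j < k) cpow (absdet (quadmx X j)) (alpha j)) *
  cpow (absdet1D X) (- dirichlet_total).

Definition dirichlet_integrable (phi : mxfamily -> C) : Prop :=
  mxfamily_integrable (fun X => phi X * dirichlet_density X).

Definition dirichlet_average (phi : mxfamily -> C) : C :=
  mxfamily_integral (fun X => phi X * dirichlet_density X).

End dirichlet.

(* Main.v *)
Require Import Defs.
From HB Require Import structures.
From mathcomp Require Import all_boot all_order all_fingroup all_algebra.
From mathcomp Require Import all_classical all_reals all_analysis.
From mathcomp Require Import complex.
From mathcomp Require Import measurable_realfun ring lra.

Set Implicit Arguments.
Unset Strict Implicit.
Unset Printing Implicit Defensive.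
Import Order.TTheory GRing.Theory Num.Theory.
Import numFieldNormedType.Exports.

Local Open Scope classical_set_scope.
Local Open Scope ring_scope.
Local Open Scope complex_scope.
Local Open Scope sesquilinear_scope.

(** Write B_j = T_j^* T_j, A = I + sum_j (T_j X_j)^* (T_j X_j), and let g be the
    exponent of det A. The average is a multiple of the integral over X of
    prod_j det(X_j^* B_j X_j)^alpha_j det(A)^-g, where
    g = alpha_1 + ... + alpha_k + (beta + delta) + n_1 + ... + n_k.
    The power det(A)^-g is, up to a constant, the Gaussian integral over square
    p x p matrices Z of |det Z|^(2(g - p)) exp(- tr Z^* A Z). After exchanging
    the integrals, the substitutions X_j = T_j^-1 Y_j Z^-1 decouple the X_j, and
    every remaining factor is a matrix Gaussian integral of |det X^* X|^al. That
    one is computed column by column: each column contributes a radial integral,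
    hence a ratio of Gamma values. Dividing by the constant requires that Gamma
    does not vanish on Re z > 0. *)

(** * Coordinates and Lebesgue measure *)

(** Only linear changes of variable occur. In the same spirit, radial integrals go through dilations
    and layer-cake formulas rather than polar coordinates.

    Complex exponents make every exchange of integrals depend on absolute convergence. The modulus
    of x^z is x^(Re z), so the modulus of an integrand is in most cases the same integrand at the
    real parts of the parameters, and its integral is another instance of the formula being proved.

    The power [pw] vanishes at 0. Integrands are therefore defined on the full coordinate spaces and
    vanish where the rank drops, and inner integrals can be stated for every value of the outer
    variable instead of almost every one. The restriction to full-rank families is restored only at
    the end. *)

Section tuple_lebesgue.
Variable R : realType.
Local Notation mR := (measurableTypeR R).
Local Notation leb := (@lebesgue_measure R).

Lemma measurable_tuple_box n (A : 'I_n -> set mR) :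
  (forall i, measurable (A i)) ->
  measurable [set t : n.-tuple mR | forall i, A i (tnth t i)].
Proof.
move=> mA; rewrite (_ : [set t | _] =
    \bigcap_(i in [set: 'I_n]) ((@tnth n mR)^~ i @^-1` A i)).
  apply: fin_bigcap_measurable => // i _.
  by rewrite -[X in measurable X]setTI; exact: measurable_tnth.
by apply/seteqP; split => t /= H i; [move=> _|]; exact: H.
Qed.

(** Boxes form a pi-system generating the sigma-algebra, and the cubes ]-k, k[^n have finite measure
    and exhaust the space. The factor [c] is kept so that images of Lebesgue measure under affine
    maps are covered. *)
Lemma lebesgue_tuple_unique n (c : {nonneg R})
    (m : {measure set (n.-tuple mR) -> \bar R}) :
  (forall A : 'I_n -> set mR, (forall i, measurable (A i)) ->
    m [set t | forall i, A i (tnth t i)] = (c%:num%:E * \prod_i leb (A i))%E) ->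
  forall X, measurable X -> m X = mscale c (lebesgue_tuple R n) X.
Proof.
move=> mbox X mX.
pose box (A : 'I_n -> set mR) := [set t : n.-tuple mR | forall i, A i (tnth t i)].
apply: (measure_unique [set box A | A in [set A | forall i, measurable (A i)]]
  (fun k => box (fun=> [set` `]-k%:R, k%:R[%R]))) => //.
- apply/seteqP; split.
    apply: smallest_sub; first exact: smallest_sigma_algebra.
    rewrite -bigcup_seq; apply: bigcup_sub => i _ _ [B mB <-].
    apply: sub_sigma_algebra.
    exists (fun j => if j == i then B else setT) => [j|].
      by case: ifP.
    apply/seteqP; split => t.
      by move=> /(_ i); rewrite eqxx.
    by move=> /= [_ Bt] j; case: eqP => // ->.
  apply: smallest_sub; first exact: sigma_algebra_measurable.
  by move=> _ [A mA <-]; exact: measurable_tuple_box.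
- move=> _ _ [A mA <-] [B mB <-]; exists (fun i => A i `&` B i).
    by move=> i; exact: measurableI.
  apply/seteqP; split => t /=; first by move=> H; split => i; case: (H i).
  by move=> [HA HB] i; split.
- by move=> k; exists (fun=> [set` `]-k%:R, k%:R[%R]).
- apply/seteqP; split => // t _.
  exists (\max_(i < n) Num.bound (tnth t i))%N => // i /=.
  rewrite in_itv /= -ltr_norml.
  apply: lt_le_trans (unstable.ltr_norm_bound _) _; rewrite ler_nat.
  exact: (@leq_bigmax _ (fun j : 'I_n => Num.bound (tnth t j))).
- by move=> _ [A mA <-]; rewrite mbox// /mscale /=
    -(tuple_measure_box leb mA).
- move=> k; rewrite mbox// ltey_eq fin_numM//; apply: prode_fin_num => i _.
  by rewrite lebesgue_measure_itv; case: ifP.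
Qed.

End tuple_lebesgue.

Section coordinates.
Variable R : realType.
Local Notation mR := (measurableTypeR R).
Local Notation leb := (@lebesgue_measure R).

Section def.
Context d (T : measurableType d).

Definition coord_tuple (I : finType) (co : T -> I -> R) (x : T) :
    #|I|.-tuple mR := [tuple co x (enum_val i) | i < #|I|].

(* [co] identifies the measure space [(T, mu)] with Lebesgue measure on R^I. *)
Record coordsys (mu : set T -> \bar R) (I : finType) (co : T -> I -> R) : Prop :=
  Coordsys {
    coord_inv : exists mk : #|I|.-tuple mR -> T,
      [/\ measurable_fun setT mk, (forall x, mk (coord_tuple co x) = x) &
          (forall t i, co (mk t) i = tnth t (enum_rank i))];
    coord_meas : forall i, measurable_fun setT (co ^~ i : T -> mR);
    coord_box : forall A : I -> set mR, (forall i, measurable (A i)) ->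
      mu [set x | forall i, A i (co x i)] = (\prod_i leb (A i))%E }.

End def.

Section theory.
Context d (T : measurableType d) (mu : {measure set T -> \bar R}).
Variables (I : finType) (co : T -> I -> R).
Hypothesis cT : coordsys mu co.

Lemma measurable_coord_tuple : measurable_fun setT (coord_tuple co).
Proof.
apply/measurable_fun_tnthP => i.
rewrite (_ : _ \o _ = co ^~ (enum_val i)); first exact: coord_meas cT _.
by apply/funext => x /=; rewrite tnth_mktuple.
Qed.

Lemma coord_inj x y : co x =1 co y -> x = y.
Proof.
have [mk [_ mkK _]] := coord_inv cT => xy.
rewrite -(mkK x) -(mkK y); congr mk.
by apply: eq_from_tnth => i; rewrite !tnth_mktuple xy.
Qed.

Lemma measurable_coordP d' (S : measurableType d') (g : S -> T) :
  (forall i, measurable_fun setT (fun s => co (g s) i : mR)) ->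
  measurable_fun setT g.
Proof.
have [mk [mmk mkK _]] := coord_inv cT => mg.
rewrite (_ : g = mk \o (coord_tuple co \o g)); last first.
  by apply/funext => s /=; rewrite mkK.
apply: measurableT_comp => //; apply/measurable_fun_tnthP => i.
rewrite (_ : _ \o _ = fun s => co (g s) (enum_val i)); first exact: mg.
by apply/funext => x /=; rewrite tnth_mktuple.
Qed.

(** Both measures are pushed forward to tuples, where boxes determine them; the left inverse [mk]
    makes every measurable set a preimage under [coord_tuple]. *)
Lemma coord_unique (c : {nonneg R}) (nu : {measure set T -> \bar R}) :
  (forall A : I -> set mR, (forall i, measurable (A i)) ->
    nu [set x | forall i, A i (co x i)] = (c%:num%:E * \prod_i leb (A i))%E) ->
  forall X, measurable X -> nu X = (c%:num%:E * mu X)%E.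
Proof.
have [mk [mmk mkK mkC]] := coord_inv cT => nubox X mX.
pose Y := mk @^-1` X.
have mY : measurable Y by rewrite -[Y]setTI; exact: mmk.
have XE : X = coord_tuple co @^-1` Y.
  by apply/seteqP; split => x; rewrite /Y /= mkK.
have mct := measurable_coord_tuple.
have boxE (A : 'I_#|I| -> set mR) :
    coord_tuple co @^-1` [set t | forall i, A i (tnth t i)] =
    [set x | forall i, A (enum_rank i) (co x i)].
  apply/seteqP; split => x /= H i.
    by have := H (enum_rank i); rewrite tnth_mktuple enum_rankK.
  by rewrite tnth_mktuple -{1}(enum_valK i); exact: H.
have prodE (A : 'I_#|I| -> set mR) :
    (\prod_i leb (A i) = \prod_i leb (A (enum_rank i)))%E.
  by rewrite (reindex (@enum_rank I))//; apply/onW_bij/enum_rank_bij.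
have nuE : nu X = mscale c (lebesgue_tuple R #|I|) Y.
  rewrite XE; apply: (lebesgue_tuple_unique (m := pushforward nu (coord_tuple co))) => // A mA.
  by rewrite /= /pushforward boxE (nubox (fun i => A (enum_rank i)))// prodE.
have muE : mu X = mscale 1%:nng (lebesgue_tuple R #|I|) Y.
  rewrite XE; apply: (lebesgue_tuple_unique (m := pushforward mu (coord_tuple co))) => // A mA.
  by rewrite /= /pushforward boxE (coord_box cT (A := fun i => A (enum_rank i)))// prodE mul1e.
by rewrite nuE muE /mscale /= mul1e.
Qed.

Lemma coord_unique_integral (c : R) (nu : {measure set T -> \bar R}) :
  0 <= c ->
  (forall A : I -> set mR, (forall i, measurable (A i)) ->
    nu [set x | forall i, A i (co x i)] = (c%:E * \prod_i leb (A i))%E) ->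
  forall f : T -> \bar R, measurable_fun setT f -> (forall x, 0 <= f x)%E ->
  (\int[nu]_x f x = c%:E * \int[mu]_x f x)%E.
Proof.
move=> c0 nubox f mf f0.
rewrite -(@ge0_integral_mscale _ _ _ mu _ measurableT (NngNum c0))//.
by apply: eq_measure_integral => A mA _; exact: coord_unique.
Qed.

End theory.

Section ops.

Lemma measurable_affine (a b : R) :
  measurable_fun setT ((fun r => a * r + b) : mR -> mR).
Proof. by apply: measurable_funD => //; exact: measurable_funM. Qed.

(** Lebesgue measure is characterized by the lengths of the intervals ]u, v], so [|a|] times the
    image measure has only to be evaluated there. A negative slope exchanges the open and the closed
    end, which leaves the length unchanged. *)
Lemma lebesgue_affine (a b : R) (A : set mR) : a != 0 -> measurable A ->
  leb ((fun r => a * r + b) @^-1` A) = (`|a|^-1%:E * leb A)%E.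
Proof.
move=> a0 mA.
have mf := measurable_affine a b.
have n0 : 0 <= `|a| by [].
have inv0 : 0 <= `|a|^-1 by rewrite invr_ge0.
have -> : leb A = (`|a|%:E * leb ((fun r => a * r + b)%R @^-1` A))%E; last first.
  rewrite muleA -EFinM mulVf ?mul1e//.
  by rewrite normr_eq0.
suff E : leb A = mscale (NngNum n0) (pushforward leb ((fun r => a * r + b) : mR -> mR)) A.
  exact: E.
move=> m; apply: (lebesgue_measure_unique (mu := mscale (NngNum n0)
  (pushforward leb ((fun r => a * r + b) : mR -> mR)))) => //.
move=> _ [[u v] _ <-] /=; rewrite /mscale /= /pushforward.
have ux t : (u < a * t + b <= v) = (u - b < a * t <= v - b).
  by rewrite ltrBlDr lerBrDr.
have [a_gt0|a_lt0|/esym/eqP] := ltgtP 0 a; last by rewrite (negbTE a0).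
  rewrite (_ : _ @^-1` _ = [set` `](u - b) / a, (v - b) / a]]); last first.
    apply/seteqP; split => t /=; rewrite !in_itv /= ux;
    by rewrite ltr_pdivrMr// ler_pdivlMr// (mulrC t).
  rewrite !lebesgue_measure_itv /= !lte_fin ltr_pM2r ?invr_gt0// ltrD2r.
  case: ifP => _; last by rewrite mule0.
  rewrite !EFinN -!EFinD -EFinM gtr0_norm//; congr (_%:E); field.
  by rewrite gt_eqF.
rewrite (_ : _ @^-1` _ = [set` `[(v - b) / a, (u - b) / a[]); last first.
  apply/seteqP; split => t /=; rewrite !in_itv /= ux;
  by rewrite ler_ndivrMr// ltr_ndivlMr// (mulrC t) andbC.
rewrite !lebesgue_measure_itv /= !lte_fin ltr_nM2r ?invr_lt0// ltrD2r.
case: ifP => _; last by rewrite mule0.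
rewrite !EFinN -!EFinD -EFinM ltr0_norm//; congr (_%:E); field.
by rewrite lt_eqF.
Qed.

(** Change of variables with a constant factor: for an invertible linear [phi], [c] is the inverse
    of the Jacobian. Testing on nonnegative functions alone avoids integrability conditions; complex
    integrands are reached in [has_cint_preserves]. *)
Definition preserves d d' (T : measurableType d) (T' : measurableType d')
    (mu : set T -> \bar R) (mu' : set T' -> \bar R) (phi : T -> T') (c : R) :=
  measurable_fun setT phi /\
  forall f : T' -> \bar R, measurable_fun setT f -> (forall x, 0 <= f x)%E ->
  (\int[mu]_x f (phi x) = c%:E * \int[mu']_x f x)%E.

(** The preimage of a box is a box with permuted and rescaled sides. Such maps, applied fibrewise
    where needed, generate all the linear changes of variable below. *)
Lemma coord_affine d (T : measurableType d) (mu : {measure set T -> \bar R})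
    d' (T' : measurableType d') (mu' : {measure set T' -> \bar R})
    (I I' : finType) (co : T -> I -> R) (co' : T' -> I' -> R) (sigma : I' -> I)
    (phi : T -> T') (a b : I' -> R) :
  coordsys mu co -> coordsys mu' co' -> bijective sigma ->
  (forall i, a i != 0) ->
  (forall x i, co' (phi x) i = a i * co x (sigma i) + b i) ->
  preserves mu mu' phi (\prod_i `|a i|^-1).
Proof.
move=> cT cT' [sigma' sK s'K] a0 phiE.
have mphi : measurable_fun setT phi.
  apply: (measurable_coordP cT') => i.
  rewrite (_ : (fun _ => _) = fun s => a i * co s (sigma i) + b i); last first.
    by apply/funext => x; rewrite phiE.
  apply: measurable_funD => //; apply: measurable_funM => //.
  exact: (coord_meas cT).
split => // f mf f0.
have := @ge0_integral_pushforward _ _ _ _ _ _ mphi mu setT f measurableT mf (fun x _ => f0 x).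
rewrite preimage_setT => <-.
apply: (coord_unique_integral cT') => //.
  by apply: prodr_ge0 => i _; rewrite invr_ge0.
move=> A mA; rewrite /= /pushforward.
pose A' i := (fun r : mR => a (sigma' i) * r + b (sigma' i) : mR) @^-1` A (sigma' i).
have mA' i : measurable (A' i).
  by rewrite -[A' i]setTI; exact: measurable_affine.
rewrite (_ : _ @^-1` _ = [set x | forall i, A' i (co x i)]); last first.
  apply/seteqP; split => x /= H i.
    by have := H (sigma' i); rewrite phiE s'K.
  by have := H (sigma i); rewrite /A' /= sK phiE.
rewrite (coord_box cT)// (reindex sigma); last by apply: onW_bij; exists sigma'.
rewrite -prodEFin -big_split; apply: eq_bigr => i _ /=.
by rewrite /A' !sK lebesgue_affine.
Qed.

Lemma coord_transport d (T : measurableType d) (mu : {measure set T -> \bar R})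
    d' (T' : measurableType d') (mu' : {measure set T' -> \bar R})
    (I I' : finType) (co : T -> I -> R) (co' : T' -> I' -> R) (sigma : I' -> I)
    (phi : T -> T') :
  coordsys mu co -> coordsys mu' co' -> bijective sigma ->
  (forall x i, co' (phi x) i = co x (sigma i)) ->
  preserves mu mu' phi 1.
Proof.
move=> cT cT' bs phiE.
have := @coord_affine _ _ mu _ _ mu' _ _ co co' sigma phi (fun=> 1) (fun=> 0) cT cT' bs.
rewrite normr1 invr1 big1//; apply => [i|x i]; first by rewrite oner_eq0.
by rewrite phiE mul1r addr0.
Qed.

Lemma coordsys_prod d (T : measurableType d) (mu : {measure set T -> \bar R})
    d' (T' : measurableType d') (mu' : {sigma_finite_measure set T' -> \bar R})
    (I I' : finType) (co : T -> I -> R) (co' : T' -> I' -> R) :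
  coordsys mu co -> coordsys mu' co' ->
  coordsys (mu \x mu')%E (fun z (i : I + I') =>
    match i with inl a => co z.1 a | inr b => co' z.2 b end).
Proof.
move=> cT cT'; have [mk [mmk mkK mkC]] := coord_inv cT.
have [mk' [mmk' mkK' mkC']] := coord_inv cT'.
split.
- exists (fun t => (mk [tuple tnth t (enum_rank (inl (enum_val i) : I + I')) | i < #|I|],
                    mk' [tuple tnth t (enum_rank (inr (enum_val i) : I + I')) | i < #|I'|])).
  split.
  + apply: measurable_fun_pair.
      apply: measurableT_comp => //; apply/measurable_fun_tnthP => i.
      rewrite (_ : _ \o _ = (@tnth _ mR)^~ (enum_rank (inl (enum_val i)))).
        exact: measurable_tnth.
      by apply/funext => t /=; rewrite tnth_mktuple.
    apply: measurableT_comp => //; apply/measurable_fun_tnthP => i.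
    rewrite (_ : _ \o _ = (@tnth _ mR)^~ (enum_rank (inr (enum_val i)))).
        exact: measurable_tnth.
      by apply/funext => t /=; rewrite tnth_mktuple.
  + move=> [x y]; congr (_, _).
      rewrite -[RHS]mkK; congr mk; apply: eq_from_tnth => i.
      by rewrite !tnth_mktuple enum_rankK.
    rewrite -[RHS]mkK'; congr mk'; apply: eq_from_tnth => i.
    by rewrite !tnth_mktuple enum_rankK.
  + by move=> t [i|i]; rewrite ?mkC ?mkC' /= tnth_mktuple enum_rankK.
- move=> [i|i].
    by apply: (measurableT_comp (coord_meas cT i)).
  by apply: (measurableT_comp (coord_meas cT' i)).
- move=> A mA.
  have m1 : measurable [set x | forall i, A (inl i) (co x i)].
    rewrite (_ : [set x | _] = \bigcap_(i in [set: I]) ((co ^~ i) @^-1` A (inl i))).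
      apply: fin_bigcap_measurable => // i _.
      by rewrite -[X in measurable X]setTI; exact: (coord_meas cT).
    by apply/seteqP; split => t /= H i; [move=> _|]; exact: H.
  have m2 : measurable [set x | forall i, A (inr i) (co' x i)].
    rewrite (_ : [set x | _] = \bigcap_(i in [set: I']) ((co' ^~ i) @^-1` A (inr i))).
      apply: fin_bigcap_measurable => // i _.
      by rewrite -[X in measurable X]setTI; exact: (coord_meas cT').
    by apply/seteqP; split => t /= H i; [move=> _|]; exact: H.
  rewrite big_sumType /= -(coord_box cT (A := fun i => A (inl i)))//.
  rewrite -(coord_box cT' (A := fun i => A (inr i)))// -product_measure1E//.
  congr (product_measure1 _ _ _); apply/seteqP; split => -[x y] /=.
    by move=> H; split => i; [exact: (H (inl i))|exact: (H (inr i))].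
  by move=> [H1 H2] [i|i].
Qed.

Lemma coordsys_tuple (I : finType) :
  coordsys (lebesgue_tuple R #|I|)
    (fun (t : #|I|.-tuple mR) (i : I) => tnth t (enum_rank i)).
Proof.
split.
- exists id; split => // x; apply: eq_from_tnth => i.
  by rewrite tnth_mktuple enum_valK.
- by move=> i; exact: measurable_tnth.
- move=> A mA; rewrite (reindex (@enum_val I predT)); last first.
    by apply: onW_bij; exact: enum_val_bij.
  rewrite -(tuple_measure_box _ (A := fun i => A (enum_val i)))//.
  congr (lebesgue_tuple _ _ _); apply/seteqP; split => t /= H i.
    by have := H (enum_val i); rewrite enum_valK.
  by have := H (enum_rank i); rewrite enum_rankK.
Qed.

End ops.
End coordinates.

HB.instance Definition _ (R : realType) := isPointed.Build R[i] 0.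

(** * Lebesgue measure on complex matrices *)

Section matrix_measure.
Variable R : realType.
Local Notation mR := (measurableTypeR R).
Local Notation C := R[i].

Section def.
Variables (n p : nat).

Definition mx_coord (X : 'M[C]_(n, p)) (i : 'I_n * 'I_p * bool) : R :=
  if i.2 then complex.Im (X i.1.1 i.1.2) else complex.Re (X i.1.1 i.1.2).

Definition tuple_mx (t : #|{: 'I_n * 'I_p * bool}|.-tuple mR) : 'M[C]_(n, p) :=
  \matrix_(r, c) (tnth t (enum_rank (r, c, false)) +i*
                  tnth t (enum_rank (r, c, true))).

(** The sigma-algebra is carried over along the bijection [tuple_mx], so that a matrix-valued map is
    measurable exactly when its entries are ([measurable_mxP]). *)
Definition mx_measurable : set (set 'M[C]_(n, p)) :=
  [set A | measurable (tuple_mx @^-1` A)].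

Let mx_measurable0 : mx_measurable set0.
Proof. by rewrite /mx_measurable /= preimage_set0. Qed.

Let mx_measurableC A : mx_measurable A -> mx_measurable (~` A).
Proof. by move=> mA; rewrite /mx_measurable /= preimage_setC; exact: measurableC. Qed.

Let mx_measurable_bigcup (F : (set 'M[C]_(n, p))^nat) :
  (forall i, mx_measurable (F i)) -> mx_measurable (\bigcup_i (F i)).
Proof.
by move=> mF; rewrite /mx_measurable /= preimage_bigcup; exact: bigcupT_measurable.
Qed.

HB.instance Definition _ := isMeasurable.Build default_measure_display
  'M[C]_(n, p) mx_measurable0 mx_measurableC mx_measurable_bigcup.

Lemma measurable_tuple_mx : measurable_fun setT tuple_mx.
Proof. by move=> _ A mA; rewrite setTI. Qed.

Lemma tuple_mxK t i : mx_coord (tuple_mx t) i = tnth t (enum_rank i).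
Proof. by case: i => [[r c] []]; rewrite /mx_coord mxE. Qed.

Lemma tuple_mxKV X : tuple_mx (coord_tuple mx_coord X) = X.
Proof.
apply/matrixP => r c; rewrite mxE !tnth_mktuple !enum_rankK /mx_coord /=.
by case: (X r c).
Qed.

Definition lebesgue_mx : set 'M[C]_(n, p) -> \bar R :=
  pushforward (lebesgue_tuple R #|{: 'I_n * 'I_p * bool}|) tuple_mx.

Let lebesgue_mx0 : lebesgue_mx set0 = 0%E.
Proof. by rewrite /lebesgue_mx /pushforward preimage_set0 measure0. Qed.

Let lebesgue_mx_ge0 A : (0 <= lebesgue_mx A)%E.
Proof. by rewrite /lebesgue_mx /pushforward; exact: measure_ge0. Qed.

Let lebesgue_mx_sigma_additive : semi_sigma_additive lebesgue_mx.
Proof.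
move=> F mF tF mUF; rewrite /lebesgue_mx /pushforward preimage_bigcup.
apply: measure_semi_sigma_additive => //.
apply/trivIsetP => /= i j _ _ ij; rewrite -preimage_setI.
by move/trivIsetP : tF => /(_ _ _ _ _ ij) ->//; rewrite preimage_set0.
Qed.

HB.instance Definition _ := isMeasure.Build _ _ _ lebesgue_mx
  lebesgue_mx0 lebesgue_mx_ge0 lebesgue_mx_sigma_additive.

Lemma measurable_mx_coord i : measurable_fun setT (mx_coord ^~ i : _ -> mR).
Proof.
move=> _ A mA; rewrite setTI /measurable /= /mx_measurable /=.
rewrite (_ : _ @^-1` _ = (@tnth _ mR)^~ (enum_rank i) @^-1` A); last first.
  by apply/seteqP; split => t /=; rewrite tuple_mxK.
by rewrite -[X in measurable X]setTI; exact: measurable_tnth.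
Qed.

Lemma coordsys_mx : coordsys lebesgue_mx mx_coord.
Proof.
split.
- exists tuple_mx; split; [exact: measurable_tuple_mx|exact: tuple_mxKV|exact: tuple_mxK].
- exact: measurable_mx_coord.
- move=> A mA; rewrite /lebesgue_mx /pushforward -(coord_box (coordsys_tuple R _))//.
  congr (lebesgue_tuple _ _ _); apply/seteqP; split => t /= H i.
    by have := H i; rewrite tuple_mxK.
  by rewrite tuple_mxK.
Qed.

Let lebesgue_mx_sigma_finite : sigma_finite setT lebesgue_mx.
Proof.
have [F FT Foo] := sigma_finiteT (lebesgue_tuple R #|{: 'I_n * 'I_p * bool}|).
exists (fun i => coord_tuple mx_coord @^-1` F i).
  by rewrite -preimage_bigcup -FT preimage_setT.
move=> i; have [mFi Fioo] := Foo i; split.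
  by rewrite -[X in measurable X]setTI; exact: (measurable_coord_tuple coordsys_mx).
rewrite /lebesgue_mx /pushforward -comp_preimage.
rewrite (_ : _ \o _ = id) ?preimage_id//.
by apply/funext => x /=; apply: eq_from_tnth => j; rewrite tnth_mktuple tuple_mxK enum_valK.
Qed.

HB.instance Definition _ := Measure_isSigmaFinite.Build _ _ _ lebesgue_mx
  lebesgue_mx_sigma_finite.

End def.

End matrix_measure.
Arguments lebesgue_mx R n p : clear implicits.

(** * Composition and fibrewise application of changes of variable *)

Section preserves_theory.
Variable R : realType.

Section comp.
Context d1 d2 d3 (T1 : measurableType d1) (T2 : measurableType d2)
  (T3 : measurableType d3).
Variables (m1 : {measure set T1 -> \bar R}) (m2 : {measure set T2 -> \bar R})
  (m3 : {measure set T3 -> \bar R}).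

Lemma preserves_comp (phi : T1 -> T2) (psi : T2 -> T3) c c' :
  preserves m1 m2 phi c -> preserves m2 m3 psi c' ->
  preserves m1 m3 (psi \o phi) (c * c').
Proof.
move=> [mphi Iphi] [mpsi Ipsi]; split; first exact: measurableT_comp.
move=> f mf f0; rewrite (Iphi (f \o psi)); [|exact: measurableT_comp|by move=> x /=].
by rewrite Ipsi// muleA.
Qed.

(** Here [phi] is a parametrization, for instance of a matrix by its blocks: the factor of [psi] may
    be computed in these parameters. *)
Lemma preserves_cancel (phi : T1 -> T2) (psi : T2 -> T3) c :
  preserves m1 m2 phi 1 -> measurable_fun setT psi ->
  preserves m1 m3 (psi \o phi) c -> preserves m2 m3 psi c.
Proof.
move=> [mphi Iphi] mpsi [_ I]; split=> // f mf f0.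
by rewrite -I// -[LHS]mul1e -(Iphi (f \o psi))//=; exact: measurableT_comp.
Qed.

End comp.

Lemma preserves_eq d1 d2 (T1 : measurableType d1) (T2 : measurableType d2)
    (m1 : {measure set T1 -> \bar R}) (m2 : {measure set T2 -> \bar R})
    (phi psi : T1 -> T2) c c' :
  preserves m1 m2 phi c -> phi =1 psi -> c = c' -> preserves m1 m2 psi c'.
Proof. by move=> H /funext <- <-. Qed.

Section prod.
Context d1 d2 d3 (T1 : measurableType d1) (T2 : measurableType d2)
  (T3 : measurableType d3).
Variables (m1 : {sigma_finite_measure set T1 -> \bar R})
  (m2 : {sigma_finite_measure set T2 -> \bar R})
  (m3 : {sigma_finite_measure set T3 -> \bar R}).

(** By Tonelli, a shear fixing the first component has the factor of its fibre maps, provided that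
    this factor is the same on every fibre. *)
Lemma preserves_fiber2 (F : T1 * T2 -> T3) c : 0 <= c ->
  measurable_fun setT F ->
  (forall x, preserves m2 m3 (fun y => F (x, y)) c) ->
  preserves (m1 \x m2)%E (m1 \x m3)%E (fun z => (z.1, F z)) c.
Proof.
move=> c0 mF H.
have mphi : measurable_fun setT (fun z => (z.1, F z)) by exact: measurable_fun_pair.
split=> // f mf f0.
rewrite (fubini_tonelli1 (fun z => f (z.1, F z)))//; last exact: (measurableT_comp mf mphi).
rewrite fubini_tonelli1// -ge0_integralZl//.
- apply: eq_integral => x _; rewrite /fubini_F /=.
  rewrite ((H x).2 (fun t => f (x, t)))//.
  by apply: measurableT_comp => //; exact: measurable_fun_pair.
- exact: measurable_fun_fubini_tonelli_F.
- by move=> x _; rewrite /fubini_F; exact: integral_ge0.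
Qed.

Lemma preserves_fiber1 (F : T1 * T2 -> T3) c : 0 <= c ->
  measurable_fun setT F ->
  (forall y, preserves m1 m3 (fun x => F (x, y)) c) ->
  preserves (m1 \x m2)%E (m3 \x m2)%E (fun z => (F z, z.2)) c.
Proof.
move=> c0 mF H.
have mphi : measurable_fun setT (fun z => (F z, z.2)) by exact: measurable_fun_pair.
split=> // f mf f0.
rewrite (fubini_tonelli2 (fun z => f (F z, z.2)))//; last first.
  exact: (measurableT_comp mf mphi).
rewrite fubini_tonelli2// -ge0_integralZl//.
- apply: eq_integral => y _; rewrite /fubini_G /=.
  rewrite ((H y).2 (fun t => f (t, y)))//.
  by apply: measurableT_comp => //; exact: measurable_fun_pair.
- exact: measurable_fun_fubini_tonelli_G.
- by move=> x _; rewrite /fubini_G; exact: integral_ge0.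
Qed.

End prod.
End preserves_theory.

(** * Measurability of complex and matrix-valued maps *)

Section cmeasurable.
Variable R : realType.
Local Notation C := R[i].
Context d (T : measurableType d).
Implicit Types f g : T -> C.

Definition cmeasurable f :=
  measurable_fun setT (fun x => complex.Re (f x)) /\
  measurable_fun setT (fun x => complex.Im (f x)).

Lemma cmeasurable_cst (c : C) : cmeasurable (fun=> c).
Proof. by split. Qed.

Lemma cmeasurable_real (f : T -> R) : measurable_fun setT f ->
  cmeasurable (fun x => (f x)%:C).
Proof. by split. Qed.

Lemma cmeasurableD f g : cmeasurable f -> cmeasurable g ->
  cmeasurable (fun x => f x + g x).
Proof.
move=> [f1 f2] [g1 g2]; split.
  by under eq_fun do rewrite raddfD; exact: measurable_funD.
by under eq_fun do rewrite raddfD; exact: measurable_funD.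
Qed.

Lemma cmeasurableM f g : cmeasurable f -> cmeasurable g ->
  cmeasurable (fun x => f x * g x).
Proof.
move=> [f1 f2] [g1 g2]; split.
  rewrite (_ : (fun _ => _) = (fun x => complex.Re (f x) * complex.Re (g x) -
    complex.Im (f x) * complex.Im (g x))).
    by apply: measurable_funB; exact: measurable_funM.
  by apply/funext => x; case: (f x) => a b; case: (g x).
rewrite (_ : (fun _ => _) = (fun x => complex.Re (f x) * complex.Im (g x) +
    complex.Im (f x) * complex.Re (g x))).
  by apply: measurable_funD; exact: measurable_funM.
by apply/funext => x; case: (f x) => a b; case: (g x).
Qed.

Lemma cmeasurable_conj f : cmeasurable f -> cmeasurable (fun x => (f x)^*).
Proof.
move=> [f1 f2]; split.
  rewrite (_ : (fun _ => _) = (fun x => complex.Re (f x)))//.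
  by apply/funext => x; case: (f x).
rewrite (_ : (fun _ => _) = (fun x => - complex.Im (f x))).
  exact: measurableT_comp.
by apply/funext => x; case: (f x).
Qed.

Lemma cmeasurable_sum (I : Type) (s : seq I) (F : I -> T -> C) :
  (forall i, cmeasurable (F i)) -> cmeasurable (fun x => \sum_(i <- s) F i x).
Proof.
move=> H; elim: s => [|i s IH].
  by under eq_fun do rewrite big_nil; exact: cmeasurable_cst.
by under eq_fun do rewrite big_cons; exact: cmeasurableD.
Qed.

Lemma cmeasurable_prod (I : Type) (s : seq I) (F : I -> T -> C) :
  (forall i, cmeasurable (F i)) -> cmeasurable (fun x => \prod_(i <- s) F i x).
Proof.
move=> H; elim: s => [|i s IH].
  by under eq_fun do rewrite big_nil; exact: cmeasurable_cst.
by under eq_fun do rewrite big_cons; exact: cmeasurableM.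
Qed.

Lemma measurable_normc f : cmeasurable f ->
  measurable_fun setT (fun x => Normc.normc (f x)).
Proof.
move=> [f1 f2].
rewrite (_ : (fun _ => _) = (fun x => Num.sqrt (complex.Re (f x) ^+ 2 + complex.Im (f x) ^+ 2))).
  apply: measurableT_comp; first by apply: continuous_measurable_fun; exact: sqrt_continuous.
  by apply: measurable_funD; exact: measurable_funX.
by apply/funext => x; case: (f x).
Qed.

Lemma measurable_mxP n p (g : T -> 'M[C]_(n, p)) :
  measurable_fun setT g <-> forall i j, cmeasurable (fun x => g x i j).
Proof.
split=> [mg i j|H].
  split.
    exact: (measurableT_comp (measurable_mx_coord (i, j, false)) mg).
  exact: (measurableT_comp (measurable_mx_coord (i, j, true)) mg).
apply: (measurable_coordP (coordsys_mx R n p)) => -[[i j] []].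
  by have [] := H i j.
by have [] := H i j.
Qed.

Lemma measurable_mulmx n p q (f : T -> 'M[C]_(n, p)) (g : T -> 'M[C]_(p, q)) :
  measurable_fun setT f -> measurable_fun setT g ->
  measurable_fun setT (fun x => f x *m g x).
Proof.
move=> /measurable_mxP mf /measurable_mxP mg; apply/measurable_mxP => i j.
under eq_fun do rewrite mxE.
by apply: cmeasurable_sum => k; exact: cmeasurableM.
Qed.

Lemma measurable_addmx n p (f g : T -> 'M[C]_(n, p)) :
  measurable_fun setT f -> measurable_fun setT g ->
  measurable_fun setT (fun x => f x + g x).
Proof.
move=> /measurable_mxP mf /measurable_mxP mg; apply/measurable_mxP => i j.
by under eq_fun do rewrite mxE; exact: cmeasurableD.
Qed.

Lemma measurable_conjtrmx n p (f : T -> 'M[C]_(n, p)) :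
  measurable_fun setT f -> measurable_fun setT (fun x => (f x)^t*).
Proof.
move=> /measurable_mxP mf; apply/measurable_mxP => i j.
by under eq_fun do rewrite !mxE; exact: cmeasurable_conj.
Qed.

Lemma cmeasurable_det n (f : T -> 'M[C]_n) :
  measurable_fun setT f -> cmeasurable (fun x => \det (f x)).
Proof.
move=> /measurable_mxP mf; rewrite /determinant.
apply: cmeasurable_sum => s; apply: cmeasurableM; first exact: cmeasurable_cst.
exact: cmeasurable_prod.
Qed.

Lemma measurable_row_mx n p q (f : T -> 'M[C]_(n, p)) (g : T -> 'M[C]_(n, q)) :
  measurable_fun setT f -> measurable_fun setT g ->
  measurable_fun setT (fun x => row_mx (f x) (g x)).
Proof.
move=> /measurable_mxP mf /measurable_mxP mg; apply/measurable_mxP => i j.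
by under eq_fun do rewrite mxE; case: (fintype.split j).
Qed.

End cmeasurable.

(** * Linear changes of a matrix variable *)

Section matrix_maps.
Variable R : realType.
Local Notation C := R[i].
Local Notation mR := (measurableTypeR R).
Local Notation normc := (@Normc.normc R).
Local Notation lmx := (lebesgue_mx R).

Lemma preserves_row_mx n p q :
  preserves (lmx n p \x lmx n q)%E (lmx n (p + q))
    (fun z => row_mx z.1 z.2) 1.
Proof.
pose sg (i : 'I_n * 'I_(p + q) * bool) : 'I_n * 'I_p * bool + 'I_n * 'I_q * bool :=
  match fintype.split i.1.2 with
  | inl j => inl (i.1.1, j, i.2)
  | inr j => inr (i.1.1, j, i.2)
  end.
pose gs (i : 'I_n * 'I_p * bool + 'I_n * 'I_q * bool) : 'I_n * 'I_(p + q) * bool :=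
  match i with
  | inl j => (j.1.1, lshift q j.1.2, j.2)
  | inr j => (j.1.1, rshift p j.1.2, j.2)
  end.
apply: (coord_transport (coordsys_prod (coordsys_mx R n p) (coordsys_mx R n q))
  (coordsys_mx R n (p + q)) (sigma := sg)).
  exists gs => [[[r c] b]|[[[r c] b]|[[r c] b]]]; rewrite /sg /gs /=.
  - by case: splitP => j cj /=; congr (_, _, _); apply: val_inj.
  - by rewrite (unsplitK (inl c)).
  - by rewrite (unsplitK (inr c)).
move=> [X Y] [[r c] b]; rewrite /mx_coord /sg /= mxE.
by case: fintype.split.
Qed.

Lemma preserves_col_mx n p q :
  preserves (lmx p n \x lmx q n)%E (lmx (p + q) n)
    (fun z => col_mx z.1 z.2) 1.
Proof.
pose sg (i : 'I_(p + q) * 'I_n * bool) : 'I_p * 'I_n * bool + 'I_q * 'I_n * bool :=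
  match fintype.split i.1.1 with
  | inl j => inl (j, i.1.2, i.2)
  | inr j => inr (j, i.1.2, i.2)
  end.
pose gs (i : 'I_p * 'I_n * bool + 'I_q * 'I_n * bool) : 'I_(p + q) * 'I_n * bool :=
  match i with
  | inl j => (lshift q j.1.1, j.1.2, j.2)
  | inr j => (rshift p j.1.1, j.1.2, j.2)
  end.
apply: (coord_transport (coordsys_prod (coordsys_mx R p n) (coordsys_mx R q n))
  (coordsys_mx R (p + q) n) (sigma := sg)).
  exists gs => [[[r c] b]|[[[r c] b]|[[r c] b]]]; rewrite /sg /gs /=.
  - by case: splitP => j cj /=; congr (_, _, _); apply: val_inj.
  - by rewrite (unsplitK (inl r)).
  - by rewrite (unsplitK (inr r)).
move=> [X Y] [[r c] b]; rewrite /mx_coord /sg /= mxE.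
by case: fintype.split.
Qed.

Lemma preserves_trmx n p : preserves (lmx n p) (lmx p n) trmx 1.
Proof.
apply: (coord_transport (coordsys_mx R n p) (coordsys_mx R p n)
  (sigma := fun i => (i.1.2, i.1.1, i.2))).
  by exists (fun i => (i.1.2, i.1.1, i.2)) => -[[r c] b].
by move=> X [[r c] b]; rewrite /mx_coord /= mxE.
Qed.

Lemma preserves_row_perm n p (s : 'S_n) : preserves (lmx n p) (lmx n p) (row_perm s) 1.
Proof.
apply: (coord_transport (coordsys_mx R n p) (coordsys_mx R n p)
  (sigma := fun i => (s i.1.1, i.1.2, i.2))).
  exists (fun i => ((s^-1)%g i.1.1, i.1.2, i.2)) => -[[r c] b] /=.
    by rewrite permK.
  by rewrite permKV.
by move=> X [[r c] b]; rewrite /mx_coord /= mxE.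
Qed.

Lemma preserves_addmx n p (M : 'M[C]_(n, p)) :
  preserves (lmx n p) (lmx n p) (fun X => M + X) 1.
Proof.
have := coord_affine (phi := fun X => M + X) (sigma := id) (a := fun=> 1)
  (b := mx_coord M) (coordsys_mx R n p) (coordsys_mx R n p).
rewrite normr1 invr1 big1//; apply => [|i|X [[r c] b]]; first by exists id.
  by rewrite oner_eq0.
by rewrite mul1r addrC /mx_coord /= mxE; case: b; rewrite raddfD.
Qed.

Let sc_tuple (J : finType) (a : R) (v x : #|J|.-tuple mR) : #|J|.-tuple mR :=
  [tuple a * tnth x i + tnth v i | i < #|J|].

Let preserves_sc_tuple (J : finType) (a : R) v : a != 0 ->
  preserves (lebesgue_tuple R #|J|) (lebesgue_tuple R #|J|) (sc_tuple a v) (`|a| ^- #|J|).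
Proof.
move=> a0.
have := coord_affine (phi := sc_tuple a v) (sigma := id) (a := fun=> a)
  (b := fun i => tnth v (enum_rank i))
  (coordsys_tuple R J) (coordsys_tuple R J).
rewrite prodr_const -exprVn; apply => //; first by exists id.
by move=> x i; rewrite tnth_mktuple.
Qed.

Let measurable_sc_tuple (J : finType) d (T : measurableType d) (a : R)
    (f g : T -> #|J|.-tuple mR) :
  measurable_fun setT f -> measurable_fun setT g ->
  measurable_fun setT (fun x => sc_tuple a (f x) (g x)).
Proof.
move=> mf mg; apply/measurable_fun_tnthP => i.
rewrite (_ : _ \o _ = fun x => a * tnth (g x) i + tnth (f x) i); last first.
  by apply/funext => x; rewrite /= tnth_mktuple.
apply: measurable_funD; last exact: (measurableT_comp (measurable_tnth i)).
apply: measurable_funM => //; exact: (measurableT_comp (measurable_tnth i)).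
Qed.

Lemma measurable_scale_mx n p (c : C) : measurable_fun setT (fun X : 'M[C]_(n, p) => c *: X).
Proof.
apply/measurable_mxP => i j; under eq_fun do rewrite mxE.
apply: cmeasurableM; first exact: cmeasurable_cst.
by have /measurable_mxP := @measurable_id _ 'M[C]_(n, p) setT.
Qed.

(* For [Re c <> 0], multiplication by [c] on R^2 is a product of two
   triangular maps. *)
Let preserves_scale_Re n p (c : C) : complex.Re c != 0 ->
  preserves (lmx n p) (lmx n p) (fun X => c *: X) (normc c ^- (2 * (n * p))).
Proof.
case: c => a b /= a0.
pose J : finType := ('I_n * 'I_p)%type.
pose tup := lebesgue_tuple R #|J|.
pose Phi (z : #|J|.-tuple mR * #|J|.-tuple mR) : 'M[C]_(n, p) :=
  \matrix_(r, s) (tnth z.1 (enum_rank (r, s)) +i* tnth z.2 (enum_rank (r, s))).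
have PPhi : preserves (tup \x tup)%E (lmx n p) Phi 1.
  apply: (coord_transport (coordsys_prod (coordsys_tuple R J) (coordsys_tuple R J))
    (coordsys_mx R n p)
    (sigma := fun i : J * bool => if i.2 then inr i.1 else inl i.1)).
    exists (fun i => match i with inl j => (j, false) | inr j => (j, true) end).
      by move=> [j []].
    by move=> [].
  by move=> [x y] [[r s] []]; rewrite /mx_coord /= mxE.
apply: (preserves_cancel PPhi); first exact: measurable_scale_mx.
pose z0 : #|J|.-tuple mR := [tuple 0 | i < _].
have ab0 : a ^+ 2 + b ^+ 2 != 0.
  by rewrite gt_eqF// ltr_wpDr ?sqr_ge0// exprn_even_gt0.
(* With x' = a x - b y, the imaginary part b x + a y equals (b/a) x' + ((a^2 + b^2)/a) y. The
   diagonal factors a and (a^2 + b^2)/a multiply to the squared modulus of the scalar. *)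
pose phi1 (z : #|J|.-tuple mR * #|J|.-tuple mR) := (sc_tuple a (sc_tuple (- b) z0 z.2) z.1, z.2).
pose phi2 (z : #|J|.-tuple mR * #|J|.-tuple mR) :=
  (z.1, sc_tuple ((a ^+ 2 + b ^+ 2) / a) (sc_tuple (b / a) z0 z.1) z.2).
have P1 : preserves (tup \x tup)%E (tup \x tup)%E phi1 (`|a| ^- #|J|).
  apply: (preserves_fiber1 tup (F := fun z => sc_tuple a (sc_tuple (- b) z0 z.2) z.1)).
  - by rewrite invr_ge0 exprn_ge0.
  - apply: measurable_sc_tuple => //; exact: measurable_sc_tuple.
  - by move=> y; exact: (preserves_sc_tuple (sc_tuple (- b) z0 y) a0).
have P2 : preserves (tup \x tup)%E (tup \x tup)%E phi2 (`|(a ^+ 2 + b ^+ 2) / a| ^- #|J|).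
  apply: (@preserves_fiber2 R _ _ _ _ _ _ tup tup tup (fun z =>
    sc_tuple ((a ^+ 2 + b ^+ 2) / a) (sc_tuple (b / a) z0 z.1) z.2) _).
  - by rewrite invr_ge0 exprn_ge0.
  - apply: measurable_sc_tuple => //; exact: measurable_sc_tuple.
  - move=> x; apply: (preserves_sc_tuple (sc_tuple (b / a) z0 x)).
    by rewrite mulf_neq0// invr_eq0.
have cE : `|a| ^- #|J| * `|(a ^+ 2 + b ^+ 2) / a| ^- #|J| * 1 =
    normc (a +i* b) ^- (2 * (n * p)).
  rewrite mulr1 -invfM -exprMn -normrM mulrCA divff// mulr1.
  rewrite card_prod !card_ord ger0_norm; last by rewrite addr_ge0 ?sqr_ge0.
  by rewrite [in RHS]exprM sqr_sqrtr// addr_ge0 ?sqr_ge0.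
have fE : Phi \o (phi2 \o phi1) = (fun X => (a +i* b) *: X) \o Phi.
  apply/funext => -[x y] /=; apply/matrixP => r s.
  rewrite !mxE /= !tnth_mktuple /=; apply/eqP; rewrite eq_complex /=.
  by apply/andP; split; apply/eqP; [ring|field].
by rewrite -cE -fE; exact: preserves_comp (preserves_comp P1 P2) PPhi.
Qed.

Lemma normcM (x y : C) : normc (x * y) = normc x * normc y.
Proof. exact: Normc.normcM. Qed.

(** A purely imaginary [c] is the product of c/(1 + i) and 1 + i, both with nonzero real part. The
    exponent counts two real dimensions per entry. *)
Lemma preserves_scale n p (c : C) : c != 0 ->
  preserves (lmx n p) (lmx n p) (fun X => c *: X) (normc c ^- (2 * (n * p))).
Proof.
move=> c0; have [c1|] := eqVneq (complex.Re c) 0; last exact: preserves_scale_Re.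
have d0 : complex.Re (1 +i* 1 : C) != 0 by rewrite oner_eq0.
have e0 : complex.Re (c / (1 +i* 1)) != 0.
  case: c c0 c1 => a b /= c0 a0; rewrite a0 mul0r sub0r.
  have b0 : b != 0 by apply: contraNneq c0 => ->; rewrite a0.
  by rewrite mulrN opprK mulf_neq0// mul1r invr_eq0 expr1n -natrD pnatr_eq0.
have d1 : (1 +i* 1 : C) != 0 by rewrite eq_complex /= oner_eq0.
apply: (preserves_eq (preserves_comp (preserves_scale_Re n p e0) (preserves_scale_Re n p d0))).
  by move=> X /=; rewrite scalerA mulrC divfK.
by rewrite -invfM -exprMn -normcM divfK.
Qed.

Lemma measurable_lmul n m p (T : 'M[C]_(m, n)) :
  measurable_fun setT (fun X : 'M[C]_(n, p) => T *m X).
Proof. exact: measurable_mulmx. Qed.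

Lemma normc_ge0 (x : C) : 0 <= normc x.
Proof. by case: x => a b; exact: sqrtr_ge0. Qed.

(** The real Jacobian of multiplication by [T] on a single column is |det T|^2, and there are [p]
    columns. *)
Definition lmul_scales n (T : 'M[C]_n) := forall p,
  preserves (lmx n p) (lmx n p) (mulmx T) (normc (\det T) ^- (2 * p)).

Let weight_ge0 (c : C) k : 0 <= normc c ^- k.
Proof. by rewrite invr_ge0 exprn_ge0// normc_ge0. Qed.

Lemma lmul_scales_mul n (S T : 'M[C]_n) :
  lmul_scales S -> lmul_scales T -> lmul_scales (S *m T).
Proof.
move=> HS HT p; apply: (preserves_eq (preserves_comp (HT p) (HS p))).
  by move=> X /=; rewrite mulmxA.
by rewrite -invfM -exprMn -normcM det_mulmx mulrC.
Qed.

Lemma lmul_scales1 n : lmul_scales (1%:M : 'M[C]_n).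
Proof.
move=> p; rewrite det1 /= expr0n /= addr0 expr1n sqrtr1 expr1n invr1.
split; first exact: measurable_lmul.
by move=> f mf f0; rewrite mul1e; apply: eq_integral => X _; rewrite mul1mx.
Qed.

Lemma lmul_scales_scalar (T : 'M[C]_1) : \det T != 0 -> lmul_scales T.
Proof.
rewrite det_mx11 => T0 p; apply: (preserves_eq (preserves_scale 1 p T0)).
  by move=> X; rewrite {2}[T]mx11_scalar mul_scalar_mx.
by rewrite mul1n det_mx11.
Qed.

Lemma lmul_scales_perm n (s : 'S_n) : lmul_scales (perm_mx s : 'M[C]_n).
Proof.
move=> p; apply: (preserves_eq (preserves_row_perm p s)).
  by move=> X; rewrite row_permE.
rewrite det_perm.
have -> : normc ((-1) ^+ s : C) = 1.
  by case: (s : bool); rewrite /= ?expr1 /= ?expr0n /= ?oppr0 ?addr0 ?sqrrN ?expr1n ?expr0n ?addr0 sqrtr1.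
by rewrite expr1n invr1.
Qed.

Section block.
Variables (a b : nat) (A : 'M[C]_a) (B : 'M[C]_b).
Hypotheses (HA : lmul_scales A) (HB : lmul_scales B).

(** The map (x, y) -> (A x, D x + B y) is two fibrewise maps: y is changed first, while the old x is
    still available, and x afterwards. For an upper block the order is reversed. *)
Lemma lmul_scales_lblock (D : 'M[C]_(b, a)) : lmul_scales (block_mx A 0 D B).
Proof.
move=> p; apply: (preserves_cancel (preserves_col_mx p a b)); first exact: measurable_lmul.
have m1 : measurable_fun setT (fun z : 'M[C]_(a, p) * 'M[C]_(b, p) => D *m z.1 + B *m z.2).
  by apply: measurable_addmx; exact: measurable_mulmx.
have m2 : measurable_fun setT (fun z : 'M[C]_(a, p) * 'M[C]_(b, p) => A *m z.1).
  exact: measurable_mulmx.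
have P (x : 'M[C]_(a, p)) : preserves (lmx b p) (lmx b p) (fun y => D *m x + B *m y)
    (normc (\det B) ^- (2 * p)).
  by apply: (preserves_eq (preserves_comp (HB p) (preserves_addmx (D *m x)))); rewrite ?mulr1.
have P1 := preserves_fiber2 (lmx a p) (m3 := lmx b p) (weight_ge0 (\det B) (2 * p)) m1 P.
have P2 := preserves_fiber1 (lmx b p) (m3 := lmx a p) (weight_ge0 (\det A) (2 * p)) m2
  (fun _ => HA p).
apply: (preserves_eq (preserves_comp (preserves_comp P1 P2) (preserves_col_mx p a b))).
  by move=> [X Y] /=; rewrite mul_block_col mul0mx addr0.
by rewrite !mulr1 -invfM -exprMn -normcM det_lblock mulrC.
Qed.

Lemma lmul_scales_ublock (D : 'M[C]_(a, b)) : lmul_scales (block_mx A D 0 B).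
Proof.
move=> p; apply: (preserves_cancel (preserves_col_mx p a b)); first exact: measurable_lmul.
have m1 : measurable_fun setT (fun z : 'M[C]_(a, p) * 'M[C]_(b, p) => D *m z.2 + A *m z.1).
  by apply: measurable_addmx; exact: measurable_mulmx.
have m2 : measurable_fun setT (fun z : 'M[C]_(a, p) * 'M[C]_(b, p) => B *m z.2).
  exact: measurable_mulmx.
have P (y : 'M[C]_(b, p)) : preserves (lmx a p) (lmx a p) (fun x => D *m y + A *m x)
    (normc (\det A) ^- (2 * p)).
  by apply: (preserves_eq (preserves_comp (HA p) (preserves_addmx (D *m y)))); rewrite ?mulr1.
have P1 := preserves_fiber1 (lmx b p) (m3 := lmx a p) (weight_ge0 (\det A) (2 * p)) m1 P.
have P2 := preserves_fiber2 (lmx a p) (m3 := lmx b p) (weight_ge0 (\det B) (2 * p)) m2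
  (fun _ => HB p).
apply: (preserves_eq (preserves_comp (preserves_comp P1 P2) (preserves_col_mx p a b))).
  by move=> [X Y] /=; rewrite mul_block_col mul0mx add0r addrC.
by rewrite !mulr1 -invfM -exprMn -normcM det_ublock.
Qed.

End block.

(** Gaussian elimination: a row exchange brings a nonzero entry into the corner, and the Schur
    complement [D] carries the induction. *)
Theorem lmul_scales_unit n (T : 'M[C]_n) : T \in unitmx -> lmul_scales T.
Proof.
elim: n T => [|n IH] T uT.
  by rewrite (flatmx0 T) -(flatmx0 1%:M); exact: lmul_scales1.
have [i Ti0] : exists i, T i 0 != 0.
  apply/existsP; rewrite -negb_forall; apply: contraTN uT => /forallP T0.
  rewrite unitmxE (expand_det_col _ 0) big1 ?unitr0// => i _.
  by rewrite (eqP (T0 i)) mul0r.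
pose s := tperm i 0; pose S : 'M[C]_(1 + n) := row_perm s T.
have TE : T = perm_mx s *m S.
  rewrite /S row_permE mulmxA -perm_mxM.
  by rewrite /s tperm2 perm_mx1 mul1mx.
have uS : S \in unitmx by rewrite /S row_permE unitmx_mul unitmx_perm.
have S00 : S 0 0 != 0 by rewrite /S mxE /s tpermR.
clearbody S.
pose t := ulsubmx S; pose L := dlsubmx S *m invmx t.
pose D := drsubmx S - L *m ursubmx S.
have tE : \det t = S 0 0.
  by rewrite det_mx11 !mxE; congr (S _ _); apply/val_inj.
have ut : t \in unitmx by rewrite unitmxE tE unitfE.
have SE : S = block_mx 1%:M 0 L 1%:M *m block_mx t (ursubmx S) 0 D.
  rewrite mulmx_block !mul1mx !mul0mx !addr0 -{1}[S]submxK /D.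
  by rewrite /L mulmxKV// addrC subrK.
have uD : D \in unitmx.
  move: uS; rewrite SE unitmx_mul => /andP[_].
  by rewrite !unitmxE det_ublock unitrM => /andP[].
rewrite TE; apply: lmul_scales_mul; first exact: lmul_scales_perm.
rewrite SE; apply: lmul_scales_mul.
  exact: (lmul_scales_lblock (lmul_scales1 1) (lmul_scales1 n) L).
have st : lmul_scales t by apply: lmul_scales_scalar; rewrite tE.
exact: (lmul_scales_ublock st (IH D uD) (ursubmx S)).
Qed.

Theorem rmul_scales_unit n p (T : 'M[C]_p) : T \in unitmx ->
  preserves (lmx n p) (lmx n p) (fun X => X *m T) (normc (\det T) ^- (2 * n)).
Proof.
move=> uT.
have uT' : T^T \in unitmx by rewrite unitmx_tr.
apply: (preserves_eq (preserves_comp (preserves_comp (preserves_trmx n p)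
  (lmul_scales_unit uT' n)) (preserves_trmx p n))).
  by move=> X /=; rewrite trmx_mul !trmxK.
by rewrite mul1r mulr1 det_tr.
Qed.

End matrix_maps.

(** * Integrals of complex functions *)

Section has_rint.
Variable R : realType.

Section one.
Context d (T : measurableType d) (mu : {measure set T -> \bar R}).
Implicit Types f g : T -> R.

Definition has_rint f (v : R) :=
  mu.-integrable setT (EFin \o f) /\ (\int[mu]_x (f x)%:E = v%:E)%E.

Lemma eq_has_rint f g v w : has_rint f v -> f =1 g -> v = w -> has_rint g w.
Proof. by move=> H /funext <- <-. Qed.

Lemma has_rint_measurable f v : has_rint f v -> measurable_fun setT f.
Proof. by move=> [/integrableP[/measurable_EFinP]]. Qed.

Lemma has_rintD f g v w : has_rint f v -> has_rint g w ->
  has_rint (fun x => f x + g x) (v + w).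
Proof.
move=> [fi fv] [gi gw]; split.
  by apply: eq_integrable (integrableD measurableT fi gi).
by have := integralD_EFin measurableT fi gi; rewrite /= fv gw.
Qed.

Lemma has_rintZ f v k : has_rint f v -> has_rint (fun x => k * f x) (k * v).
Proof.
move=> [fi fv]; split; first by apply: eq_integrable (integrableZl measurableT k fi).
by have := integralZl measurableT fi k; rewrite /= fv.
Qed.

Lemma has_rint0 : has_rint (fun=> 0) 0.
Proof. by split; [exact: integrable0|exact: integral0]. Qed.

Lemma has_rint_ge0 f v : measurable_fun setT f -> (forall x, 0 <= f x) ->
  (\int[mu]_x (f x)%:E = v%:E)%E -> has_rint f v.
Proof.
move=> mf f0 fv; split => //; apply/integrableP; split; first exact/measurable_EFinP.
by under eq_integral do rewrite /= ger0_norm//; rewrite fv ltry.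
Qed.

End one.

(** The hypothesis concerns nonnegative integrands only; a signed [f] is split into its positive and
    negative parts, and its integrability comes from the case of its absolute value. *)
Lemma has_rint_weight d1 d2 (T1 : measurableType d1) (T2 : measurableType d2)
    (m1 : {measure set T1 -> \bar R}) (m2 : {measure set T2 -> \bar R})
    (phi : T1 -> T2) (w f : T2 -> R) v :
  measurable_fun setT phi -> (forall x, 0 <= w x) -> measurable_fun setT f ->
  (forall g : T2 -> \bar R, measurable_fun setT g -> (forall x, 0 <= g x)%E ->
    (\int[m1]_x g (phi x) = \int[m2]_x ((w x)%:E * g x))%E) ->
  has_rint m2 (fun x => w x * f x) v -> has_rint m1 (f \o phi) v.
Proof.
move=> mphi w0 mf I [/integrableP[mwf iwf] wfv].
have mEf : measurable_fun setT (EFin \o f) by exact/measurable_EFinP.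
have fi : m1.-integrable setT (EFin \o (f \o phi)).
  apply/integrableP; split; first exact/measurable_EFinP/measurableT_comp.
  rewrite (I (fun x => `|(f x)%:E|)%E)//; last exact: measurableT_comp.
  apply: le_lt_trans iwf; rewrite le_eqVlt; apply/orP; left; apply/eqP.
  by apply: eq_integral => x _; rewrite /= normrM ger0_norm// EFinM.
split => //; rewrite -wfv integralE [RHS]integralE; congr (_ - _)%E.
  transitivity (\int[m2]_x ((w x)%:E * (EFin \o f)^\+ x))%E.
    rewrite -(I ((EFin \o f)^\+)%E)//; last exact: measurable_funepos.
    by apply: eq_integral => x _; rewrite !funeposE.
  by apply: eq_integral => x _; rewrite !funeposE maxe_pMr ?lee_fin// mule0.
transitivity (\int[m2]_x ((w x)%:E * (EFin \o f)^\- x))%E.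
  rewrite -(I ((EFin \o f)^\-)%E)//; last exact: measurable_funeneg.
  by apply: eq_integral => x _; rewrite !funenegE.
by apply: eq_integral => x _; rewrite !funenegE maxe_pMr ?lee_fin// mule0 muleN.
Qed.

Lemma has_rint_preserves_inv d1 d2 (T1 : measurableType d1) (T2 : measurableType d2)
    (m1 : {measure set T1 -> \bar R}) (m2 : {measure set T2 -> \bar R})
    (phi : T1 -> T2) (f : T2 -> R) v :
  measurable_fun setT f -> preserves m1 m2 phi 1 ->
  has_rint m1 (f \o phi) v -> has_rint m2 f v.
Proof.
move=> mf [mphi I] [/integrableP[_ ifp] fv].
have mEf : measurable_fun setT (EFin \o f) by exact/measurable_EFinP.
split.
  apply/integrableP; split => //; rewrite -[ltLHS]mul1e.
  by rewrite -(I (fun x => `|(f x)%:E|)%E)//; exact: measurableT_comp.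
rewrite -fv integralE [RHS]integralE; congr (_ - _)%E.
  rewrite -[LHS]mul1e -(I ((EFin \o f)^\+)%E)//; last exact: measurable_funepos.
  by apply: eq_integral => x _; rewrite !funeposE.
rewrite -[LHS]mul1e -(I ((EFin \o f)^\-)%E)//; last exact: measurable_funeneg.
by apply: eq_integral => x _; rewrite !funenegE.
Qed.

Section fubini.
Context d1 d2 (T1 : measurableType d1) (T2 : measurableType d2).
Variables (m1 : {sigma_finite_measure set T1 -> \bar R})
  (m2 : {sigma_finite_measure set T2 -> \bar R}).

Lemma has_rint_fubini (f : T1 * T2 -> R) (h k : T2 -> R) v w :
  measurable_fun setT f ->
  (forall y, has_rint m1 (fun x => `|f (x, y)|) (h y)) -> has_rint m2 h w ->
  (forall y, has_rint m1 (fun x => f (x, y)) (k y)) -> has_rint m2 k v ->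
  has_rint (m1 \x m2)%E f v.
Proof.
move=> mf fh [hi hw] fk [ki kv].
have fi : (m1 \x m2)%E.-integrable setT (EFin \o f).
  apply/integrable21ltyP; first exact/measurable_EFinP.
  rewrite (eq_integral (EFin \o h)); first by rewrite [ltLHS]hw ltry.
  by move=> y _; have [_] := fh y.
split=> //; rewrite -[LHS](integral21_prod_meas1 fi) -kv.
by apply: eq_integral => y _; have [_] := fk y.
Qed.

Lemma has_rint_fubini_inv (f : T1 * T2 -> R) (k : T1 -> R) v :
  has_rint (m1 \x m2)%E f v ->
  (forall x, has_rint m2 (fun y => f (x, y)) (k x)) -> has_rint m1 k v.
Proof.
move=> [fi fv] fk.
have kE : (EFin \o k) = fubini_F m2 (EFin \o f).
  by apply/funext => x; have [_ /esym] := fk x.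
split; first by rewrite kE; exact: integrable_fubini_F.
by have := integral12_prod_meas1 fi; rewrite -kE => ->.
Qed.

End fubini.
End has_rint.

Section has_cint.
Variable R : realType.
Local Notation C := R[i].
Local Notation normc := (@Normc.normc R).

Section one.
Context d (T : measurableType d) (mu : {measure set T -> \bar R}).
Implicit Types f g : T -> C.

(** Integrability and value travel together: [cintegral] alone gives a default value to a divergent
    integral, and the final statement asks for both. *)
Definition has_cint f (v : C) := cintegrable mu setT f /\ cintegral mu setT f = v.

Lemma has_cintP f v : has_cint f v <->
  has_rint mu (fun x => complex.Re (f x)) (complex.Re v) /\
  has_rint mu (fun x => complex.Im (f x)) (complex.Im v).
Proof.
split=> [[[i1 i2] <-]|[[i1 e1] [i2 e2]]].
  by split; split => //=; rewrite fineK//; [exact: integrable_fin_num i1|exact: integrable_fin_num i2].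
by split; [split|rewrite /cintegral /Rintegral e1 e2; case: v {e1 e2}].
Qed.

Lemma has_cint_cmeasurable f v : has_cint f v -> cmeasurable f.
Proof. by move=> /has_cintP[/has_rint_measurable ? /has_rint_measurable ?]. Qed.

Lemma eq_has_cint f g v w : has_cint f v -> f =1 g -> v = w -> has_cint g w.
Proof. by move=> H /funext <- <-. Qed.

Lemma has_cint_real (f : T -> R) (v : R) :
  has_rint mu f v -> has_cint (fun x => (f x)%:C) v%:C.
Proof. by move=> H; apply/has_cintP; split => //; exact: has_rint0. Qed.

Lemma has_cintZ f v c : has_cint f v -> has_cint (fun x => c * f x) (c * v).
Proof.
case: c v => a b [u v] /has_cintP[/= H1 H2]; apply/has_cintP; split.
  apply: (eq_has_rint (has_rintD (has_rintZ a H1) (has_rintZ (- b) H2))).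
    by move=> x; case: (f x) => s t /=; rewrite mulNr.
  by rewrite /= mulNr.
apply: (eq_has_rint (has_rintD (has_rintZ a H2) (has_rintZ b H1))) => //.
by move=> x; case: (f x).
Qed.

Lemma has_cintD f g v w : has_cint f v -> has_cint g w ->
  has_cint (fun x => f x + g x) (v + w).
Proof.
move=> /has_cintP[f1 f2] /has_cintP[g1 g2]; apply/has_cintP; split.
  by apply: (eq_has_rint (has_rintD f1 g1)) => [x|]; rewrite raddfD.
by apply: (eq_has_rint (has_rintD f2 g2)) => [x|]; rewrite raddfD.
Qed.

Lemma has_cint_unique f v w : has_cint f v -> has_cint f w -> v = w.
Proof. by move=> [_ <-] [_ <-]. Qed.

Lemma normc_Re (z : C) : `|complex.Re z| <= normc z.
Proof.
case: z => a b /=; rewrite -sqrtr_sqr ler_sqrt; last by rewrite addr_ge0 ?sqr_ge0.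
by rewrite lerDl sqr_ge0.
Qed.

Lemma normc_Im (z : C) : `|complex.Im z| <= normc z.
Proof.
case: z => a b /=; rewrite -sqrtr_sqr ler_sqrt; last by rewrite addr_ge0 ?sqr_ge0.
by rewrite lerDr sqr_ge0.
Qed.

End one.

Lemma has_cint_weight d1 d2 (T1 : measurableType d1) (T2 : measurableType d2)
    (m1 : {measure set T1 -> \bar R}) (m2 : {measure set T2 -> \bar R})
    (phi : T1 -> T2) (w : T2 -> R) (f : T2 -> C) v :
  measurable_fun setT phi -> (forall x, 0 <= w x) -> cmeasurable f ->
  (forall g : T2 -> \bar R, measurable_fun setT g -> (forall x, 0 <= g x)%E ->
    (\int[m1]_x g (phi x) = \int[m2]_x ((w x)%:E * g x))%E) ->
  has_cint m2 (fun x => (w x)%:C * f x) v -> has_cint m1 (f \o phi) v.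
Proof.
move=> mphi w0 [mf1 mf2] I /has_cintP[H1 H2]; apply/has_cintP; split.
  apply: (has_rint_weight mphi w0 mf1 I); apply: (eq_has_rint H1) => // x.
  by case: (f x) => s t /=; rewrite mul0r subr0.
apply: (has_rint_weight mphi w0 mf2 I); apply: (eq_has_rint H2) => // x.
by case: (f x) => s t /=; rewrite mul0r addr0.
Qed.

Lemma has_cint_preserves d1 d2 (T1 : measurableType d1) (T2 : measurableType d2)
    (m1 : {measure set T1 -> \bar R}) (m2 : {measure set T2 -> \bar R})
    (phi : T1 -> T2) (c : R) (f : T2 -> C) v :
  0 <= c -> preserves m1 m2 phi c -> has_cint m2 f v ->
  has_cint m1 (f \o phi) (c%:C * v).
Proof.
move=> c0 [mphi I] fv.
apply: (has_cint_weight mphi (fun=> c0) (has_cint_cmeasurable fv)).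
  by move=> g mg g0; rewrite I// ge0_integralZl.
exact: has_cintZ.
Qed.

(** Used with [phi] a parametrization by blocks or columns: an integral computed on the product is
    transferred to the space being parametrized. *)
Lemma has_cint_preserves_inv d1 d2 (T1 : measurableType d1) (T2 : measurableType d2)
    (m1 : {measure set T1 -> \bar R}) (m2 : {measure set T2 -> \bar R})
    (phi : T1 -> T2) (f : T2 -> C) v :
  cmeasurable f -> preserves m1 m2 phi 1 ->
  has_cint m1 (f \o phi) v -> has_cint m2 f v.
Proof.
move=> [mf1 mf2] P /has_cintP[H1 H2]; apply/has_cintP.
by split; [exact: (has_rint_preserves_inv mf1 P H1)|exact: (has_rint_preserves_inv mf2 P H2)].
Qed.

Section fubini.
Context d1 d2 (T1 : measurableType d1) (T2 : measurableType d2).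
Variables (m1 : {sigma_finite_measure set T1 -> \bar R})
  (m2 : {sigma_finite_measure set T2 -> \bar R}).

Lemma cintegrable_le d (T : measurableType d) (mu : {measure set T -> \bar R})
    (f : T -> C) (g : T -> R) : cmeasurable f ->
  mu.-integrable setT (EFin \o g) -> (forall x, normc (f x) <= g x) ->
  cintegrable mu setT f.
Proof.
move=> [f1 f2] ig fg; split.
  apply: (le_integrable _ _ _ ig) => //; first exact/measurable_EFinP.
  move=> x _ /=; rewrite lee_fin (le_trans (normc_Re _))// (le_trans (fg x))// ler_norm//.
apply: (le_integrable _ _ _ ig) => //; first exact/measurable_EFinP.
by move=> x _ /=; rewrite lee_fin (le_trans (normc_Im _))// (le_trans (fg x))// ler_norm.
Qed.

(** [h] is the inner integral of the modulus: its integrability gives absolute convergence on the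
    product, after which [k] gives the value. The number [w] only witnesses finiteness. *)
Lemma has_cint_fubini (f : T1 * T2 -> C) (h k : T2 -> C) v w :
  cmeasurable f ->
  (forall y, has_cint m1 (fun x => (normc (f (x, y)))%:C) (h y)) -> has_cint m2 h w ->
  (forall y, has_cint m1 (fun x => f (x, y)) (k y)) -> has_cint m2 k v ->
  has_cint (m1 \x m2)%E f v.
Proof.
move=> mf fh hw fk kv.
have /has_cintP[hw1 _] := hw; have /has_cintP[kv1 kv2] := kv.
have nf : has_rint (m1 \x m2)%E (fun z => normc (f z)) (complex.Re w).
  have fh1 y : has_rint m1 (fun x => normc (f (x, y))) (complex.Re (h y)).
    by have /has_cintP[] := fh y.
  apply: (has_rint_fubini _ _ hw1 fh1 hw1) => //; first exact: measurable_normc.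
  move=> y; apply: (eq_has_rint (fh1 y)) => // x; rewrite ger0_norm//.
  exact: normc_ge0.
have [[fi1 fi2]] : cintegrable (m1 \x m2)%E setT f.
  by apply: (cintegrable_le mf nf.1) => z.
apply/has_cintP; split; split => //.
  rewrite -[LHS](integral21_prod_meas1 fi1) -kv1.2.
  by apply: eq_integral => y _; have /has_cintP[[]] := fk y.
rewrite -[LHS](integral21_prod_meas1 fi2) -kv2.2.
by apply: eq_integral => y _; have /has_cintP[_ []] := fk y.
Qed.

(** Applied after [has_cint_fubini], this reads the same double integral in the other order; the
    pair is how integrals are exchanged below. *)
Lemma has_cint_fubini_inv (f : T1 * T2 -> C) (k : T1 -> C) v :
  has_cint (m1 \x m2)%E f v ->
  (forall x, has_cint m2 (fun y => f (x, y)) (k x)) -> has_cint m1 k v.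
Proof.
move=> /has_cintP[f1 f2] fk; apply/has_cintP; split.
  by apply: (has_rint_fubini_inv f1) => x; have /has_cintP[] := fk x.
by apply: (has_rint_fubini_inv f2) => x; have /has_cintP[] := fk x.
Qed.

End fubini.
End has_cint.

(** * Complex powers and the Gamma function *)

Section power.
Variable R : realType.
Local Notation C := R[i].
Local Notation normc := (@Normc.normc R).

Lemma realcM (a b : R) : (a * b)%:C = a%:C * b%:C :> C.
Proof. exact: rmorphM. Qed.

Lemma realcB (a b : R) : (a - b)%:C = a%:C - b%:C :> C.
Proof. exact: rmorphB. Qed.

(* [cpow] extended by 0 to [x <= 0], which makes it multiplicative on
   nonnegative reals and keeps track of the domain of integration. *)
Definition pw (x : R) (z : C) : C := if 0 < x then cpow x z else 0.

Lemma pw_gt0 x z : 0 < x -> pw x z = cpow x z.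
Proof. by rewrite /pw => ->. Qed.

Lemma pw_le0 x z : x <= 0 -> pw x z = 0.
Proof. by rewrite /pw leNgt => /negbTE ->. Qed.

Lemma pwD x z w : pw x (z + w) = pw x z * pw x w.
Proof.
rewrite /pw; case: ifP => x0; last by rewrite mulr0.
rewrite /cpow; case: z w => a b [c d] /=.
rewrite powRD; last by rewrite (gt_eqF x0) implybT.
rewrite mulrDl cosD sinD; apply/eqP; rewrite eq_complex /=.
by apply/andP; split; apply/eqP; ring.
Qed.

Lemma pwM x y z : 0 <= x -> 0 <= y -> pw (x * y) z = pw x z * pw y z.
Proof.
rewrite !le_eqVlt => /orP[/eqP <-|x0].
  by rewrite mul0r pw_le0 // mul0r.
move=> /orP[/eqP <-|y0]; first by rewrite mulr0 pw_le0 // mulr0.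
rewrite !pw_gt0// ?mulr_gt0// /cpow powRM ?ltW// lnM ?posrE// mulrDr cosD sinD.
by apply/eqP; rewrite eq_complex /=; apply/andP; split; apply/eqP; ring.
Qed.

Lemma pw1 z : pw 1 z = 1.
Proof.
by rewrite pw_gt0// /cpow ln1 mulr0 cos0 sin0 powR1 mulr1 mulr0.
Qed.

Lemma pw0 x : 0 < x -> pw x 0 = 1.
Proof. by move=> x0; rewrite pw_gt0// /cpow /= powRr0 mul0r cos0 sin0 mulr1 mulr0. Qed.

Lemma pwN x z : 0 < x -> pw x (- z) = (pw x z)^-1.
Proof.
move=> x0; have : pw x z * pw x (- z) = 1 by rewrite -pwD subrr pw0.
move=> H; have z0 : pw x z != 0 by apply: contra_eq_neq H => ->; rewrite mul0r eq_sym oner_eq0.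
by rewrite -[RHS]mulr1 -H mulKf.
Qed.

Lemma pw_neq0 x z : 0 < x -> pw x z != 0.
Proof.
move=> x0; have : pw x z * pw x (- z) = 1 by rewrite -pwD subrr pw0.
by move=> H; apply: contra_eq_neq H => ->; rewrite mul0r eq_sym oner_eq0.
Qed.

Lemma pwV x z : 0 < x -> pw x^-1 z = pw x (- z).
Proof.
move=> x0; rewrite pwN//; apply: (mulIf (pw_neq0 z x0)).
by rewrite mulVf ?pw_neq0// -pwM ?invr_ge0 ?ltW// mulVf ?gt_eqF// pw1.
Qed.

Lemma pw_real x a : 0 < x -> pw x a%:C = (x `^ a)%:C.
Proof. by move=> x0; rewrite pw_gt0// /cpow /= mul0r cos0 sin0 mulr1 mulr0. Qed.

Lemma pwr1 x : 0 < x -> pw x 1 = x%:C.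
Proof. by move=> x0; rewrite -[1]/(1%:C) pw_real// powRr1// ltW. Qed.

Lemma pw_nat x n : 0 < x -> pw x n%:R = (x ^+ n)%:C.
Proof.
move=> x0; rewrite -powR_mulrn ?ltW// -pw_real//.
by rewrite rmorph_nat.
Qed.

Lemma normc_pw x z : (normc (pw x z))%:C = pw x (complex.Re z)%:C.
Proof.
have [x0|x0] := ltP 0 x; last by rewrite !pw_le0//= expr0n /= addr0 sqrtr0.
rewrite pw_real// pw_gt0// /cpow; congr (_%:C) => /=.
by rewrite !exprMn -mulrDr cos2Dsin2 mulr1 sqrtr_sqr ger0_norm ?powR_ge0.
Qed.

Lemma cmeasurable_pw d (T : measurableType d) (f : T -> R) z :
  measurable_fun setT f -> cmeasurable (fun x => pw (f x) z).
Proof.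
move=> mf.
have mpos : measurable_fun setT (fun x => 0 < f x) by exact: measurable_fun_ltr.
have mln : measurable_fun setT (fun x => complex.Im z * ln (f x)).
  apply: measurable_funM => //; exact: measurableT_comp.
have mp : measurable_fun setT (fun x => f x `^ complex.Re z).
  exact: (measurableT_comp (measurable_powR (complex.Re z)) mf).
split.
  rewrite (_ : (fun _ => _) = fun x => if 0 < f x then
      f x `^ complex.Re z * cos (complex.Im z * ln (f x)) else 0); last first.
    by apply/funext => x; rewrite /pw; case: ifP.
  apply: measurable_fun_ifT => //; apply: measurable_funM => //.
  apply: measurableT_comp => //; apply: continuous_measurable_fun.
  exact: continuous_cos.
rewrite (_ : (fun _ => _) = fun x => if 0 < f x then
    f x `^ complex.Re z * sin (complex.Im z * ln (f x)) else 0); last first.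
  by apply/funext => x; rewrite /pw; case: ifP.
apply: measurable_fun_ifT => //; apply: measurable_funM => //.
apply: measurableT_comp => //; apply: continuous_measurable_fun.
exact: continuous_sin.
Qed.

End power.

Section real_line.
Variable R : realType.
Local Notation mR := (measurableTypeR R).
Local Notation leb := (@lebesgue_measure R).

Lemma coordsys_R : coordsys leb (fun (x : mR) (_ : unit) => x : R).
Proof.
split.
- exists (fun t => tnth t (enum_rank tt)); split.
  + exact: measurable_tnth.
  + by move=> x; rewrite tnth_mktuple.
  + by move=> t [].
- by [].
- move=> A mA; rewrite (big_pred1 tt); last by case.
  congr (lebesgue_measure _); apply/seteqP; split => x /=; first exact.
  by move=> ? [].
Qed.

Lemma preserves_affine (a b : R) : a != 0 ->
  preserves leb leb (fun x : mR => a * x + b : mR) `|a|^-1.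
Proof.
move=> a0; have := coord_affine (phi := fun x : mR => a * x + b : mR) (sigma := id)
  (a := fun=> a) (b := fun=> b) coordsys_R coordsys_R.
rewrite (big_pred1 tt); last by case.
by apply => //; exists id.
Qed.

Let integral_exp_tail (x : R) :
  (\int[leb]_(t in [set` `[x, +oo[%R]) (expR (- t))%:E = (expR (- x))%:E)%E.
Proof.
have dF (t : R) : is_derive t 1 (fun t : R => - expR (- t) : R) (- (expR (- t) * - 1)).
  have d1 : is_derive t 1 (fun t : R => expR (- t) : R) (expR (- t) * - 1).
    exact: (is_derive1_comp (f := expR) (g := -%R)).
  exact: is_deriveN.
rewrite (@ge0_continuous_FTC2y _ _ (fun t => - expR (- t)) x 0)//.
- by rewrite sub0e -EFinN opprK.
- apply: continuous_subspaceT => t.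
  apply: (@continuous_comp _ _ _ (-%R) expR); first exact: opp_continuous.
  exact: continuous_expR.
- by rewrite -oppr0; apply: cvgN; exact: cvgr_expR.
- apply: cvg_at_right_filter; apply: cvgN.
  apply: (@continuous_comp _ _ _ (-%R) expR); first exact: opp_continuous.
  exact: continuous_expR.
- by move=> t _; rewrite derive1E; have [_ ->] := dF t; rewrite mulrN1 opprK.
Qed.

Let measurable_exp_opp : measurable_fun setT (fun t : mR => expR (- t) : R).
Proof. exact: measurableT_comp. Qed.

Lemma has_rint_exp_tail_le (x : R) :
  has_rint leb (fun t : mR => if x <= t then expR (- t) else 0) (expR (- x)).
Proof.
apply: has_rint_ge0.
- by apply: measurable_fun_ifT => //; exact: measurable_fun_ler.
- by move=> t; case: ifP => // _; exact: expR_ge0.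
rewrite -integral_exp_tail [RHS]integral_mkcond; apply: eq_integral => t _.
by rewrite patchE mem_setE in_itv /= andbT; case: ifP.
Qed.

Lemma has_rint_exp_tail (x : R) :
  has_rint leb (fun t : mR => if x < t then expR (- t) else 0) (expR (- x)).
Proof.
apply: has_rint_ge0.
- by apply: measurable_fun_ifT => //; exact: measurable_fun_ltr.
- by move=> t; case: ifP => // _; exact: expR_ge0.
rewrite -integral_exp_tail -integral_itv_obnd_cbnd; last first.
  by apply: measurable_funTS; exact/measurable_EFinP.
rewrite [RHS]integral_mkcond; apply: eq_integral => t _.
by rewrite patchE mem_setE in_itv /= andbT; case: ifP.
Qed.

End real_line.

(** * Integrals of complex powers between 0 and 1 *)

Section power_integral.
Variable R : realType.
Local Notation C := R[i].
Local Notation mR := (measurableTypeR R).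
Local Notation leb := (@lebesgue_measure R).

Let is_derive_arg (b x : R) : 0 < x ->
  is_derive x 1 (fun t : R => b * ln t : R) (b * x^-1).
Proof. by move=> x0; have := is_deriveZ b (is_derive1_ln x0). Qed.

Let powRB1 (a x : R) : 0 < x -> x `^ (a - 1) = x `^ a / x.
Proof.
move=> x0; rewrite powRD ?powR_inv1 ?ltW//.
by rewrite (gt_eqF x0) implybT.
Qed.

Lemma is_derive_cpow_Re (z : C) (x : R) : 0 < x ->
  is_derive x 1 (fun t : R => complex.Re (cpow t z) : R)
    (complex.Re (z * cpow x (z - 1))).
Proof.
move=> x0; case: z => a b.
have d1 := is_derive1_powR a x0.
have d2 := is_derive1_comp (f := cos) (g := fun t => b * ln t)
  (is_derive_cos (b * ln x)) (is_derive_arg b x0).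
apply: (is_derive_eq (is_deriveM d1 d2)).
rewrite /cpow /= subr0 powRB1//; rewrite !/GRing.scale /=.
by ring.
Qed.

Lemma is_derive_cpow_Im (z : C) (x : R) : 0 < x ->
  is_derive x 1 (fun t : R => complex.Im (cpow t z) : R)
    (complex.Im (z * cpow x (z - 1))).
Proof.
move=> x0; case: z => a b.
have d1 := is_derive1_powR a x0.
have d2 := is_derive1_comp (f := sin) (g := fun t => b * ln t)
  (is_derive_sin (b * ln x)) (is_derive_arg b x0).
apply: (is_derive_eq (is_deriveM d1 d2)).
rewrite /cpow /= subr0 powRB1//; rewrite !/GRing.scale /=.
by ring.
Qed.

Lemma continuous_cpow_Re (z : C) (x : R) : 0 < x ->
  {for x, continuous (fun t : R => complex.Re (cpow t z) : R)}.
Proof.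
move=> x0; apply: differentiable_continuous; apply/derivable1_diffP.
by have [] := is_derive_cpow_Re z x0.
Qed.

Lemma continuous_cpow_Im (z : C) (x : R) : 0 < x ->
  {for x, continuous (fun t : R => complex.Im (cpow t z) : R)}.
Proof.
move=> x0; apply: differentiable_continuous; apply/derivable1_diffP.
by have [] := is_derive_cpow_Im z x0.
Qed.

Let has_rint_itv (s : R) (f F : R -> R) : 0 < s < 1 ->
  (forall x : R, 0 < x -> {for x, continuous f}) ->
  (forall x : R, 0 < x -> is_derive x 1 F (f x)) ->
  measurable_fun setT (fun x : mR => if s <= x < 1 then f x else 0 : R) ->
  has_rint leb (fun x : mR => if s <= x < 1 then f x else 0) (F 1 - F s).
Proof.
move=> /andP[s0 s1] cf dF mf.
have gt0 x : s <= x -> 0 < x by exact: lt_le_trans.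
have cw : {within `[s, 1], continuous f}.
  apply: continuous_in_subspaceT => x; rewrite inE /= in_itv /= => /andP[sx _].
  by apply: cf; exact: gt0.
have Fc x : 0 < x -> {for x, continuous F}.
  move=> x0; apply: differentiable_continuous; apply/derivable1_diffP.
  by have [] := dF _ x0.
have E : (fun x : mR => (if s <= x < 1 then f x else 0)%:E) = (EFin \o f) \_ `[s, 1[.
  by apply/funext => x; rewrite patchE mem_setE in_itv /=; case: ifP.
have fi : leb.-integrable `[s, 1] (EFin \o f).
  by apply: (continuous_compact_integrable _ cw); exact: segment_compact.
have fi' : leb.-integrable `[s, 1[ (EFin \o f).
  apply: (@integrableS _ mR R leb `[s, 1] _ _ (measurable_itv _) (measurable_itv _)) => //.
  by move=> x /=; rewrite !in_itv /= => /andP[-> /ltW].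
split.
  rewrite (_ : _ \o _ = (EFin \o f) \_ `[s, 1[); last by rewrite -E.
  by have [+ _] := @integrable_mkcond _ mR R leb `[s, 1[ (EFin \o f) (measurable_itv _); apply.
rewrite E -integral_mkcond integral_itv_bndo_bndc; last by have /integrableP[] := fi'.
rewrite (continuous_FTC2 s1 cw (F := F)) ?EFinB//.
  split.
  - move=> x; rewrite in_itv /= => /andP[sx _].
    by have [] := dF _ (lt_trans s0 sx).
  - by apply: cvg_at_right_filter; apply: Fc.
  - by apply: cvg_at_left_filter; apply: Fc; exact: lt_trans s1.
move=> x; rewrite in_itv /= => /andP[sx _]; rewrite derive1E.
by have [_ ->] := dF _ (lt_trans s0 sx).
Qed.

Lemma has_cint_pw_itv (s : R) (z : C) : 0 < s < 1 ->
  has_cint leb (fun x : mR => if s <= x < 1 then z * pw x (z - 1) else 0) (1 - pw s z).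
Proof.
move=> s01; have /andP[s0 s1] := s01.
have mz : cmeasurable (fun x : mR => if s <= x < 1 then z * pw x (z - 1) else 0).
  have [m1 m2] : cmeasurable (fun x : mR => z * pw x (z - 1)).
    apply: cmeasurableM; first exact: cmeasurable_cst.
    exact: cmeasurable_pw.
  have mb : measurable_fun setT (fun x : mR => s <= x < 1).
    by apply: measurable_and; [exact: measurable_fun_ler|exact: measurable_fun_ltr].
  split.
    by under eq_fun do rewrite (fun_if (@complex.Re R)); exact: measurable_fun_ifT.
  by under eq_fun do rewrite (fun_if (@complex.Im R)); exact: measurable_fun_ifT.
have e1 x : complex.Re (if s <= x < 1 then z * pw x (z - 1) else 0) =
    if s <= x < 1 then complex.Re (z * cpow x (z - 1)) else 0.
  case: ifP => // /andP[sx _]; rewrite pw_gt0//; exact: lt_le_trans sx.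
have e2 x : complex.Im (if s <= x < 1 then z * pw x (z - 1) else 0) =
    if s <= x < 1 then complex.Im (z * cpow x (z - 1)) else 0.
  case: ifP => // /andP[sx _]; rewrite pw_gt0//; exact: lt_le_trans sx.
have [mz1 mz2] := mz.
have one : 1 = cpow 1 z by rewrite -pw_gt0// pw1.
have cRe (x : R) : 0 < x -> {for x, continuous (fun x => complex.Re (z * cpow x (z - 1)) : R)}.
  move=> x0; case: {e1 e2 one mz mz1 mz2}z => a b.
  rewrite (_ : (fun x => _) = (fun x => a * complex.Re (cpow x (a +i* b - 1)) -
    b * complex.Im (cpow x (a +i* b - 1)))); last first.
    by apply/funext => y; case: (cpow y _).
  apply: cvgB.
    by apply: cvgM; [exact: cvg_cst|exact: continuous_cpow_Re].
  by apply: cvgM; [exact: cvg_cst|exact: continuous_cpow_Im].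
have cIm (x : R) : 0 < x -> {for x, continuous (fun x => complex.Im (z * cpow x (z - 1)) : R)}.
  move=> x0; case: {e1 e2 one mz mz1 mz2 cRe}z => a b.
  rewrite (_ : (fun x => _) = (fun x => a * complex.Im (cpow x (a +i* b - 1)) +
    b * complex.Re (cpow x (a +i* b - 1)))); last first.
    by apply/funext => y; case: (cpow y _).
  apply: cvgD.
    by apply: cvgM; [exact: cvg_cst|exact: continuous_cpow_Im].
  by apply: cvgM; [exact: cvg_cst|exact: continuous_cpow_Re].
have mf1 : measurable_fun setT (fun x : mR =>
    if s <= x < 1 then complex.Re (z * cpow x (z - 1)) else 0 : R).
  by under eq_fun do rewrite -e1.
have mf2 : measurable_fun setT (fun x : mR =>
    if s <= x < 1 then complex.Im (z * cpow x (z - 1)) else 0 : R).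
  by under eq_fun do rewrite -e2.
apply/has_cintP; rewrite pw_gt0//; split.
  apply: (eq_has_rint (has_rint_itv s01 cRe (is_derive_cpow_Re z) mf1)).
    by move=> x; rewrite e1.
  by rewrite -one [RHS]raddfB.
apply: (eq_has_rint (has_rint_itv s01 cIm (is_derive_cpow_Im z) mf2)).
  by move=> x; rewrite e2.
by rewrite -one [RHS]raddfB.
Qed.

End power_integral.

Section power01.
Variable R : realType.
Local Notation C := R[i].
Local Notation mR := (measurableTypeR R).
Local Notation leb := (@lebesgue_measure R).
Local Notation normc := (@Normc.normc R).

(** The function x^(z - 1) on ]0, 1[ extended by zero to the line; the cut at 0 is hidden in
    [pw]. *)
Definition pw01 (z : C) (x : mR) : C := if x < 1 then pw x (z - 1) else 0.

Lemma cmeasurable_if d (T : measurableType d) (b : T -> bool) (f : T -> C) :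
  measurable_fun setT b -> cmeasurable f -> cmeasurable (fun x => if b x then f x else 0).
Proof.
move=> mb [mf1 mf2]; split.
  by under eq_fun do rewrite (fun_if (@complex.Re R)); exact: measurable_fun_ifT.
by under eq_fun do rewrite (fun_if (@complex.Im R)); exact: measurable_fun_ifT.
Qed.

Lemma cmeasurable_pw01 z : cmeasurable (pw01 z).
Proof.
apply: cmeasurable_if; first exact: measurable_fun_ltr.
exact: cmeasurable_pw.
Qed.

Lemma normc_pw01 z x : (normc (pw01 z x))%:C = pw01 (complex.Re z)%:C x.
Proof.
rewrite /pw01; case: ifP => _; last by rewrite /= expr0n /= addr0 sqrtr0.
by rewrite normc_pw [in LHS]raddfB rmorphB.
Qed.

Let pw01_ge0 (a : R) x : 0 <= complex.Re (pw01 a%:C x).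
Proof.
rewrite /pw01; case: ifP => // _; have [x0|x0] := ltP 0 x; last by rewrite pw_le0.
by rewrite -[1]/(1%:C) -rmorphB pw_real//= powR_ge0.
Qed.

(** Monotone convergence along the intervals [s, 1[ with s tending to 0: there the integral is (1 -
    s^a)/a, hence at most 1/a. *)
Let has_rint_pw01 (a : R) : 0 < a ->
  leb.-integrable setT (EFin \o (fun x => complex.Re (pw01 a%:C x))).
Proof.
move=> a0; have [mf _] := cmeasurable_pw01 a%:C.
(* The offset 2 keeps every [s n] strictly below 1. *)
pose s n : R := n.+2%:R^-1.
have s01 n : 0 < s n < 1 by rewrite invr_gt0 ltr0n /= invf_lt1 ?ltr0n// ltr1n.
pose g n (x : mR) := (complex.Re (if s n <= x < 1 then pw x (a%:C - 1) else 0))%:E.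
have gE n x : g n x = (a^-1 * complex.Re (if s n <= x < 1 then a%:C * pw x (a%:C - 1) else 0))%:E.
  rewrite /g; case: ifP => _; last by rewrite mulr0.
  case: (pw _ _) => u v /=; rewrite mul0r subr0 mulrA mulVf ?mul1r// gt_eqF//.
have ig n : (\int[leb]_x g n x <= (a^-1)%:E)%E.
  have /has_cintP[H _] := has_cint_pw_itv a%:C (s01 n).
  have [_] := has_rintZ a^-1 H.
  rewrite (eq_integral (g n)); last by move=> x _; rewrite gE.
  move=> ->; rewrite lee_fin ler_piMr ?invr_ge0 ?(ltW a0)//.
  have /andP[sn0 _] := s01 n; rewrite raddfB /= pw_real//= lerBlDr lerDl; exact: powR_ge0.
have mg n : measurable_fun setT (g n).
  apply/measurable_EFinP; apply: (cmeasurable_if _ (cmeasurable_pw _ _)).1 => //.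
  by apply: measurable_and; [exact: measurable_fun_ler|exact: measurable_fun_ltr].
have Re0 x : 0 <= complex.Re (pw x (a%:C - 1)).
  have [x0|x0] := ltP 0 x; last by rewrite pw_le0.
  by rewrite -[1]/(1%:C) -rmorphB pw_real//= powR_ge0.
have g0 n x : (0 <= g n x)%E by rewrite lee_fin; case: ifP.
have nd x : {homo g^~ x : n m / (n <= m)%N >-> (n <= m)%E}.
  move=> n m nm; rewrite lee_fin; case: ifP => [/andP[sx x1]|_]; last by case: ifP.
  by rewrite x1 andbT (le_trans _ sx)// lef_pV2 ?posrE ?ltr0n// ler_nat !ltnS.
apply/integrableP; split; first exact/measurable_EFinP.
under eq_integral do rewrite gee0_abs ?lee_fin//.
have lim x : limn (g^~ x) = (complex.Re (pw01 a%:C x))%:E.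
  apply/cvg_lim => //; apply: cvg_near_cst.
  rewrite /g /pw01; have [x1|x1] := ltP x 1; last by near=> n; rewrite andbF.
  have [x0|x0] := ltP 0 x; last first.
    by near=> n; rewrite pw_le0//; case: ifP.
  near=> n; rewrite andbT (_ : s n <= x) //.
  rewrite /s invf_ple ?posrE ?ltr0n//.
  apply: (le_trans (ltW (archi_boundP _))); first by rewrite invr_ge0 ltW.
  rewrite ler_nat; apply: leqW; apply: leqW; near: n; exact: nbhs_infty_ge.
have /cvg_lim <- // : (\int[leb]_x g n x)%E @[n --> \oo] -->
    (\int[leb]_x (complex.Re (pw01 a%:C x))%:E)%E.
  rewrite (eq_integral (fun x => limn (g^~ x))); last by move=> x _; rewrite lim.
  by apply: cvg_monotone_convergence => // x _; exact: nd.
apply: (@le_lt_trans _ _ (a^-1)%:E); last by rewrite ltry.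
apply: lime_le; last by near=> n; exact: ig.
apply: ereal_nondecreasing_is_cvgn => n m nm; apply: ge0_le_integral => //.
by move=> x _; exact: nd.
Unshelve. all: by end_near.
Qed.

(** Self-similarity replaces a limit at 0. Splitting the integral K at 1/2 and dilating the lower
    half by 2 gives K = q K + (1 - q)/z with q = 2^(-z). The modulus of q is 2^(-Re z), which
    differs from 1, so the equation determines K. *)
Lemma has_cint_pw01 (z : C) : 0 < complex.Re z -> has_cint leb (pw01 z) z^-1.
Proof.
move=> z0; have iz : cintegrable leb setT (pw01 z).
  apply: (cintegrable_le (cmeasurable_pw01 z) (has_rint_pw01 z0)) => x.
  by rewrite -normc_pw01.
pose K := cintegral leb setT (pw01 z).
have HK : has_cint leb (pw01 z) K by [].
have h01 : 0 < (2^-1 : R) < 1 by rewrite invr_gt0 invf_lt1 ?ltr0n// ltr1n.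
have H1 := has_cint_pw_itv z h01.
have two0 : (2 : R) != 0 by rewrite pnatr_eq0.
have z_neq0 : z != 0 by apply: contraTneq z0 => ->; rewrite ltxx.
have HD := preserves_affine 0 two0.
have n2 : 0 <= `|2 : R|^-1 by [].
pose q := pw (2^-1 : R) z.
have q1 : 1 - q != 0.
  rewrite subr_eq0 eq_sym; apply: contraTneq z0 => q1.
  have := normc_pw 2^-1 z; rewrite -/q q1 pw_real ?invr_gt0// => /complexI.
  rewrite /= expr0n /= addr0 expr1n sqrtr1 => /esym/eqP.
  rewrite powR_eq1 => /or3P[/eqP|h|/eqP ->]; [lra| |by rewrite ltxx].
  by exfalso; lra.
have c0 : pw 2 (1 - z) * (2^-1)%:C = q.
  rewrite pwD pwr1// mulrAC -rmorphM divff// mul1r /q pwV//.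
have := has_cintD (has_cintZ (pw 2 (1 - z)) (has_cint_preserves n2 HD HK))
  (has_cintZ z^-1 H1).
rewrite ger0_norm// mulrA c0 -/q => H.
have {H} : has_cint leb (pw01 z) (q * K + z^-1 * (1 - q)).
  apply: (eq_has_cint H) => // x /=; rewrite addr0 /pw01.
  have [x0|x0] := leP x 0.
    rewrite (pw_le0 _ x0) (@pw_le0 _ (2 * x)); last by rewrite pmulr_rle0.
    by rewrite !mulr0 !if_same !mulr0 addr0.
  have e : pw 2 (1 - z) * pw (2 * x) (z - 1) = pw x (z - 1).
    by rewrite pwM ?ltW// mulrA -pwD addrC subrKA subrr pw0// mul1r.
  have [x1|x1] := ltP x 2^-1.
    rewrite (_ : 2 * x < 1); last by rewrite -ltr_pdivlMl// mulr1.
    by rewrite e mulr0 addr0 (lt_trans x1) //; case/andP: h01.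
  rewrite (_ : 2 * x < 1 = false); last first.
    by apply/negbTE; rewrite -leNgt -ler_pdivrMl// mulr1.
  rewrite mulr0 add0r.
  by case: (x < 1) => /=; rewrite ?mulr0 ?mulKf.
move=> /(has_cint_unique HK) KE.
rewrite (_ : z^-1 = K) //; apply: (mulIf q1).
have -> : z^-1 * (1 - q) = K - q * K by rewrite {1}KE addrAC subrr add0r.
by ring.
Qed.

End power01.

(** * Convergence and functional equation of Euler's integral *)

Section gamma.
Variable R : realType.
Local Notation C := R[i].
Local Notation mR := (measurableTypeR R).
Local Notation leb := (@lebesgue_measure R).
Local Notation normc := (@Normc.normc R).

Definition gamma_fun (z : C) (x : mR) : C := pw x (z - 1) * (expR (- x))%:C.

Lemma cGammaE z : cGamma z = cintegral leb setT (gamma_fun z).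
Proof.
rewrite /cGamma /cintegral; congr (_ +i* _); rewrite Rintegral_mkcond;
  congr Rintegral; apply/funext => x; rewrite patchE mem_setE in_itv /= andbT;
  rewrite /gamma_fun /pw; case: ifP => // _; by rewrite mul0r.
Qed.

Lemma measurable_expN : measurable_fun setT (fun x : mR => expR (- x) : R).
Proof. exact: measurableT_comp. Qed.

Lemma cmeasurable_gamma_fun z : cmeasurable (gamma_fun z).
Proof.
apply: cmeasurableM; first exact: cmeasurable_pw.
by apply: cmeasurable_real; exact: measurable_expN.
Qed.

Lemma normc_real (a : R) : 0 <= a -> normc a%:C = a.
Proof. by move=> a0; rewrite /= expr0n /= addr0 sqrtr_sqr ger0_norm. Qed.

Lemma normc_gamma_fun z x : (normc (gamma_fun z x))%:C = gamma_fun (complex.Re z)%:C x.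
Proof.
rewrite /gamma_fun normcM realcM normc_pw [in LHS]raddfB realcB; congr (_ * _).
by rewrite normc_real// expR_ge0.
Qed.

Lemma gamma_fun_real (a : R) x : 0 < x ->
  gamma_fun a%:C x = (x `^ (a - 1) * expR (- x))%:C.
Proof. by move=> x0; rewrite /gamma_fun -[1]/(1%:C) -realcB pw_real// -realcM. Qed.

Let ln_le (u : R) : 0 < u -> ln u <= u - 1.
Proof.
move=> u0; have := expR_ge1Dx (ln u); rewrite lnK ?posrE// => h.
by rewrite lerBrDl.
Qed.

(** From ln u <= u - 1 at u = x/(2a) follows (a - 1) ln x <= x/2 + (a - 1) ln(2a); this uses a >= 1.
    The integrand is thus dominated by a constant times exp(-x/2). *)
Let cintegrable_gamma_ge1 (z : C) : 1 <= complex.Re z -> cintegrable leb setT (gamma_fun z).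
Proof.
move=> a1; set a := complex.Re z in a1.
have half0 : (2^-1 : R) != 0 by rewrite invr_neq0.
have n2 : 0 <= `|2^-1 : R|^-1 by [].
have /has_cintP[H _] := has_cint_preserves n2 (preserves_affine 0 half0)
  (has_cint_real (has_rint_exp_tail 0)).
have [H1 _] := has_rintZ (expR ((a - 1) * ln (2 * a))) H.
apply: (cintegrable_le (cmeasurable_gamma_fun z) H1) => x.
rewrite /= addr0; have [x0|x0] := ltP 0 x; last first.
  rewrite (_ : (0 < _) = false) ?mulr0; last by apply/negbTE; rewrite -leNgt pmulr_rle0.
  by rewrite /gamma_fun pw_le0// mul0r /= expr0n /= addr0 sqrtr0.
rewrite mulr_gt0 ?invr_gt0//.
have := normc_gamma_fun z x; rewrite gamma_fun_real// => /complexI ->.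
have a0 : 0 < a by exact: lt_le_trans a1.
rewrite /powR gt_eqF// -!expRD ler_expR -/a.
have := ln_le (divr_gt0 x0 (mulr_gt0 (ltr0Sn R 1) a0)).
rewrite ln_div ?posrE ?mulr_gt0// => h.
have {}h : ln x <= x / (2 * a) + ln (2 * a) by lra.
have {}h : (a - 1) * ln x <= (a - 1) * (x / (2 * a) + ln (2 * a)).
  by apply: ler_wpM2l => //; rewrite subr_ge0.
have h2 : (a - 1) * (x / (2 * a)) <= 2^-1 * x.
  rewrite (_ : (a - 1) * _ = 2^-1 * x - x / (2 * a)); last by field; rewrite gt_eqF.
  by rewrite gerBl divr_ge0 ?ltW// mulr_gt0.
lra.
Qed.

(** The double integral of x^(z - 1) exp(-t) over 0 < x < t is taken in both orders: over x first it
    gives t^z exp(-t)/z, over t first it gives the integrand of Gamma(z). So convergence descends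
    from z + 1 to z together with the functional equation. The second integrability hypothesis
    serves the modulus. *)
Let gamma_step (z : C) : 0 < complex.Re z -> cintegrable leb setT (gamma_fun (z + 1)) ->
  cintegrable leb setT (gamma_fun ((complex.Re z)%:C + 1)) ->
  has_cint leb (gamma_fun z) (z^-1 * cGamma (z + 1)).
Proof.
move=> z0 i1 i2.
pose f (z : C) (p : mR * mR) : C :=
  pw p.1 (z - 1) * (if p.1 < p.2 then (expR (- p.2))%:C else 0).
have inner w t : 0 < complex.Re w ->
    has_cint leb (fun x => f w (x, t)) (w^-1 * gamma_fun (w + 1) t).
  move=> w0; have [t0|t0] := ltP 0 t; last first.
    apply: (eq_has_cint (has_cintZ 0 (has_cint_pw01 w0))) => [x|].
      rewrite mul0r /f /=; case: ifP => [xt|]; last by rewrite mulr0.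
      by rewrite pw_le0 ?mul0r// ltW// (lt_le_trans xt).
    by rewrite /gamma_fun pw_le0// !mul0r mulr0.
  have t0' : t^-1 != 0 by rewrite invr_neq0// gt_eqF.
  have nt : 0 <= `|t^-1|^-1 by [].
  have := has_cintZ ((expR (- t))%:C * pw t (w - 1))
    (has_cint_preserves nt (preserves_affine 0 t0') (has_cint_pw01 w0)).
  rewrite ger0_norm ?invr_ge0 ?ltW// invrK => H.
  apply: (eq_has_cint H) => [x|].
    rewrite /f /pw01 /= addr0; have [x0|x0] := ltP 0 x; last first.
      rewrite (@pw_le0 _ (t^-1 * x)); last by rewrite pmulr_rle0 ?invr_gt0.
      by rewrite (pw_le0 _ x0) if_same mulr0 mul0r.
    rewrite ltr_pdivrMl// mulr1; case: ifP => _; last by rewrite !mulr0.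
    rewrite pwM ?invr_ge0 ?ltW// pwV// mulrA -(mulrA (expR _)%:C) -pwD subrr pw0//.
    by rewrite mulr1 mulrC.
  rewrite /gamma_fun addrK.
  have -> : pw t w = pw t (w - 1) * t%:C by rewrite -{1}(subrK 1 w) pwD pwr1.
  by ring.
have mf : cmeasurable (f z).
  apply: cmeasurableM; first by apply: cmeasurable_pw; exact: measurable_fst.
  apply: cmeasurable_if.
    by apply: measurable_fun_ltr; [exact: measurable_fst|exact: measurable_snd].
  by apply: cmeasurable_real; exact: (measurableT_comp measurable_expN measurable_snd).
have nf x t : (normc (f z (x, t)))%:C = f (complex.Re z)%:C (x, t).
  rewrite /f normcM realcM normc_pw [in LHS]raddfB realcB; congr (_ * _).
  by case: ifP => _; rewrite (@normc_real 0, normc_real)// expR_ge0.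
have F : has_cint (leb \x leb)%E (f z) (z^-1 * cGamma (z + 1)).
  apply: (has_cint_fubini mf (h := fun t => (complex.Re z)%:C^-1 * gamma_fun ((complex.Re z)%:C + 1) t)
     (k := fun t => z^-1 * gamma_fun (z + 1) t)).
  - move=> t; exact: (eq_has_cint (inner (complex.Re z)%:C t z0)).
  - by apply: has_cintZ; split.
  - by move=> t; exact: inner.
  - by apply: has_cintZ; split => //; rewrite cGammaE.
apply: (has_cint_fubini_inv F) => x.
apply: (eq_has_cint (has_cintZ (pw x (z - 1)) (has_cint_real (has_rint_exp_tail x)))) => // t.
by rewrite /f /=; case: ifP.
Qed.

Lemma has_cint_gamma (z : C) : 0 < complex.Re z -> has_cint leb (gamma_fun z) (cGamma z).
Proof.
move=> z0; have [] := @gamma_step z z0.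
- by apply: cintegrable_gamma_ge1; rewrite raddfD /= lerDr ltW.
- by apply: cintegrable_gamma_ge1; rewrite /= lerDr ltW.
- by move=> i _; split => //; rewrite cGammaE.
Qed.

Lemma cGammaS (z : C) : 0 < complex.Re z -> cGamma (z + 1) = z * cGamma z.
Proof.
move=> z0; have H : has_cint leb (gamma_fun z) (z^-1 * cGamma (z + 1)).
  apply: gamma_step => //; apply: cintegrable_gamma_ge1; first by rewrite raddfD /= lerDr ltW.
  by rewrite /= lerDr ltW.
rewrite (has_cint_unique (has_cint_gamma z0) H) mulVKf//.
by apply: contraTneq z0 => ->; rewrite ltxx.
Qed.

End gamma.

(** * Non-vanishing of Gamma on the right half-plane *)

Section gamma_neq0.
Variable R : realType.
Local Notation C := R[i].
Local Notation mR := (measurableTypeR R).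
Local Notation leb := (@lebesgue_measure R).

Lemma has_rint_le d (T : measurableType d) (mu : {measure set T -> \bar R})
    (f g : T -> R) v w :
  has_rint mu f v -> has_rint mu g w -> (forall x, f x <= g x) -> v <= w.
Proof.
move=> [fi fv] [gi gw] fg; rewrite -lee_fin -fv -gw.
by apply: le_integral => // x _; rewrite lee_fin.
Qed.

Let G (s : R) : R := complex.Re (cGamma s%:C).
Let g (s : R) (x : mR) : R := complex.Re (gamma_fun s%:C x).

Let has_rint_g s : 0 < s -> has_rint leb (g s) (G s).
Proof. by move=> s0; have /has_cintP[] := @has_cint_gamma R s%:C s0. Qed.

Let G_S s : 0 < s -> G (s + 1) = s * G s.
Proof.
move=> s0; rewrite /G (_ : (s + 1)%:C = s%:C + 1) ?rmorphD// cGammaS//.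
by case: (cGamma _) => a b /=; rewrite mul0r subr0.
Qed.

Let g_gt0 s x : 0 < x -> g s x = x `^ (s - 1) * expR (- x).
Proof. by move=> x0; rewrite /g gamma_fun_real. Qed.

Let g_le0 s x : x <= 0 -> g s x = 0.
Proof. by move=> x0; rewrite /g /gamma_fun pw_le0// mul0r. Qed.

Let g_ge0 s x : 0 <= g s x.
Proof.
have [x0|x0] := ltP 0 x; last by rewrite g_le0.
by rewrite g_gt0// mulr_ge0 ?powR_ge0 ?expR_ge0.
Qed.

Let has_rint_itv12 : has_rint leb (fun x : mR => if 1 <= x < 2 then 1 else 0) (1 : R).
Proof.
apply: has_rint_ge0.
- apply: measurable_fun_ifT => //.
  by apply: measurable_and; [exact: measurable_fun_ler|exact: measurable_fun_ltr].
- by move=> x; case: ifP.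
transitivity (\int[leb]_(x in [set` `[(1:R), 2[%R]) (cst 1%:E x))%E.
  rewrite [RHS]integral_mkcond; apply: eq_integral => t _.
  by rewrite patchE mem_setE in_itv /=; case: ifP.
rewrite integral_cst//= lebesgue_measure_itv /= lte_fin ltr1n mul1e -EFinB.
by congr (_%:E); ring.
Qed.

(** On [1, 2[ the integrand is at least exp(-2), because its power factor is at least 1 when s >=
    1. *)
Let G_pos s : 1 <= s -> 0 < G s.
Proof.
move=> s1; have s0 : 0 < s by exact: lt_le_trans s1.
apply: (@lt_le_trans _ _ (expR (- 2) * 1)); first by rewrite mulr1 expR_gt0.
apply: (has_rint_le (has_rintZ _ has_rint_itv12) (has_rint_g s0)) => x.
case: ifP => [/andP[x1 x2]|_]; last by rewrite mulr0.
rewrite mulr1 g_gt0 ?(lt_le_trans _ x1)// -[leLHS]mul1r.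
apply: ler_pM => //.
  have : x `^ 0 <= x `^ (s - 1) by apply: ler_powR; rewrite ?subr_ge0.
  by rewrite powRr0.
by rewrite ler_expR lerN2 ltW.
Qed.

Let sin_le (v : R) : sin v ^+ 2 <= v ^+ 2.
Proof.
wlog v0 : v / 0 <= v => [H|].
  have [/H//|v0] := leP 0 v.
  by have := H (- v); rewrite sinN !sqrrN; apply; rewrite oppr_ge0 ltW.
have [c _] := @MVT_segment R sin cos 0 v v0 (fun x _ => is_derive_sin x)
  (continuous_subspaceT (@continuous_sin R)).
by rewrite sin0 !subr0 => ->; rewrite exprMn ler_piMl ?sqr_ge0//.
Qed.

Let cos_ge (u : R) : 1 - u ^+ 2 / 2 <= cos u.
Proof.
have -> : cos u = 1 - 2 * sin (u / 2) ^+ 2.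
  have {1}-> : u = (u / 2) *+ 2 by rewrite -mulr_natr divfK// pnatr_eq0.
  by rewrite cos_mulr2n cos2sin2; ring.
have := sin_le (u / 2) => h.
by lra.
Qed.

(* [|v| <= |e^v - e^-v|] with [u = e^(2v)] *)
Let ln_sqr (u : R) : 0 < u -> ln u ^+ 2 <= 4 * (u + u^-1 - 2).
Proof.
move=> u0; pose v := ln u / 2; have -> : ln u = 2 * v by rewrite /v; field.
have uE : u = expR v ^+ 2.
  by rewrite expr2 -expRD -[LHS]lnK ?posrE//; congr expR; rewrite /v; field.
have -> : 4 * (u + u^-1 - 2) = 4 * (expR v - expR (- v)) ^+ 2.
  by rewrite uE expRN; field; rewrite gt_eqF// expR_gt0.
rewrite exprMn (_ : 2 ^+ 2 = 4); last by ring.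
rewrite ler_pM2l//.
have aux (w : R) : 0 <= w -> w ^+ 2 <= (expR w - expR (- w)) ^+ 2.
  move=> w0; have h1 := expR_ge1Dx w.
  have h2 : expR (- w) <= 1 by rewrite -expR0 ler_expR oppr_le0.
  have h3 : w <= expR w - expR (- w) by lra.
  by apply: lerXn2r; rewrite ?nnegrE// (le_trans w0).
have [v0|v0] := leP 0 v; first exact: aux.
have := aux (- v); rewrite sqrrN opprK => h; rewrite -(opprB (expR (- v))) sqrrN.
by apply: h; rewrite oppr_ge0 ltW.
Qed.

(* The Gamma density concentrates around [a], where the phase [t^(ib)] hardly
   turns once [a] is large. *)
Let cGamma_neq0_large (a b : R) : 1 + 2 * b ^+ 2 < a -> cGamma (a +i* b) != 0 :> C.
Proof.
move=> hab; have b2 := sqr_ge0 b.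
have a1 : 1 < a by lra.
have a0 : 0 < a by lra.
have am1 : 0 < a - 1 by lra.
apply/eqP => G0.
have := has_cintZ (pw a (0 -i* b)) (@has_cint_gamma R (a +i* b) a0).
rewrite G0 mulr0 => /has_cintP[/= H _].
have G1 := G_S am1; rewrite subrK in G1.
(* After multiplication by a^(-ib) the real part of the integrand is g_a(x) cos(b ln(x/a)), at least
   g_a(x) (1 - 2 b^2 (x/a + a/x - 2)) by [cos_ge] and [ln_sqr]. Multiplying g_a by x or 1/x shifts
   its parameter by one, so this bound is a combination of three Gamma integrals; by the functional
   equation its value is G(a - 1) (a - 1 - 2 b^2). *)
have L := has_rintD (has_rintZ (1 + 4 * b ^+ 2) (has_rint_g a0))
  (has_rintZ (- (2 * b ^+ 2)) (has_rintD (has_rintZ a^-1 (has_rint_g (addr_gt0 a0 ltr01)))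
    (has_rintZ a (has_rint_g am1)))).
have pt x : (1 + 4 * b ^+ 2) * g a x +
    - (2 * b ^+ 2) * (a^-1 * g (a + 1) x + a * g (a - 1) x) <=
    complex.Re (pw a (0 -i* b) * gamma_fun (a +i* b) x).
  have [x0|x0] := ltP 0 x; last first.
    by rewrite !g_le0// /gamma_fun (pw_le0 _ x0) mul0r !mulr0 addr0 mulr0 addr0.
  have -> : complex.Re (pw a (0 -i* b) * gamma_fun (a +i* b) x) =
      g a x * cos (b * ln (x / a)).
    rewrite g_gt0// /gamma_fun !pw_gt0// /cpow /= oppr0 powRr0 ln_div ?posrE//.
    rewrite addr0 (mulrBr b) cosB mulNr cosN sinN; ring.
  have -> : g (a + 1) x = x * g a x.
    rewrite !g_gt0// (_ : a + 1 - 1 = 1 + (a - 1)); last by ring.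
    rewrite (@powRD _ x 1 (a - 1)); last by rewrite (gt_eqF x0) implybT.
    by rewrite powRr1 ?(ltW x0)// mulrA.
  have -> : g (a - 1) x = x^-1 * g a x.
    rewrite !g_gt0// (addrC (a - 1)) (@powRD _ x (- 1) (a - 1)); last by rewrite (gt_eqF x0) implybT.
    by rewrite powR_inv1 ?(ltW x0)// mulrA.
  have -> : (1 + 4 * b ^+ 2) * g a x +
      - (2 * b ^+ 2) * (a^-1 * (x * g a x) + a * (x^-1 * g a x)) =
      g a x * (1 - b ^+ 2 * (4 * (x / a + (x / a)^-1 - 2)) / 2).
    by field; rewrite !gt_eqF.
  apply: ler_wpM2l; first exact: g_ge0.
  apply: le_trans (cos_ge _); rewrite exprMn lerD2l lerN2 ler_pM2r ?invr_gt0//.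
  by apply: ler_wpM2l => //; apply: ln_sqr; rewrite divr_gt0.
have h := has_rint_le L H pt.
have Gp : 0 < G a by apply: G_pos; rewrite ltW.
have G2 : 0 < G (a - 1) by move: Gp; rewrite G1 pmulr_rgt0.
move: h; rewrite G_S// mulKf ?gt_eqF// G1.
have -> : (1 + 4 * b ^+ 2) * ((a - 1) * G (a - 1)) +
    - (2 * b ^+ 2) * ((a - 1) * G (a - 1) + a * G (a - 1)) =
    G (a - 1) * (a - 1 - 2 * b ^+ 2) by ring.
by rewrite leNgt mulr_gt0// subr_gt0; lra.
Qed.

(** The functional equation raises the real part by an integer while the imaginary part stays fixed,
    until the real part exceeds 1 + 2 (Im z)^2. A zero at [z] would propagate along this shift. *)
Theorem cGamma_neq0 (z : C) : 0 < complex.Re z -> cGamma z != 0.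
Proof.
move=> z0.
have H m : cGamma (z + m%:R) != 0 -> cGamma z != 0.
  elim: m => [|m IH]; first by rewrite addr0.
  rewrite -natr1 addrA cGammaS ?mulf_eq0 ?negb_or => [/andP[_]//|].
  rewrite raddfD /= -[m%:R]/((m%:R : C)) -(rmorph_nat (real_complex R)) /=.
  by rewrite ltr_wpDr.
pose m := Num.bound (1 + 2 * complex.Im z ^+ 2).
apply: (H m); case: z {H} z0 @m => a b /= a0.
rewrite -(rmorph_nat (real_complex R)) /= /GRing.add /= addr0.
apply: cGamma_neq0_large.
apply: (lt_le_trans (archi_boundP _)); first by rewrite addr_ge0// mulr_ge0// sqr_ge0.
by rewrite lerDr ltW.
Qed.

End gamma_neq0.

(** * Hermitian forms and Gram determinants *)

Section posdef.
Variable R : realType.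
Local Notation C := R[i].
Local Notation normc := (@Normc.normc R).

Lemma adjmxM n p q (A : 'M[C]_(n, p)) (B : 'M[C]_(p, q)) :
  (A *m B)^t* = B^t* *m A^t*.
Proof. by rewrite trmx_mul map_mxM. Qed.

Lemma adjmxD n p (A B : 'M[C]_(n, p)) : (A + B)^t* = A^t* + B^t*.
Proof. by rewrite linearD map_mxD. Qed.

Lemma adjmxB n p (A B : 'M[C]_(n, p)) : (A - B)^t* = A^t* - B^t*.
Proof. by rewrite linearB map_mxB. Qed.

Lemma adjmx1 n : (1%:M : 'M[C]_n)^t* = 1%:M.
Proof. by rewrite trmx1 map_mx1. Qed.

Lemma adjmx0 n p : (0 : 'M[C]_(n, p))^t* = 0.
Proof. by rewrite trmx0 map_mx0. Qed.

Lemma adjmx_block a b c d (A : 'M[C]_(a, c)) (B : 'M[C]_(a, d)) (D : 'M[C]_(b, c))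
    (E : 'M[C]_(b, d)) : (block_mx A B D E)^t* = block_mx (A^t*) (D^t*) (B^t*) (E^t*).
Proof. by rewrite tr_block_mx map_block_mx. Qed.

Lemma adjmx_col a b c (A : 'M[C]_(a, c)) (B : 'M[C]_(b, c)) :
  (col_mx A B)^t* = row_mx (A^t*) (B^t*).
Proof. by rewrite tr_col_mx map_row_mx. Qed.

Lemma adjmx_row a b c (A : 'M[C]_(a, b)) (B : 'M[C]_(a, c)) :
  (row_mx A B)^t* = col_mx (A^t*) (B^t*).
Proof. by rewrite tr_row_mx map_col_mx. Qed.

Lemma adjmx_unit n (T : 'M[C]_n) : (T^t* \in unitmx) = (T \in unitmx).
Proof. by rewrite map_unitmx unitmx_tr. Qed.

Lemma det_adjmx n (T : 'M[C]_n) : \det (T^t*) = (\det T)^*.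
Proof. by rewrite det_map_mx det_tr. Qed.

Lemma conjM_normc (x : C) : x^* * x = (normc x ^+ 2)%:C.
Proof.
case: x => a b /=; rewrite sqr_sqrtr; last by rewrite addr_ge0 ?sqr_ge0.
by apply/eqP; rewrite eq_complex /=; apply/andP; split; apply/eqP; ring.
Qed.

Lemma normc_eq0 (x : C) : (normc x == 0) = (x == 0).
Proof.
by apply/eqP/eqP => [/Normc.eq0_normc//|->]; rewrite /= expr0n /= addr0 sqrtr0.
Qed.

Lemma normc_conj (x : C) : normc (x^*) = normc x.
Proof. by case: x => a b /=; rewrite sqrrN. Qed.

Lemma hermsymmxE n (A : 'M[C]_n) : (A \is hermsymmx) = (A == A^t*).
Proof. by rewrite is_hermitianmxE expr0 scale1r. Qed.

Lemma adjmxK n p (A : 'M[C]_(n, p)) : (A^t*)^t* = A.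
Proof. exact: trmxCK. Qed.

(** The squared Frobenius norm, that is, the trace of X^* X ([trace_gram]). *)
Definition mxnorm2 n p (X : 'M[C]_(n, p)) : R := \sum_i \sum_j normc (X i j) ^+ 2.

Lemma mxnorm2_ge0 n p (X : 'M[C]_(n, p)) : 0 <= mxnorm2 X.
Proof. by apply: sumr_ge0 => i _; apply: sumr_ge0 => j _; exact: sqr_ge0. Qed.

Lemma mxnorm2_eq0 n p (X : 'M[C]_(n, p)) : (mxnorm2 X == 0) = (X == 0).
Proof.
apply/eqP/eqP => [X0|->]; last first.
  rewrite /mxnorm2 big1 // => i _; rewrite big1// => j _.
  by rewrite mxE /= expr0n /= addr0 sqrtr0 expr0n.
apply/matrixP => i j; rewrite mxE; apply/eqP.
move/eqP: X0; rewrite psumr_eq0; last by move=> k _; apply: sumr_ge0 => l _; exact: sqr_ge0.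
move=> /allP/(_ i (mem_index_enum _))/implyP/(_ isT).
rewrite psumr_eq0; last by move=> l _; exact: sqr_ge0.
move=> /allP/(_ j (mem_index_enum _))/implyP/(_ isT).
by rewrite sqrf_eq0 normc_eq0.
Qed.

Lemma trace_gram n p (X : 'M[C]_(n, p)) : \tr (X^t* *m X) = (mxnorm2 X)%:C.
Proof.
rewrite /mxnorm2 /mxtrace exchange_big rmorph_sum; apply: eq_bigr => j _.
rewrite mxE rmorph_sum; apply: eq_bigr => i _.
by rewrite !mxE conjM_normc.
Qed.

Lemma gram_cV n (w : 'cV[C]_n) : (w^t* *m w) 0 0 = (mxnorm2 w)%:C.
Proof. by rewrite -trace_gram /mxtrace big_ord1. Qed.

Lemma mxnorm2_row n p q (X : 'M[C]_(n, p)) (Y : 'M[C]_(n, q)) :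
  mxnorm2 (row_mx X Y) = mxnorm2 X + mxnorm2 Y.
Proof.
rewrite /mxnorm2 -big_split; apply: eq_bigr => i _ /=; rewrite big_split_ord.
by congr (_ + _); apply: eq_bigr => j _; rewrite ?row_mxEl ?row_mxEr.
Qed.

Lemma mxnorm2_col n p q (X : 'M[C]_(n, p)) (Y : 'M[C]_(q, p)) :
  mxnorm2 (col_mx X Y) = mxnorm2 X + mxnorm2 Y.
Proof.
rewrite /mxnorm2 big_split_ord.
by congr (_ + _); apply: eq_bigr => i _; apply: eq_bigr => j _; rewrite ?col_mxEu ?col_mxEd.
Qed.

Lemma hermposdef_gram n p (T : 'M[C]_(n, p)) :
  (forall v : 'cV_p, T *m v = 0 -> v = 0) -> hermposdefmx (T^t* *m T).
Proof.
move=> Tinj; split; first by rewrite hermsymmxE adjmxM adjmxK.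
move=> v v0; rewrite mulmxA -adjmxM -mulmxA gram_cV ltcR lt_def mxnorm2_ge0 andbT.
by rewrite mxnorm2_eq0; apply: contraNneq v0 => /Tinj ->.
Qed.

Lemma hermposdef_ul a b (A : 'M[C]_(a + b)) : hermposdefmx A -> hermposdefmx (ulsubmx A).
Proof.
move=> [hA pA]; split.
  move: hA; rewrite !hermsymmxE -{1 2}[A]submxK adjmx_block => /eqP/eq_block_mx[<- _ _ _].
  by rewrite eqxx.
move=> v v0; rewrite (_ : _ *m _ = (col_mx v 0)^t* *m A *m col_mx v 0); last first.
  rewrite -{2}[A]submxK adjmx_col adjmx0.
  by rewrite mul_row_block !mul0mx !addr0 mul_row_col mulmx0 addr0.
apply: pA; by apply: contraNneq v0 => /eqP; rewrite col_mx_eq0 => /andP[].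
Qed.

(* One step of the block Cholesky factorization: [D] is the Schur complement. *)
Lemma hermposdef_schur a b (A : 'M[C]_(a + b)) (T : 'M[C]_a) :
  hermposdefmx A -> ulsubmx A = T^t* *m T -> T \in unitmx ->
  exists (E : 'M[C]_(a, b)) (D : 'M[C]_b), hermposdefmx D /\
    forall S : 'M[C]_b, D = S^t* *m S ->
      A = (block_mx T E 0 S)^t* *m block_mx T E 0 S.
Proof.
move=> [hA pA] AT uT.
have uT' : T^t* \in unitmx by rewrite adjmx_unit.
pose E := invmx (T^t*) *m ursubmx A.
have [hl hr] : dlsubmx A = (ursubmx A)^t* /\ drsubmx A = (drsubmx A)^t*.
  move: hA; rewrite hermsymmxE -{1 2}[A]submxK adjmx_block => /eqP/eq_block_mx[_ _ <- <-].
  by [].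
have TE : T^t* *m E = ursubmx A by rewrite mulKVmx.
have ET : E^t* *m T = dlsubmx A by rewrite hl -TE [RHS]adjmxM adjmxK.
clearbody E; pose D := drsubmx A - E^t* *m E.
pose F : 'M[C]_(a + b) := block_mx T E 0 1%:M.
have AF : A = F^t* *m block_mx 1%:M 0 0 D *m F.
  rewrite adjmx_block adjmx0 adjmx1 mulmx_block !mulmx1 !mulmx0 !mul0mx !addr0 !add0r mul1mx.
  rewrite mulmx_block !mulmx0 !addr0 !mulmx1 ?addr0 -AT TE ET.
  by rewrite /D addrCA subrr addr0 submxK.
exists E, D; split; last first.
  move=> S DS; rewrite adjmx_block adjmx0 mulmx_block !mul0mx !mulmx0 !addr0.
  by rewrite -AT TE ET -DS /D addrCA subrr addr0 submxK.
split; first by rewrite hermsymmxE /D adjmxB -hr adjmxM adjmxK.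
(* The upper part of [u] is chosen so that F u = (0, v); the form of [A] at [u] is then the form of
   [D] at [v]. *)
move=> v v0; pose u := col_mx (- (invmx T *m (E *m v))) v.
have Fu : F *m u = col_mx 0 v.
  by rewrite mul_block_col mulmxN mulKVmx// addNr mul0mx mul1mx add0r.
have := pA u; rewrite AF !mulmxA -adjmxM -!mulmxA Fu adjmx_col adjmx0.
rewrite mul_block_col !mul0mx !mulmx0 addr0 add0r mul_row_col mul0mx add0r mulmxA; apply.
by apply: contraNneq v0 => /eqP; rewrite col_mx_eq0 => /andP[].
Qed.

Lemma block_ublock_unit a b (T : 'M[C]_a) (E : 'M[C]_(a, b)) (S : 'M[C]_b) :
  T \in unitmx -> S \in unitmx -> block_mx T E 0 S \in unitmx.
Proof. by rewrite !unitmxE det_ublock unitrM => -> ->. Qed.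

(** Induction with a 1 x 1 pivot: the pivot is positive, so its square root is self-conjugate and
    factors the corner as T^* T. *)
Theorem cholesky n (A : 'M[C]_n) : hermposdefmx A ->
  exists2 T : 'M[C]_n, T \in unitmx & A = (T^t*) *m T.
Proof.
elim: n A => [|n IH] A pA.
  by exists 1%:M; [exact: unitmx1|rewrite [A]flatmx0 [RHS]flatmx0].
have [_ /(_ 1%:M)] := @hermposdef_ul 1 n A pA.
rewrite adjmx1 mul1mx mulmx1 oner_eq0 => /(_ isT) c0.
set c := (ulsubmx _ _ _) in c0.
have cc : Num.conj (sqrtC c) = sqrtC c by apply: geC0_conj; rewrite sqrtC_ge0 ltW.
pose T : 'M[C]_1 := (sqrtC c)%:M.
have uT : T \in unitmx by rewrite unitmxE det_scalar1 unitfE sqrtC_eq0 gt_eqF.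
have AT : ulsubmx (A : 'M[C]_(1 + n)) = T^t* *m T.
  rewrite [LHS]mx11_scalar -/c tr_scalar_mx map_scalar_mx /= cc.
  by rewrite -scalar_mxM -expr2 sqrtCK.
have [E [D [pD HD]]] := @hermposdef_schur 1 n A T pA AT uT.
have [S uS DS] := IH D pD.
by exists (block_mx T E 0 S); [exact: (block_ublock_unit E uT uS)|exact: HD].
Qed.

Definition gramdet n p (X : 'M[C]_(n, p)) : R := absdet (X^t* *m X).

Lemma gramdet_ge0 n p (X : 'M[C]_(n, p)) : 0 <= gramdet X.
Proof. exact: normc_ge0. Qed.

(** A vector in the kernel of the Gram matrix has an image under [X] of norm zero, so the Gram
    matrix is singular only when the columns of [X] are dependent. *)
Lemma gramdet0P n p (X : 'M[C]_(n, p)) : gramdet X = 0 <->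
  exists2 v : 'rV_p, v != 0 & v *m X^t* = 0.
Proof.
rewrite /gramdet /absdet; split=> [/eqP|[v v0 vX]]; last first.
  by apply/eqP; rewrite normc_eq0; apply/det0P; exists v; rewrite // mulmxA vX mul0mx.
rewrite normc_eq0 => /det0P[v v0 vX]; exists v => //.
have w0 : (v *m X^t*)^t* = 0.
  apply/eqP; rewrite -mxnorm2_eq0; apply/eqP/complexI.
  by rewrite -gram_cV adjmxK adjmxM adjmxK !mulmxA -(mulmxA v) vX mul0mx mxE.
by rewrite -[LHS]adjmxK w0 adjmx0.
Qed.

Lemma gramdet_neq0 n p (X : 'M[C]_(n, p)) : (gramdet X != 0) = (\rank X == p).
Proof.
apply/idP/eqP => [|rX]; last first.
  apply/eqP => /gramdet0P[v v0]; have rf : row_free (X^t*) by rewrite /row_free mxrank_map mxrank_tr rX.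
  by rewrite -(mul0mx _ (X^t*)) => /(row_free_inj rf) v00; rewrite v00 eqxx in v0.
rewrite /gramdet /absdet normc_eq0 -unitfE -unitmxE -row_free_unit /row_free => /eqP r.
by apply/eqP; rewrite eqn_leq rank_leq_col -{1}r mxrankM_maxr.
Qed.

(** The invertible matrix M = [col_ebase X] has the column space of [X] spanned by its first q
    columns. If M^* M = T^* T then M T^-1 is unitary, and a block upper triangular [T] keeps the
    column space of [X] inside the first q coordinates. *)
Lemma qr_decomposition q m (X : 'M[C]_(q + m, q)) : \rank X = q ->
  exists (L : 'M[C]_(q + m)) (A : 'M[C]_q), L^t* *m L = 1%:M /\ X = L *m col_mx A 0.
Proof.
move=> rX.
pose M := col_ebase X; have uM : M \in unitmx by exact: col_ebase_unit.
have pM : hermposdefmx (M^t* *m M).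
  by apply: hermposdef_gram => v Mv; rewrite -[v](mulKmx uM) Mv mulmx0.
(* The two diagonal blocks are factored separately, since the conclusion of [cholesky] does not
   record a triangular shape. *)
have [T11 uT11 AT] := cholesky (hermposdef_ul pM).
have [E [D [pD HD]]] := hermposdef_schur pM AT uT11.
have [S uS DS] := cholesky pD.
pose T := block_mx T11 E 0 S.
have uT : T \in unitmx by exact: block_ublock_unit.
have MT : M^t* *m M = T^t* *m T by exact: HD.
exists (M *m invmx T), (T11 *m row_ebase X); split.
  have uT' : T^t* \in unitmx by rewrite adjmx_unit.
  rewrite adjmxM -mulmxA (mulmxA (M^t*)) MT -mulmxA mulmxV// mulmx1.
  by rewrite -adjmxM mulmxV// adjmx1.
rewrite -mulmxA -[LHS]mulmx_ebase rX pid_mx_col -!mulmxA; congr (_ *m _).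
rewrite -[LHS](mulKmx uT); congr (_ *m _).
by rewrite (mul_col_mx 1%:M) mul1mx mul0mx mul_block_col !mulmx0 !mul0mx !addr0.
Qed.

Lemma gramdet_isometry n p (L : 'M[C]_n) (X : 'M[C]_(n, p)) :
  L^t* *m L = 1%:M -> gramdet (L *m X) = gramdet X.
Proof. by move=> LL; rewrite /gramdet adjmxM -mulmxA (mulmxA (L^t*)) LL mul1mx. Qed.

Lemma mxnorm2_isometry n p (L : 'M[C]_n) (X : 'M[C]_(n, p)) :
  L^t* *m L = 1%:M -> mxnorm2 (L *m X) = mxnorm2 X.
Proof.
move=> LL; apply: complexI; rewrite -!trace_gram.
by rewrite adjmxM -mulmxA (mulmxA (L^t*)) LL mul1mx.
Qed.

Lemma absdetM n (A B : 'M[C]_n) : absdet (A *m B) = absdet A * absdet B.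
Proof. by rewrite /absdet det_mulmx normcM. Qed.

Lemma absdet_adjmx n (A : 'M[C]_n) : absdet (A^t*) = absdet A.
Proof. by rewrite /absdet det_adjmx normc_conj. Qed.

Lemma absdet1 n : absdet (1%:M : 'M[C]_n) = 1.
Proof. by rewrite /absdet det1 /= expr0n /= addr0 expr1n sqrtr1. Qed.

Lemma gramdet_square n (A : 'M[C]_n) : gramdet A = absdet A ^+ 2.
Proof. by rewrite /gramdet absdetM absdet_adjmx expr2. Qed.

Lemma gramdetMr n p (X : 'M[C]_(n, p)) (Z : 'M[C]_p) :
  gramdet (X *m Z) = gramdet X * absdet Z ^+ 2.
Proof.
rewrite /gramdet adjmxM mulmxA -(mulmxA (Z^t*)) !absdetM absdet_adjmx; ring.
Qed.

Lemma absdet_isometry n (L : 'M[C]_n) : L^t* *m L = 1%:M -> absdet L = 1.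
Proof.
move=> LL; have := gramdet_square L; rewrite /gramdet LL absdet1 => /esym/eqP.
by rewrite sqrp_eq1 ?normc_ge0// => /eqP.
Qed.

Lemma absdet_eq0 n (A : 'M[C]_n) : (absdet A == 0) = (A \notin unitmx).
Proof. by rewrite /absdet normc_eq0 unitmxE unitfE negbK. Qed.

Lemma gramdet_col0 q m (A : 'M[C]_q) : gramdet (col_mx A (0 : 'M[C]_(m, q))) = absdet A ^+ 2.
Proof. by rewrite /gramdet adjmx_col mul_row_col mulmx0 addr0 -gramdet_square. Qed.

(** Only the part of the first column orthogonal to the others matters: multiplying the Gram matrix
    by [K], of determinant 1, makes it block triangular with diagonal blocks w^* w and A^* A. *)
Lemma gramdet_block q m (A : 'M[C]_q) (v : 'cV[C]_q) (w : 'cV[C]_m) : A \in unitmx ->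
  gramdet (block_mx v A w 0) = mxnorm2 w * absdet A ^+ 2.
Proof.
move=> uA; rewrite /gramdet -gramdet_square /gramdet.
pose K : 'M[C]_(1 + q) := block_mx 1%:M 0 (- (invmx A *m v)) 1%:M.
have K1 : absdet K = 1.
  by rewrite /absdet det_lblock !det1 mulr1 /= expr0n /= addr0 expr1n sqrtr1.
rewrite -[LHS]mulr1 -[X in _ * X]K1 -absdetM adjmx_block adjmx0 mulmx_block mulmx0 addr0.
rewrite !mul0mx !addr0 /K mulmx_block !mulmx1 !mulmx0 !add0r.
have -> : v^t* *m v + w^t* *m w + v^t* *m A *m - (invmx A *m v) = w^t* *m w.
  by rewrite mulmxN -mulmxA mulKVmx// addrC addrA addNr add0r.
have -> : A^t* *m v + A^t* *m A *m - (invmx A *m v) = 0.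
  by rewrite mulmxN -mulmxA mulKVmx// subrr.
rewrite /absdet det_ublock normcM; congr (_ * _).
by rewrite det_mx11 gram_cV normc_real// mxnorm2_ge0.
Qed.

End posdef.

(** * Gaussian integrals over complex matrices *)

Section radial.
Variable R : realType.
Local Notation C := R[i].
Local Notation mR := (measurableTypeR R).
Local Notation leb := (@lebesgue_measure R).
Local Notation lmx := (lebesgue_mx R).

(** Without entries the matrix space is one point, and its mass is an empty product, hence 1. *)
Lemma has_cint_point n p (f : 'M[C]_(n, p) -> C) : (n * p = 0)%N ->
  cmeasurable f -> has_cint (lmx n p) f (f 0).
Proof.
move=> np0 [mf1 mf2].
have X0 (X : 'M[C]_(n, p)) : X = 0.
  move/eqP: np0; rewrite muln_eq0 => /orP[]/eqP e; apply/matrixP => i j.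
    by have := leq_trans (ltn_ord i) (eq_leq e).
  by have := leq_trans (ltn_ord j) (eq_leq e).
have muT : lmx n p setT = 1%E.
  have := coord_box (coordsys_mx R n p) (A := fun=> setT) (fun _ => measurableT).
  rewrite (_ : [set x | _] = setT); last by apply/seteqP; split.
  move=> ->; rewrite big_pred0// => -[[i j] b].
  by move/eqP: np0; rewrite muln_eq0 => /orP[]/eqP e;
    [have := leq_trans (ltn_ord i) (eq_leq e)|have := leq_trans (ltn_ord j) (eq_leq e)].
have fE : f = fun=> f 0 by apply/funext => X; rewrite (X0 X).
have H1 : has_rint (lmx n p) (fun=> 1) 1.
  by apply: has_rint_ge0 => //; rewrite integral_cst//= muT mule1.
have H (a : R) : has_rint (lmx n p) (fun=> a) a.
  by apply: (eq_has_rint (has_rintZ a H1)) => [x|]; rewrite mulr1.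
by apply/has_cintP; rewrite {1 3}fE; split; exact: H.
Qed.

Lemma measurable_mxnorm2 n p : measurable_fun setT (@mxnorm2 R n p).
Proof.
rewrite /mxnorm2; apply: measurable_sum => i; apply: measurable_sum => j.
apply: measurable_funX; apply: measurable_normc.
by have /measurable_mxP := @measurable_id _ 'M[C]_(n, p) setT.
Qed.

Lemma has_rint_gauss1 : has_rint leb (fun x : mR => expR (- x ^+ 2)) (Num.sqrt pi).
Proof. by split; [exact: integrableT_gauss|exact: integralT_gauss]. Qed.

Lemma has_rint_gauss11 :
  has_rint (lmx 1 1) (fun X => expR (- mxnorm2 X)) pi.
Proof.
pose phi (z : mR * mR) : 'M[C]_1 := (z.1 +i* z.2)%:M.
have P : preserves (leb \x leb)%E (lmx 1 1) phi 1.
  apply: (coord_transport (coordsys_prod (coordsys_R R) (coordsys_R R)) (coordsys_mx R 1 1)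
    (sigma := fun i => if i.2 then inr tt else inl tt)).
    exists (fun i => match i with inl _ => (0, 0, false) | inr _ => (0, 0, true) end).
      by move=> [[r s] []]; rewrite !ord1.
    by move=> [] [].
  by move=> [x y] [[r s] []]; rewrite /mx_coord /= !ord1 mxE.
have mg : measurable_fun setT (fun x : mR => expR (- x ^+ 2) : R).
  by have := has_rint_measurable has_rint_gauss1.
have H : has_rint (leb \x leb)%E
    (fun z : mR * mR => expR (- z.1 ^+ 2) * expR (- z.2 ^+ 2)) pi.
  have inner (y : mR) := has_rintZ (expR (- y ^+ 2)) has_rint_gauss1.
  have outer := has_rintZ (Num.sqrt pi) has_rint_gauss1.
  rewrite -expr2 sqr_sqrtr ?pi_ge0// in outer.
  pose k (y : mR) : R := Num.sqrt pi * expR (- y ^+ 2).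
  refine (@has_rint_fubini R _ _ _ _ leb leb _ k k pi pi _ _ outer _ outer).
  - by apply: measurable_funM;
      [exact: (measurableT_comp mg measurable_fst)|exact: (measurableT_comp mg measurable_snd)].
  - move=> y; apply: (eq_has_rint (inner y)) => [x|]; last by rewrite mulrC.
    by rewrite /= ger0_norm 1?mulrC// mulr_ge0// expR_ge0.
  - move=> y; apply: (eq_has_rint (inner y)) => [x|]; last by rewrite mulrC.
    by rewrite /= mulrC.
have NE z : mxnorm2 (phi z) = z.1 ^+ 2 + z.2 ^+ 2.
  rewrite /mxnorm2 !big_ord1 mxE /= sqr_sqrtr// addr_ge0// sqr_ge0//.
have mN : measurable_fun setT (fun X : 'M[C]_1 => expR (- mxnorm2 X)).
  by apply: measurableT_comp => //; apply: measurableT_comp => //; exact: measurable_mxnorm2.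
apply: has_rint_ge0 => //.
have := P.2 (fun X => (expR (- mxnorm2 X))%:E); rewrite mul1e => <-.
- rewrite -H.2; apply: eq_integral => z _.
  by rewrite NE opprD expRD.
- exact/measurable_EFinP.
- by move=> X; rewrite lee_fin expR_ge0.
Qed.

Lemma has_rint_gauss m : has_rint (lmx m 1) (fun X => expR (- mxnorm2 X)) (pi ^+ m).
Proof.
have mN k : measurable_fun setT (fun X : 'M[C]_(k, 1) => expR (- mxnorm2 X)).
  by apply: measurableT_comp => //; apply: measurableT_comp => //; exact: measurable_mxnorm2.
elim: m => [|m IH].
  have /has_cintP[] := @has_cint_point 0 1 (fun X => (expR (- mxnorm2 X))%:C) erefl
    (cmeasurable_real (mN 0)).
  by rewrite /= {2}/mxnorm2 big_ord0 oppr0 expR0.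
change (has_rint (lmx (1 + m) 1) (fun X : 'M[C]_(1 + m, 1) => expR (- mxnorm2 X)) (pi ^+ m.+1)).
have P := preserves_col_mx R 1 1 m.
have H : has_rint (lmx 1 1 \x lmx m 1)%E
    (fun z => expR (- mxnorm2 z.1) * expR (- mxnorm2 z.2)) (pi ^+ m.+1).
  have inner (y : 'M[C]_(m, 1)) := has_rintZ (expR (- mxnorm2 y)) has_rint_gauss11.
  have outer := has_rintZ pi IH; rewrite -exprS in outer.
  pose k (y : 'M[C]_(m, 1)) : R := pi * expR (- mxnorm2 y).
  refine (@has_rint_fubini R _ _ _ _ (lmx 1 1) (lmx m 1) _ k k _ _ _ _ outer _ outer).
  - by apply: measurable_funM;
      [exact: (measurableT_comp (mN 1) measurable_fst)|exact: (measurableT_comp (mN m) measurable_snd)].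
  - move=> y; apply: (eq_has_rint (inner y)) => [x|]; last by rewrite mulrC.
    by rewrite /= ger0_norm 1?mulrC// mulr_ge0// expR_ge0.
  - move=> y; apply: (eq_has_rint (inner y)) => [x|]; last by rewrite mulrC.
    by rewrite /= mulrC.
have E : (\int[lmx (1 + m) 1]_X (expR (- mxnorm2 X))%:E = (pi ^+ m.+1)%:E)%E.
  rewrite -H.2 -[LHS]mul1e -(P.2 (fun X => (expR (- mxnorm2 X))%:E)).
  - by apply: eq_integral => z _; rewrite mxnorm2_col opprD expRD.
  - by apply/measurable_EFinP; exact: (mN (1 + m)%N).
  - by move=> X; rewrite lee_fin expR_ge0.
exact: (has_rint_ge0 (mN (1 + m)%N) (fun X => expR_ge0 _) E).
Qed.

End radial.

(** * Radial integrals over C^m *)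

Section radial_power.
Variables (R : realType) (m : nat).
Local Notation C := R[i].
Local Notation mR := (measurableTypeR R).
Local Notation leb := (@lebesgue_measure R).
Local Notation lmx := (lebesgue_mx R).
Local Notation normc := (@Normc.normc R).
Local Notation N := (@mxnorm2 R m 1).

Lemma mxnorm2_scale n p (c : C) (X : 'M[C]_(n, p)) :
  mxnorm2 (c *: X) = normc c ^+ 2 * mxnorm2 X.
Proof.
rewrite /mxnorm2 mulr_sumr; apply: eq_bigr => i _; rewrite mulr_sumr.
by apply: eq_bigr => j _; rewrite mxE normcM exprMn.
Qed.

Let measurable_N : measurable_fun setT N := @measurable_mxnorm2 R m 1.

(** Dilate by t^(-1/2). In the 2m real dimensions of the space this contributes the factor t^m. *)
Lemma has_cint_radial_scale (f : R -> C) v (t : R) : 0 < t ->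
  has_cint (lmx m 1) (fun w => f (N w)) v ->
  has_cint (lmx m 1) (fun w => f (N w / t)) ((t ^+ m)%:C * v).
Proof.
move=> t0 H.
pose c : C := ((Num.sqrt t)^-1)%:C.
have nc : normc c = (Num.sqrt t)^-1 by rewrite normc_real// invr_ge0 sqrtr_ge0.
have c0 : c != 0 by rewrite -normc_eq0 nc invr_eq0 gt_eqF// sqrtr_gt0.
have w0 : 0 <= normc c ^- (2 * (m * 1)) by rewrite invr_ge0 exprn_ge0// normc_ge0.
apply: (eq_has_cint (has_cint_preserves w0 (preserves_scale m 1 c0) H)) => [w|].
  by rewrite /= mxnorm2_scale nc exprVn sqr_sqrtr ?(ltW t0)// mulrC.
by rewrite nc exprVn invrK muln1 exprM sqr_sqrtr ?(ltW t0).
Qed.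

Hypothesis m_gt0 : (0 < m)%N.

(** A ball of squared radius [s], so its volume grows like s^m. The origin is removed to agree with
    [pw], which vanishes at 0. *)
Let ball (s : R) (w : 'M[C]_(m, 1)) : R := if (0 < N w) && (N w <= s) then 1 else 0.

Let measurable_ball s : measurable_fun setT (ball s).
Proof.
apply: measurable_fun_ifT => //; apply: measurable_and.
  exact: measurable_fun_ltr.
exact: measurable_fun_ler.
Qed.

(** The indicator is at most e times the Gaussian. Finiteness is all that is needed here: the volume
    is determined only in [has_cint_radial]. *)
Let has_rint_ball1 : exists c, has_rint (lmx m 1) (ball 1) c.
Proof.
have [i _] := has_rintZ (expR 1) (has_rint_gauss R m).
have ib : (lmx m 1).-integrable setT (EFin \o ball 1).
  apply: (le_integrable _ _ _ i) => //.
    by apply/measurable_EFinP; exact: measurable_ball.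
  move=> w _ /=; rewrite lee_fin /ball; case: ifP => [/andP[_ w1]|_]; last first.
    by rewrite normr0.
  rewrite normr1 ger0_norm; last by rewrite mulr_ge0// expR_ge0.
  by rewrite -expRD -[leLHS]expR0 ler_expR subr_ge0.
exists (fine (\int[lmx m 1]_w (ball 1 w)%:E)); split => //.
by rewrite fineK//; exact: integrable_fin_num ib.
Qed.

Let unit_vol := sval (cid has_rint_ball1).
Let unit_volP : has_rint (lmx m 1) (ball 1) unit_vol := svalP (cid has_rint_ball1).

Let has_cint_ball s : 0 < s ->
  has_cint (lmx m 1) (fun w => (ball s w)%:C) ((s ^+ m)%:C * unit_vol%:C).
Proof.
move=> s0; pose f (r : R) : C := (if (0 < r) && (r <= 1) then 1 else 0)%:C.
have := @has_cint_radial_scale f unit_vol%:C s s0 (has_cint_real unit_volP).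
move=> H; apply: (eq_has_cint H) => // w.
by rewrite /f /ball pmulr_lgt0 ?invr_gt0// ler_pdivrMr// mul1r.
Qed.

(* Dilating by 2 shows that the measure of the origin is [2 ^ m] times itself. *)
Let has_rint_null : has_rint (lmx m 1) (fun w => if 0 < N w then 0 else 1) 0.
Proof.
have mf : measurable_fun setT (fun w => if 0 < N w then 0 else 1 : R).
  by apply: measurable_fun_ifT => //; exact: measurable_fun_ltr.
have [i _] := has_rint_gauss R m.
have ib : (lmx m 1).-integrable setT (EFin \o (fun w => if 0 < N w then 0 else 1 : R)).
  apply: (le_integrable _ _ _ i) => //; first exact/measurable_EFinP.
  move=> w _ /=; rewrite lee_fin; case: ifP => [_|/negbT].
    by rewrite normr0.
  rewrite -leNgt => w0; have -> : N w = 0 by apply/eqP; rewrite eq_le w0 mxnorm2_ge0.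
  by rewrite oppr0 expR0.
pose v := fine (\int[lmx m 1]_w (if 0 < N w then 0 else 1)%:E).
have H : has_rint (lmx m 1) (fun w => if 0 < N w then 0 else 1) v.
  by split => //; rewrite /v fineK//; exact: integrable_fin_num ib.
pose f (r : R) : C := (if 0 < r then 0 else 1)%:C.
have t0 : (0 : R) < 2 by [].
have H2 := @has_cint_radial_scale f v%:C 2 t0 (has_cint_real H).
have E : v%:C = (2 ^+ m)%:C * v%:C.
  apply: (has_cint_unique (has_cint_real H)); apply: (eq_has_cint H2) => // w.
  by rewrite /f pmulr_lgt0 ?invr_gt0.
suff v0 : v = 0 by rewrite v0 in H.
move: E; rewrite -realcM => /complexI /eqP; rewrite -subr_eq0 -{1}[v]mul1r -mulrBl.
rewrite mulf_eq0 subr_eq0 => /orP[|/eqP//].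
by rewrite eq_sym gt_eqF// exprn_egt1 ?ltr1n// -lt0n.
Qed.

(* Layer-cake: [1 - r ^ al] is the integral of [al s ^ (al - 1)] over [r, 1]. *)
Let radial_ball_power (al : C) : 0 < complex.Re (al + m%:R) ->
  has_cint (lmx m 1) (fun w => if N w <= 1 then pw (N w) al else 0)
    (unit_vol%:C * m%:R / (al + m%:R)).
Proof.
move=> alm.
(* The prefactor [b] is separate from the exponent [a] because the modulus of [f al al] has exponent
   Re al but prefactor |al|. *)
pose f (a b : C) (z : 'M[C]_(m, 1) * mR) : C := b * pw01 a z.2 * (ball z.2 z.1)%:C.
have mf a b : cmeasurable (f a b).
  apply: cmeasurableM.
    apply: cmeasurableM; first exact: cmeasurable_cst.
    have [h1 h2] := cmeasurable_pw01 a.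
    by split; [exact: (measurableT_comp h1 measurable_snd)|exact: (measurableT_comp h2 measurable_snd)].
  apply: cmeasurable_real; apply: measurable_fun_ifT => //; apply: measurable_and.
    by apply: measurable_fun_ltr => //; exact: measurableT_comp.
  by apply: measurable_fun_ler; [exact: measurableT_comp|exact: measurable_snd].
have inner a b s : has_cint (lmx m 1) (fun w => f a b (w, s))
    (unit_vol%:C * b * pw01 (a + m%:R) s).
  have [s0|s0] := ltP 0 s; last first.
    apply: (eq_has_cint (has_cintZ 0 (has_cint_real unit_volP))) => [w|].
      rewrite mul0r /f /= /pw01 /ball; case: ifP => _; last by rewrite mulr0 mul0r.
      by rewrite pw_le0// mulr0 mul0r.
    by rewrite mul0r /pw01 pw_le0// if_same mulr0.
  apply: (eq_has_cint (has_cintZ (b * pw01 a s) (has_cint_ball s0))) => //.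
  rewrite /pw01; case: ifP => _; last by rewrite !(mulr0, mul0r).
  by rewrite addrAC (pwD s (a - 1)) pw_nat//; ring.
have nf w s : (normc (f al al (w, s)))%:C = f (complex.Re al)%:C (normc al)%:C (w, s).
  rewrite /f !normcM !realcM normc_pw01; congr (_ * _).
  by rewrite normc_real// /ball; case: ifP.
have alm' : 0 < complex.Re ((complex.Re al)%:C + m%:R : C).
  by move: alm; rewrite !raddfD.
have F : has_cint (lmx m 1 \x leb)%E (f al al) (unit_vol%:C * al * (al + m%:R)^-1).
  refine (has_cint_fubini (mf al al) (h := fun s =>
    unit_vol%:C * (normc al)%:C * pw01 ((complex.Re al)%:C + m%:R) s)
    _ (has_cintZ _ (has_cint_pw01 alm')) (inner al al) (has_cintZ _ (has_cint_pw01 alm))).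
  by move=> s; apply: (eq_has_cint (inner (complex.Re al)%:C (normc al)%:C s)).
have H : has_cint (lmx m 1) (fun w => if (0 < N w) && (N w <= 1) then 1 - pw (N w) al else 0)
    (unit_vol%:C * al * (al + m%:R)^-1).
  apply: (has_cint_fubini_inv F) => w.
  have Z : has_cint leb (fun _ : mR => 0 : C) 0.
    by apply: has_cint_real; exact: has_rint0.
  have [r0|r0] := ltP 0 (N w); last first.
    by apply: (eq_has_cint Z) => // s; rewrite /f /ball /= ltNge r0 /= mulr0.
  have [r1|r1] := ltP (N w) 1; last first.
    apply: (eq_has_cint Z) => [s|].
      rewrite /f /ball /= r0 /= /pw01; case: (ltP s 1) => [s1|_]; last by rewrite mulr0 mul0r.
      by rewrite leNgt (lt_le_trans s1 r1) /= mulr0.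
    rewrite /= le_eqVlt ltNge r1 orbF; case: eqP => // ->.
    by rewrite pw1 subrr.
  have r01 : 0 < N w < 1 by rewrite r0.
  rewrite /= (ltW r1); apply: (eq_has_cint (has_cint_pw_itv al r01)) => // s.
  rewrite /f /ball /pw01 /= r0 /=.
  by case: (N w <= s); case: (s < 1); rewrite /= ?mulr1 ?mulr0 ?mul0r.
apply: (eq_has_cint (has_cintD (has_cint_real unit_volP) (has_cintZ (- 1) H))).
  move=> w; rewrite /ball; have [r0|r0] := ltP 0 (N w); last first.
    by rewrite pw_le0// if_same mulr0 addr0.
  case: (N w <= 1) => /=; last by rewrite mulr0 addr0.
  by rewrite mulN1r opprB addrC subrK.
have am0 : al + m%:R != 0 by apply: contraTneq alm => ->; rewrite ltxx.
by field.
Qed.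

(* Layer-cake: [exp (- r)] is the integral of [exp (- t)] over [t >= r]. *)
Let has_cint_radial_vol (al : C) : 0 < complex.Re (al + m%:R) ->
  has_cint (lmx m 1) (fun w => pw (N w) al * (expR (- N w))%:C)
    (unit_vol%:C * m%:R * cGamma (al + m%:R)).
Proof.
move=> alm.
pose f (a : C) (z : 'M[C]_(m, 1) * mR) : C :=
  pw (N z.1) a * (if N z.1 <= z.2 then expR (- z.2) else 0)%:C.
have mf a : cmeasurable (f a).
  apply: cmeasurableM.
    by apply: cmeasurable_pw; exact: measurableT_comp.
  apply: cmeasurable_real; apply: measurable_fun_ifT => //.
    by apply: measurable_fun_ler; [exact: measurableT_comp|exact: measurable_snd].
  exact: (measurableT_comp (@measurable_expN R) measurable_snd).
pose K (a : C) := unit_vol%:C * m%:R / (a + m%:R).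
have inner a t : 0 < complex.Re (a + m%:R) ->
    has_cint (lmx m 1) (fun w => f a (w, t)) (K a * gamma_fun (a + m%:R + 1) t).
  move=> am; have HK := radial_ball_power am.
  have [t0|t0] := ltP 0 t; last first.
    apply: (eq_has_cint (has_cintZ 0 HK)) => [w|].
      rewrite mul0r /f /=; case: ifP => [wt|_]; last by rewrite mulr0.
      by rewrite pw_le0 ?mul0r// (le_trans wt).
    by rewrite /gamma_fun pw_le0// !(mul0r, mulr0).
  pose g (r : R) : C := if r <= 1 then pw r a else 0.
  have := @has_cint_radial_scale g _ t t0 HK.
  move=> /(has_cintZ ((expR (- t))%:C * pw t a)) H; apply: (eq_has_cint H) => [w|].
    rewrite /f /g /= ler_pdivrMr// mul1r; case: ifP => _; last by rewrite !mulr0.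
    rewrite pwM ?mxnorm2_ge0 ?invr_ge0 ?(ltW t0)// pwV// (mulrC (pw (N w) a)) mulrA.
    by rewrite -(mulrA (expR _)%:C) -pwD subrr pw0// mulr1 mulrC.
  by rewrite /gamma_fun addrK (pwD t a) pw_nat// /K; ring.
have nf w t : (normc (f al (w, t)))%:C = f (complex.Re al)%:C (w, t).
  rewrite /f normcM realcM normc_pw; congr (_ * _).
  by rewrite normc_real//=; case: ifP => // _; exact: expR_ge0.
have alm' : 0 < complex.Re ((complex.Re al)%:C + m%:R : C).
  by move: alm; rewrite !raddfD.
have Re1 (z : C) : 0 < complex.Re z -> 0 < complex.Re (z + 1).
  by move=> z0; rewrite raddfD /= addr_gt0.
have F : has_cint (lmx m 1 \x leb)%E (f al) (K al * cGamma (al + m%:R + 1)).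
  refine (has_cint_fubini (mf al) (h := fun t =>
    K (complex.Re al)%:C * gamma_fun ((complex.Re al)%:C + m%:R + 1) t)
    _ (has_cintZ _ (has_cint_gamma (Re1 _ alm'))) (fun t => inner al t alm)
    (has_cintZ _ (has_cint_gamma (Re1 _ alm)))).
  by move=> t; apply: (eq_has_cint (inner (complex.Re al)%:C t alm')).
have KE : K al * cGamma (al + m%:R + 1) = unit_vol%:C * m%:R * cGamma (al + m%:R).
  have am0 : al + m%:R != 0 by apply: contraTneq alm => ->; rewrite ltxx.
  by rewrite cGammaS// /K mulrA divfK.
rewrite -KE; apply: (has_cint_fubini_inv F) => w.
exact: (eq_has_cint (has_cintZ (pw (N w) al) (has_cint_real (has_rint_exp_tail_le (N w))))).
Qed.

Theorem has_cint_radial (al : C) : 0 < complex.Re (al + m%:R) ->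
  has_cint (lmx m 1) (fun w => pw (N w) al * (expR (- N w))%:C)
    ((pi ^+ m)%:C * cGamma (al + m%:R) / cGamma m%:R).
Proof.
move=> alm.
have m0 : 0 < complex.Re (0 + m%:R : C).
  by rewrite add0r -(rmorph_nat (real_complex R)) /= ltr0n.
(* The case of exponent 0 fixes the unknown volume: off the origin, which is a null set, the
   integrand is then the Gaussian, whose integral is pi^m. *)
have vol : unit_vol%:C * m%:R * cGamma m%:R = (pi ^+ m)%:C.
  have := has_cint_radial_vol m0; rewrite add0r => H1.
  apply: (has_cint_unique H1).
  have H2 := has_cintD (has_cint_real (has_rint_gauss R m))
    (has_cintZ (- 1) (has_cint_real has_rint_null)).
  apply: (eq_has_cint H2) => [w|]; last by rewrite mulr0 addr0.
  case: ifP => [w0|/negbT]; first by rewrite pw0// mul1r mulr0 addr0.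
  rewrite -leNgt => w0; rewrite pw_le0//.
  have -> : N w = 0 by apply/eqP; rewrite eq_le w0 mxnorm2_ge0.
  by rewrite oppr0 expR0 mul0r mulN1r subrr.
have g0 : cGamma (m%:R : C) != 0 by apply: cGamma_neq0; rewrite add0r in m0.
apply: (eq_has_cint (has_cint_radial_vol alm)) => //.
by rewrite -vol [RHS]mulrAC mulfK.
Qed.

End radial_power.

(** * Matrix Gaussian integrals, one column at a time *)

Section matrix_gaussian.
Variable R : realType.
Local Notation C := R[i].
Local Notation lmx := (lebesgue_mx R).
Local Notation normc := (@Normc.normc R).

Definition mxgauss n p (al : C) (X : 'M[C]_(n, p)) : C :=
  pw (gramdet X) al * (expR (- mxnorm2 X))%:C.

(** Factor [i] is the contribution of a column added to [i] others: its [i] coordinates in their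
    span give pi^i, and the n - i orthogonal ones give the radial integral. [mxgauss_valE] rewrites
    the product with [mvGamma]. *)
Definition mxgauss_val n p (al : C) : C :=
  \prod_(i < p) ((pi ^+ n)%:C * cGamma (al + (n - i)%:R) / cGamma (n - i)%:R).

Lemma cmeasurable_comp d1 d2 (T1 : measurableType d1) (T2 : measurableType d2)
    (f : T2 -> C) (g : T1 -> T2) : cmeasurable f -> measurable_fun setT g ->
  cmeasurable (fun x => f (g x)).
Proof.
move=> [f1 f2] mg; split; first exact: (measurableT_comp f1 mg).
exact: (measurableT_comp f2 mg).
Qed.

Lemma measurable_gramdet n p : measurable_fun setT (@gramdet R n p).
Proof.
apply: measurable_normc; apply: cmeasurable_det; apply: measurable_mulmx => //.
exact: measurable_conjtrmx.
Qed.

Lemma measurable_expN_mxnorm2 n p :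
  measurable_fun setT (fun X : 'M[C]_(n, p) => expR (- mxnorm2 X)).
Proof.
by apply: measurableT_comp => //; apply: measurableT_comp => //; exact: measurable_mxnorm2.
Qed.

Lemma cmeasurable_mxgauss n p al : cmeasurable (@mxgauss n p al).
Proof.
apply: cmeasurableM; first by apply: cmeasurable_pw; exact: measurable_gramdet.
by apply: cmeasurable_real; exact: measurable_expN_mxnorm2.
Qed.

Lemma normc_mxgauss n p al (X : 'M[C]_(n, p)) :
  (normc (mxgauss al X))%:C = mxgauss (complex.Re al)%:C X.
Proof. by rewrite /mxgauss normcM realcM normc_pw normc_real// expR_ge0. Qed.

(* A unitary rotation moves the columns of [X] into the first [q] coordinates;
   the Gram determinant then only sees the last [m] coordinates of [x]. *)
Lemma has_cint_column_full q m (X : 'M[C]_(q + m, q)) (al : C) : (0 < m)%N ->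
  0 < complex.Re (al + m%:R) -> gramdet X != 0 ->
  has_cint (lmx (q + m) 1) (fun x => mxgauss al (row_mx x X))
    ((pi ^+ (q + m))%:C * cGamma (al + m%:R) / cGamma m%:R * mxgauss al X).
Proof.
move=> m0 alm; rewrite gramdet_neq0 => /eqP rX.
have [L [A [LL XE]]] := qr_decomposition rX.
have gX : gramdet X = absdet A ^+ 2 by rewrite XE gramdet_isometry// gramdet_col0.
have uA : A \in unitmx.
  have : gramdet X != 0 by rewrite gramdet_neq0 rX.
  by rewrite gX expf_eq0 /= absdet_eq0 negbK.
have NX : mxnorm2 X = mxnorm2 A.
  rewrite XE mxnorm2_isometry// mxnorm2_col; apply/eqP.
  by rewrite -subr_eq0 addrAC subrr add0r mxnorm2_eq0.
have uL : L \in unitmx by rewrite -[_ \in _]negbK -absdet_eq0 absdet_isometry// oner_eq0.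
have mf : cmeasurable (fun x : 'cV[C]_(q + m) => mxgauss al (row_mx x X)).
  apply: (cmeasurable_comp (@cmeasurable_mxgauss (q + m) (1 + q) al)).
  by apply: measurable_row_mx; [exact: measurable_id|exact: measurable_cst].
have PL : preserves (lmx (q + m) 1) (lmx (q + m) 1) (mulmx L) 1.
  have := lmul_scales_unit uL 1; rewrite (absdet_isometry LL : normc (\det L) = 1).
  by rewrite expr1n invr1.
have P := preserves_comp (preserves_col_mx R 1 q m) PL; rewrite mulr1 in P.
apply: (has_cint_preserves_inv mf P).
pose f (a : C) (z : 'cV[C]_q * 'cV[C]_m) : C :=
  mxgauss a X * ((expR (- mxnorm2 z.1))%:C * (pw (mxnorm2 z.2) a * (expR (- mxnorm2 z.2))%:C)).
have fE : f al =1 ((fun x => mxgauss al (row_mx x X)) \o (mulmx L \o (fun z => col_mx z.1 z.2))).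
  move=> [v w] /=; rewrite {1}XE -mul_mx_row /mxgauss gramdet_isometry// mxnorm2_isometry//.
  rewrite -block_mxEh gramdet_block// -gX pwM ?mxnorm2_ge0 ?gramdet_ge0//.
  rewrite block_mxEh mxnorm2_row !mxnorm2_col (_ : mxnorm2 0 = 0); last first.
    by apply/eqP; rewrite mxnorm2_eq0.
  rewrite addr0 -NX !opprD !expRD !realcM /f /= /mxgauss; ring.
have mf1 a : cmeasurable (f a).
  apply: cmeasurableM; first exact: cmeasurable_cst.
  apply: cmeasurableM.
    by apply: cmeasurable_real; exact: (measurableT_comp (@measurable_expN_mxnorm2 q 1) measurable_fst).
  apply: cmeasurableM.
    by apply: cmeasurable_pw; exact: (measurableT_comp (@measurable_mxnorm2 R m 1) measurable_snd).
  by apply: cmeasurable_real; exact: (measurableT_comp (@measurable_expN_mxnorm2 m 1) measurable_snd).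
have inner a (w : 'cV[C]_m) := has_cintZ (mxgauss a X * (pw (mxnorm2 w) a * (expR (- mxnorm2 w))%:C))
  (has_cint_real (has_rint_gauss R q)).
have alm' : 0 < complex.Re ((complex.Re al)%:C + m%:R : C).
  by move: alm; rewrite !raddfD.
have outer a (am : 0 < complex.Re (a + m%:R)) :=
  has_cintZ (mxgauss a X * (pi ^+ q)%:C) (has_cint_radial m0 am).
have nf z : (normc (f al z))%:C = f (complex.Re al)%:C z.
  rewrite /f normcM realcM normc_mxgauss; congr (_ * _).
  rewrite normcM realcM normc_real ?expR_ge0//; congr (_ * _).
  by rewrite normcM realcM normc_pw normc_real// expR_ge0.
suff F : has_cint (lmx q 1 \x lmx m 1)%E (f al)
    ((pi ^+ (q + m))%:C * cGamma (al + m%:R) / cGamma m%:R * mxgauss al X).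
  exact: (eq_has_cint F fE).
pose k (a : C) (w : 'cV[C]_m) : C :=
  mxgauss a X * (pi ^+ q)%:C * (pw (mxnorm2 w) a * (expR (- mxnorm2 w))%:C).
have Hi a w : has_cint (lmx q 1) (fun v => f a (v, w)) (k a w).
  by apply: (eq_has_cint (inner a w)) => [v|]; rewrite /f /k /=; ring.
have Ho a : 0 < complex.Re (a + m%:R) -> has_cint (lmx m 1) (k a)
    ((pi ^+ (q + m))%:C * cGamma (a + m%:R) / cGamma m%:R * mxgauss a X).
  move=> am; apply: (eq_has_cint (outer a am)) => //.
  by rewrite exprD realcM; ring.
apply: (has_cint_fubini (mf1 al) (h := k (complex.Re al)%:C) _ (Ho _ alm') (Hi al) (Ho _ alm)).
by move=> w; apply: (eq_has_cint (Hi (complex.Re al)%:C w)) => // v; rewrite nf.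
Qed.

(** If the columns of [X] are dependent, so are those of every extension, and both sides vanish. The
    formula thus holds for every [X], as the Fubini step requires. *)
Lemma has_cint_column q m (X : 'M[C]_(q + m, q)) (al : C) : (0 < m)%N ->
  0 < complex.Re (al + m%:R) ->
  has_cint (lmx (q + m) 1) (fun x => mxgauss al (row_mx x X))
    ((pi ^+ (q + m))%:C * cGamma (al + m%:R) / cGamma m%:R * mxgauss al X).
Proof.
move=> m0 alm; have [g0|] := eqVneq (gramdet X) 0; last exact: has_cint_column_full.
have Z : has_cint (lmx (q + m) 1) (fun _ => 0 : C) 0.
  by apply: has_cint_real; exact: has_rint0.
apply: (eq_has_cint Z) => [x|]; last by rewrite /mxgauss g0 pw_le0// mul0r mulr0.
rewrite /mxgauss (_ : gramdet _ = 0) ?pw_le0 ?mul0r//.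
have [v v0 vX] := (gramdet0P X).1 g0.
apply/gramdet0P; exists (row_mx 0 v); first by rewrite row_mx_eq0 eqxx.
by rewrite adjmx_row mul_row_col mul0mx add0r.
Qed.

Theorem has_cint_mxgauss n p (al : C) : (p <= n)%N ->
  p%:R - 1 < complex.Re (al + n%:R) ->
  has_cint (lmx n p) (mxgauss al) (mxgauss_val n p al).
Proof.
elim: p al => [|q IH] al pn alp.
  apply: (eq_has_cint (has_cint_point (muln0 n) (@cmeasurable_mxgauss n 0 al))) => //.
  rewrite /mxgauss_val big_ord0 /mxgauss (_ : gramdet _ = 1); last first.
    by rewrite /gramdet /absdet det_mx00 /= expr0n /= addr0 expr1n sqrtr1.
  rewrite pw1 (_ : mxnorm2 _ = 0) ?oppr0 ?expR0 ?mul1r//.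
  by apply/eqP; rewrite mxnorm2_eq0.
have [m m0 nE] : exists2 m, (0 < m)%N & n = (q + m)%N.
  by exists (n - q)%N; rewrite ?subn_gt0// subnKC// ltnW.
have alq : q%:R - 1 < complex.Re (al + n%:R) by move: alp; rewrite -natr1; lra.
have alq' : q%:R - 1 < complex.Re ((complex.Re al)%:C + n%:R : C).
  by move: alq; rewrite !raddfD.
(* The hypothesis on [al] is exactly the convergence condition of the column added last, which is
   the strictest: with q columns in place, m = n - q coordinates remain. *)
have alm : 0 < complex.Re (al + m%:R).
  move: alp; rewrite nE natrD -natr1 addrK !raddfD /=.
  by rewrite -!(rmorph_nat (real_complex R)) /=; lra.
have alm' : 0 < complex.Re ((complex.Re al)%:C + m%:R : C).
  by move: alm; rewrite !raddfD.
have mE : m = (n - q)%N by rewrite nE addKn.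
have col (a : C) (X : 'M[C]_(n, q)) : 0 < complex.Re (a + m%:R) ->
    has_cint (lmx n 1) (fun x => mxgauss a (row_mx x X))
      ((pi ^+ n)%:C * cGamma (a + m%:R) / cGamma m%:R * mxgauss a X).
  by move=> am; clear -nE m0 am; subst n; exact: has_cint_column.
have F : has_cint (lmx n 1 \x lmx n q)%E (fun z => mxgauss al (row_mx z.1 z.2))
    (mxgauss_val n q.+1 al).
  refine (has_cint_fubini _ (h := fun X =>
      (pi ^+ n)%:C * cGamma ((complex.Re al)%:C + m%:R) / cGamma m%:R * mxgauss (complex.Re al)%:C X)
    (k := fun X => (pi ^+ n)%:C * cGamma (al + m%:R) / cGamma m%:R * mxgauss al X)
    _ (has_cintZ _ (IH _ (ltnW pn) alq')) (fun X => col al X alm) _).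
  - apply: (cmeasurable_comp (@cmeasurable_mxgauss n (1 + q) al)).
    by apply: measurable_row_mx; [exact: measurable_fst|exact: measurable_snd].
  - move=> X; apply: (eq_has_cint (col (complex.Re al)%:C X alm')) => // x.
    by rewrite normc_mxgauss.
  - apply: (eq_has_cint (has_cintZ _ (IH al (ltnW pn) alq))) => //.
    by rewrite /mxgauss_val big_ord_recr /= mE mulrC.
exact: (has_cint_preserves_inv (@cmeasurable_mxgauss n (1 + q) al) (preserves_row_mx R n 1 q) F).
Qed.

End matrix_gaussian.

(** * The Dirichlet integral *)

Section family.
Variable R : realType.
Local Notation C := R[i].
Local Notation mR := (measurableTypeR R).
Local Notation lmx := (lebesgue_mx R).
Local Notation normc := (@Normc.normc R).

Lemma has_cint_no_coord d (T : measurableType d) (mu : {measure set T -> \bar R})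
    (I : finType) (co : T -> I -> R) (f : T -> C) (x0 : T) :
  coordsys mu co -> (I -> False) -> cmeasurable f -> has_cint mu f (f x0).
Proof.
move=> cT I0 _.
have fE : f = fun=> f x0.
  by apply/funext => x; congr f; apply: (coord_inj cT) => i; case: (I0 i).
have muT : mu setT = 1%E.
  have := coord_box cT (A := fun=> setT) (fun _ => measurableT).
  rewrite (_ : [set x | _] = setT); last by apply/seteqP; split.
  by move=> ->; rewrite big_pred0// => i; case: (I0 i).
have H1 : has_rint mu (fun=> 1) 1.
  by apply: has_rint_ge0 => //; rewrite integral_cst//= muT mule1.
have H (a : R) : has_rint mu (fun=> a) a.
  by apply: (eq_has_rint (has_rintZ a H1)) => [x|]; rewrite mulr1.
by apply/has_cintP; rewrite {1 3}fE; split; exact: H.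
Qed.

(** The modulus is at most |Re| + |Im|. This serves products of arbitrary factors, whose moduli are
    not instances of an explicit formula. *)
Lemma has_cint_normc d (T : measurableType d) (mu : {measure set T -> \bar R})
    (f : T -> C) v : has_cint mu f v ->
  exists w, has_cint mu (fun x => (normc (f x))%:C) w.
Proof.
move=> fv; have mf := has_cint_cmeasurable fv; have [[i1 i2] _] := fv.
have mn := measurable_normc mf.
have i : mu.-integrable setT (EFin \o (fun x => normc (f x))).
  have := integrableD measurableT (integrable_abse i1) (integrable_abse i2).
  apply: le_integrable => //; first exact/measurable_EFinP.
  move=> x _ /=; rewrite lee_fin ger0_norm ?normc_ge0// [leRHS]ger0_norm ?addr_ge0//.
  case: (f x) => a b /=; rewrite -(ler_sqr _ _) ?nnegrE ?addr_ge0 ?sqrtr_ge0//.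
  rewrite sqr_sqrtr ?addr_ge0 ?sqr_ge0// sqrrD !real_normK ?num_real//.
  by rewrite -addrA lerD2l addrC lerDl mulrn_wge0// mulr_ge0.
exists (fine (\int[mu]_x (normc (f x))%:E))%:C; apply: has_cint_real; split => //.
by rewrite fineK//; exact: integrable_fin_num i.
Qed.

Lemma measurable_mx_of_coords p k (n : 'I_k -> nat) j :
  measurable_fun setT (fun x => @mx_of_coords R p k n x j).
Proof.
apply/measurable_mxP => r c; under eq_fun do rewrite mxE.
by split; exact: measurable_tnth.
Qed.

Section step.
Variables (p k : nat) (n : 'I_k.+1 -> nat).
Let n' (j : 'I_k) := n (lift ord0 j).

Let join (s : 'I_(n ord0) * 'I_p * bool + rcoord p n') : rcoord p n :=
  match s with
  | inl a => Tagged (fun j => ('I_(n j) * 'I_p * bool)%type) a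
  | inr (existT j b) => @existT _ (fun j => ('I_(n j) * 'I_p * bool)%type) (lift ord0 j) b
  end.

Let join_inj : injective join.
Proof.
move=> [a|[j b]] [a'|[j' b']] /= /eqP.
- by rewrite eq_Tagged /= => /eqP ->.
- by move=> /eqP /(congr1 tag) /=.
- by move=> /eqP /(congr1 tag) /=.
- move=> /eqP e; have /lift_inj jj := congr1 tag e.
  subst j'; congr inr; move/eqP: e; rewrite eq_Tagged /= => /eqP ->.
  by [].
Qed.

Let join_surj i : exists s, join s = i.
Proof.
case: i => j b; case: (unliftP ord0 j) b => [j'|] -> b.
  by exists (inr (existT _ j' b)).
by exists (inl b).
Qed.

(** Splits the first matrix off a family. The real coordinates are only relabelled along the
    bijection [join], so the factor is 1. *)
Lemma preserves_mx_of_coords :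
  exists phi : 'M[C]_(n ord0, p) * #|rcoord p n'|.-tuple mR -> #|rcoord p n|.-tuple mR,
    [/\ preserves (lmx (n ord0) p \x lebesgue_tuple R #|rcoord p n'|)%E
          (lebesgue_tuple R #|rcoord p n|) phi 1,
      forall z, mx_of_coords (phi z) ord0 = z.1 &
      forall z j, mx_of_coords (phi z) (lift ord0 j) = mx_of_coords z.2 j].
Proof.
have [sg sgK] := choice join_surj.
have sK : cancel join sg by move=> s; apply: join_inj; rewrite sgK.
pose co := fun (z : 'M[C]_(n ord0, p) * #|rcoord p n'|.-tuple mR)
    (i : 'I_(n ord0) * 'I_p * bool + rcoord p n') =>
  match i with inl a => mx_coord z.1 a | inr b => tnth z.2 (enum_rank b) end.
pose phi z : #|rcoord p n|.-tuple mR := [tuple co z (sg (enum_val i)) | i < #|rcoord p n|].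
have phiE z s : tnth (phi z) (enum_rank (join s)) = co z s.
  by rewrite tnth_mktuple enum_rankK sK.
exists phi; split.
- apply: (coord_transport (coordsys_prod (coordsys_mx R (n ord0) p) (coordsys_tuple R (rcoord p n')))
    (coordsys_tuple R (rcoord p n)) (sigma := sg)).
    by exists join.
  by move=> z i; rewrite tnth_mktuple enum_rankK.
- move=> z; apply/matrixP => r c; rewrite mxE.
  have := phiE z (inl (r, c, false)); have := phiE z (inl (r, c, true)).
  by rewrite /join /= /Tagged => -> ->; rewrite /mx_coord /=; case: (z.1 r c).
- move=> z j; apply/matrixP => r c; rewrite !mxE.
  have := phiE z (inr (Tagged (fun j => ('I_(n' j) * 'I_p * bool)%type) (r, c, false))).
  have := phiE z (inr (Tagged (fun j => ('I_(n' j) * 'I_p * bool)%type) (r, c, true))).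
  by rewrite /join /= /Tagged => -> ->.
Qed.

End step.

Lemma has_cint_family p k (n : 'I_k -> nat) (g : forall j, 'M[C]_(n j, p) -> C) v :
  (forall j, has_cint (lmx (n j) p) (g j) (v j)) ->
  has_cint (lebesgue_tuple R #|rcoord p n|)
    (fun x => \prod_j g j (mx_of_coords x j)) (\prod_j v j).
Proof.
have mg l (m : 'I_l -> nat) (h : forall j, 'M[C]_(m j, p) -> C) : (forall j, cmeasurable (h j)) ->
    cmeasurable (fun x : #|rcoord p m|.-tuple mR => \prod_j h j (mx_of_coords x j)).
  move=> mh; apply: cmeasurable_prod => j.
  exact: (cmeasurable_comp (mh j) (@measurable_mx_of_coords p l m j)).
elim: k n g v => [|k IH] n g v gv.
  have m1 := mg _ _ g (fun j => has_cint_cmeasurable (gv j)).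
  have I0 : rcoord p n -> False by move=> [[]].
  have := has_cint_no_coord ([tuple 0 | i < _] : #|rcoord p n|.-tuple mR)
    (coordsys_tuple R (rcoord p n)) I0 m1.
  by move=> H; apply: (eq_has_cint H) => //; rewrite !big_ord0.
have [phi [P phi0 phiS]] := preserves_mx_of_coords p n.
apply: (has_cint_preserves_inv (mg _ _ g (fun j => has_cint_cmeasurable (gv j))) P).
pose n' j := n (lift ord0 j); pose g' j := g (lift ord0 j).
have IH' := IH n' g' (fun j => v (lift ord0 j)) (fun j => gv (lift ord0 j)).
have [w0 gw0] := has_cint_normc (gv ord0); have [w gw] := has_cint_normc IH'.
pose f (z : 'M[C]_(n ord0, p) * #|rcoord p n'|.-tuple mR) : C :=
  (\prod_j g' j (mx_of_coords z.2 j)) * g ord0 z.1.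
have mf : cmeasurable f.
  apply: cmeasurableM.
    by apply: (cmeasurable_comp (has_cint_cmeasurable IH')); exact: measurable_snd.
  by apply: (cmeasurable_comp (has_cint_cmeasurable (gv ord0))); exact: measurable_fst.
suff F : has_cint (lmx (n ord0) p \x lebesgue_tuple R #|rcoord p n'|)%E f (\prod_j v j).
  apply: (eq_has_cint F) => // z; rewrite /f /= big_ord_recl phi0 mulrC; congr (_ * _).
  by apply: eq_bigr => j _; rewrite phiS.
refine (has_cint_fubini mf
  (h := fun t => (normc (\prod_j g' j (mx_of_coords t j)))%:C * w0) _ _
  (fun t => has_cintZ (\prod_j g' j (mx_of_coords t j)) (gv ord0)) _).
- move=> t; apply: (eq_has_cint (has_cintZ _ gw0)) => // x.
  by rewrite /f normcM realcM.
- by apply: (eq_has_cint (has_cintZ w0 gw)) => // t; rewrite mulrC.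
- apply: (eq_has_cint (has_cintZ (v ord0) IH')) => [t|]; first by rewrite mulrC.
  by rewrite big_ord_recl.
Qed.

End family.

Section dirichlet_integral.
Variable R : realType.
Local Notation C := R[i].
Local Notation mR := (measurableTypeR R).
Local Notation lmx := (lebesgue_mx R).
Local Notation normc := (@Normc.normc R).

Lemma absdet_gt0 n (T : 'M[C]_n) : T \in unitmx -> 0 < absdet T.
Proof. by move=> uT; rewrite lt_def absdet_eq0 uT normc_ge0. Qed.

Lemma gramdetMl n p (T : 'M[C]_n) (X : 'M[C]_(n, p)) : T \in unitmx ->
  (gramdet (T *m X) != 0) = (gramdet X != 0).
Proof.
move=> uT; rewrite !gramdet_neq0 -mxrank_tr trmx_mul mxrankMfree ?mxrank_tr//.
by rewrite row_free_unit unitmx_tr.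
Qed.

(** Substitute Y = S X Z in the matrix Gaussian integral. The determinant power contributes |det
    Z|^(-2a) and the Jacobian |det Z|^(-2m), together [gramdet Z] to the power -(a + m). *)
Lemma has_cint_block m p (S : 'M[C]_m) (Z : 'M[C]_p) (a : C) :
  (p <= m)%N -> S \in unitmx -> Z \in unitmx -> p%:R - 1 < complex.Re (a + m%:R) ->
  has_cint (lmx m p)
    (fun X => pw (gramdet (S *m X)) a * (expR (- mxnorm2 (S *m X *m Z)))%:C)
    ((absdet S ^- (2 * p))%:C * mxgauss_val m p a * pw (gramdet Z) (- (a + m%:R))).
Proof.
move=> pm uS uZ am.
have dZ := absdet_gt0 uZ.
have w0 (r : R) l : 0 <= r -> 0 <= r ^- l by move=> r0; rewrite invr_ge0 exprn_ge0.
have P := preserves_comp (lmul_scales_unit uS p) (rmul_scales_unit m uZ).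
have c0 : 0 <= normc (\det S) ^- (2 * p) * normc (\det Z) ^- (2 * m).
  by rewrite mulr_ge0// w0// normc_ge0.
have H := has_cint_preserves c0 P (has_cintZ (pw (gramdet Z) (- a)) (has_cint_mxgauss pm am)).
apply: (eq_has_cint H) => [X|].
  rewrite /= /mxgauss gramdetMr -gramdet_square pwM ?gramdet_ge0// !mulrA.
  congr (_ * _); rewrite mulrAC mulrC [X in _ * X](mulrC _ (pw _ a)) -pwD.
  by rewrite subrr pw0 ?mulr1// gramdet_square exprn_gt0.
rewrite -/(absdet S) -/(absdet Z) realcM.
have -> : pw (gramdet Z) (- (a + m%:R)) = pw (gramdet Z) (- a) * (absdet Z ^- (2 * m))%:C.
  rewrite opprD (pwD _ (- a) (- m%:R)) gramdet_square; congr (_ * _).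
  by rewrite pwN ?exprn_gt0// pw_nat ?exprn_gt0// -exprM fmorphV.
by ring.
Qed.

(** The substitution Z -> S^-1 Z has Jacobian |det S|^(-2p), that is, [gramdet S] to the power -p.
    Hence the shift by p in the exponent: g - p inside yields -g outside. *)
Lemma has_cint_gauss_form p (S : 'M[C]_p) (g : C) : S \in unitmx ->
  p%:R - 1 < complex.Re g ->
  has_cint (lmx p p)
    (fun Z => pw (gramdet Z) (g - p%:R) * (expR (- mxnorm2 (S *m Z)))%:C)
    (pw (gramdet S) (- g) * mxgauss_val p p (g - p%:R)).
Proof.
move=> uS g_gt; have S0 : 0 < gramdet S by rewrite gramdet_square exprn_gt0// absdet_gt0.
have c0 : 0 <= normc (\det S) ^- (2 * p) by rewrite invr_ge0 exprn_ge0// normc_ge0.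
have G : has_cint (lmx p p) (mxgauss (g - p%:R)) (mxgauss_val p p (g - p%:R)).
  by apply: has_cint_mxgauss => //; rewrite subrK.
have H := has_cint_preserves c0 (lmul_scales_unit uS p)
  (has_cintZ (pw (gramdet S) (- (g - p%:R))) G).
apply: (eq_has_cint H) => [Z|].
  rewrite /= /mxgauss gramdetMr -gramdet_square pwM ?gramdet_ge0// !mulrA -pwD.
  by rewrite addNr pw0// mul1r.
rewrite mulrA -/(absdet S); congr (_ * _).
have -> : (absdet S ^- (2 * p))%:C = pw (gramdet S) (- p%:R).
  by rewrite pwN// pw_nat// gramdet_square -exprM fmorphV.
by rewrite -pwD; congr pw; ring.
Qed.

Lemma has_cint_restrict d (T : measurableType d) (mu : {measure set T -> \bar R})
    (D : set T) (f g : T -> C) v : measurable D ->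
  (forall x, D x -> g x = f x) -> (forall x, ~ D x -> g x = 0) ->
  has_cint mu g v -> cintegrable mu D f /\ cintegral mu D f = v.
Proof.
move=> mD gf g0.
have E (h : C -> R) : h 0 = 0 -> (EFin \o (h \o f)) \_ D = EFin \o (h \o g).
  move=> h0; apply/funext => x; rewrite patchE /=; case: ifPn.
    by rewrite inE => /gf ->.
  by rewrite notin_setE => /g0 ->; rewrite h0.
move=> [[iRe iIm] <-]; split.
  split; apply/(integrable_mkcond _ mD).
    by rewrite (E (@complex.Re R)).
  by rewrite (E (@complex.Im R)).
rewrite /cintegral /Rintegral !(integral_mkcond D).
by rewrite (E (@complex.Re R))// (E (@complex.Im R)).
Qed.

Lemma pi_expC_neq0 m : (pi ^+ m : R)%:C != 0 :> C.
Proof. by rewrite fmorph_eq0 expf_neq0// gt_eqF// pi_gt0. Qed.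

(** The arguments n - i and al + n - i are those of the Gamma factors of two [mvGamma], whose powers
    of pi cancel in the quotient. *)
Lemma mxgauss_valE n p (al : C) : (p <= n)%N ->
  mxgauss_val n p al = (pi ^+ (n * p))%:C * mvGamma p (al + n%:R) / mvGamma p n%:R.
Proof.
move=> pn; have pi0 := pi_expC_neq0.
rewrite /mvGamma /mxgauss_val big_split big_split /= prodfV prodr_const card_ord.
rewrite -!mulrA; congr (_ * _); first by rewrite -rmorphXn /= -exprM.
rewrite mulrA -mulf_div divff// mul1r; congr (_ / _); apply: eq_bigr => i _.
  by rewrite natrB ?addrA// (leq_trans _ pn)// ltnW.
by rewrite natrB// (leq_trans _ pn)// ltnW.
Qed.

Lemma mvGamma_neq0 p (z : C) : p%:R - 1 < complex.Re z -> mvGamma p z != 0.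
Proof.
move=> z_gt; rewrite /mvGamma mulf_neq0 ?pi_expC_neq0//.
apply/prodf_neq0 => i _; apply: cGamma_neq0.
rewrite raddfB /= -(rmorph_nat (real_complex R)) /= subr_gt0.
by apply: le_lt_trans z_gt; rewrite lerBrDr natr1 ler_nat.
Qed.

Section blocks.
Variables (p k : nat) (n : 'I_k -> nat) (T : forall j, 'M[C]_(n j)).
Hypothesis uT : forall j, T j \in unitmx.
Hypothesis n_gep : forall j, (p <= n j)%N.

Local Notation coords := (#|rcoord p n|.-tuple mR).
Local Notation sys := (@mx_of_coords R p k n).

(** The integrand with the auxiliary matrix Z = [z.2] adjoined; [be] will be beta + delta. The
    exponent of [gramdet z.2] is the one that [has_cint_gauss_form] turns into minus the total. *)
Definition dirichlet_gauss (al : 'I_k -> C) (be : C) (z : coords * 'M[C]_p) : C :=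
  pw (gramdet z.2) (dirichlet_total n al be - p%:R) * (expR (- mxnorm2 z.2))%:C *
  \prod_j (pw (gramdet (T j *m sys z.1 j)) (al j) *
           (expR (- mxnorm2 (T j *m sys z.1 j *m z.2)))%:C).

Lemma normc_dirichlet_gauss al be z : (normc (dirichlet_gauss al be z))%:C =
  dirichlet_gauss (fun j => (complex.Re (al j))%:C) (complex.Re be)%:C z.
Proof.
have normc_prod (F : 'I_k -> C) : (normc (\prod_j F j))%:C = \prod_j (normc (F j))%:C.
  apply: (big_morph (fun x : C => (normc x)%:C)) => [x y|]; first by rewrite normcM realcM.
  by rewrite normc_real.
rewrite /dirichlet_gauss !normcM !realcM normc_pw normc_real ?expR_ge0// normc_prod.
congr (pw _ _ * _ * _); last first.
  by apply: eq_bigr => j _; rewrite normcM realcM normc_pw normc_real ?expR_ge0.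
have Re_nat m : (complex.Re (m%:R : C))%:C = m%:R by rewrite -(rmorph_nat (real_complex R)).
rewrite /dirichlet_total !(raddfB, raddfD, raddf_sum) /= !Re_nat.
by congr (_ + _ - _); apply: eq_bigr => j _; rewrite Re_nat.
Qed.

Lemma cmeasurable_dirichlet_gauss al be : cmeasurable (dirichlet_gauss al be).
Proof.
have mZ : measurable_fun setT (fun z : coords * 'M[C]_p => z.2) by exact: measurable_snd.
apply: cmeasurableM.
  exact: (cmeasurable_comp (@cmeasurable_mxgauss R p p (dirichlet_total n al be - p%:R)) mZ).
apply: cmeasurable_prod => j.
have mX : measurable_fun setT (fun z : coords * 'M[C]_p => T j *m sys z.1 j).
  apply: measurable_mulmx => //.
  exact: (measurableT_comp (@measurable_mx_of_coords R p k n j) measurable_fst).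
apply: cmeasurableM.
  by apply: cmeasurable_pw; apply: measurableT_comp mX; exact: measurable_gramdet.
apply: cmeasurable_real; apply: (measurableT_comp (@measurable_expN_mxnorm2 R _ _)).
exact: measurable_mulmx.
Qed.

Definition dirichlet_gauss_val (al : 'I_k -> C) : C :=
  \prod_j ((absdet (T j) ^- (2 * p))%:C * mxgauss_val (n j) p (al j)).

(** Block j lowers the exponent of [gramdet Z] by al_j + n_j. Starting from the total minus p, what
    remains is be - p, so the outer integral over [Z] is again a matrix Gaussian. For singular [Z]
    both sides vanish. *)
Lemma has_cint_dirichlet_gauss_fiber al be (Z : 'M[C]_p) :
  (forall j, p%:R - 1 < complex.Re (al j + (n j)%:R)) ->
  has_cint (lebesgue_tuple R #|rcoord p n|) (fun x => dirichlet_gauss al be (x, Z))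
    (dirichlet_gauss_val al * mxgauss (be - p%:R) Z).
Proof.
move=> al_gt; have [uZ|nuZ] := boolP (Z \in unitmx); last first.
  have Z0 : gramdet Z = 0.
    by rewrite gramdet_square; move: nuZ; rewrite -absdet_eq0 => /eqP ->; rewrite expr0n.
  apply: (eq_has_cint (has_cint_real (has_rint0 _))) => [x|].
    by rewrite /dirichlet_gauss /= Z0 pw_le0// !mul0r.
  by rewrite /mxgauss Z0 pw_le0// mul0r mulr0.
have H := has_cint_family (fun j => has_cint_block (n_gep j) (uT j) uZ (al_gt j)).
apply: (eq_has_cint (has_cintZ (mxgauss (dirichlet_total n al be - p%:R) Z) H)) => //.
rewrite big_split /= mulrCA; congr (_ * _); rewrite /mxgauss mulrAC; congr (_ * _).
have Z0 : 0 < gramdet Z by rewrite gramdet_square exprn_gt0// absdet_gt0.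
have -> (F : 'I_k -> C) : \prod_j pw (gramdet Z) (F j) = pw (gramdet Z) (\sum_j F j).
  by apply/esym/(big_morph (pw (gramdet Z))) => [z w|]; [exact: pwD|exact: pw0].
rewrite -pwD; congr pw; rewrite sumrN big_split /dirichlet_total /=; ring.
Qed.

Lemma has_cint_dirichlet_gauss al be :
  (forall j, p%:R - 1 < complex.Re (al j + (n j)%:R)) -> p%:R - 1 < complex.Re be ->
  has_cint (lebesgue_tuple R #|rcoord p n| \x lmx p p)%E (dirichlet_gauss al be)
    (dirichlet_gauss_val al * mxgauss_val p p (be - p%:R)).
Proof.
have outer a b : p%:R - 1 < complex.Re b ->
    has_cint (lmx p p) (fun Z => dirichlet_gauss_val a * mxgauss (b - p%:R) Z)
      (dirichlet_gauss_val a * mxgauss_val p p (b - p%:R)).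
  by move=> b0; apply: has_cintZ; apply: has_cint_mxgauss => //; rewrite subrK.
move=> al_gt be_gt.
have Re_nat m : (m%:R : C) = (m%:R : R)%:C by rewrite rmorph_nat.
pose al' j := (complex.Re (al j))%:C; pose be' := (complex.Re be)%:C.
refine (has_cint_fubini (cmeasurable_dirichlet_gauss al be)
  (h := fun Z => dirichlet_gauss_val al' * mxgauss (be' - p%:R) Z) _ _
  (fun Z => has_cint_dirichlet_gauss_fiber be Z al_gt) (outer al be be_gt)).
  move=> Z; apply: (eq_has_cint (has_cint_dirichlet_gauss_fiber (al := al') be' Z _)) => //.
    by move=> j; have := al_gt j; rewrite /al' !raddfD.
  by move=> x; rewrite -normc_dirichlet_gauss.
exact: outer.
Qed.

Definition block_gram (x : coords) : 'M[C]_p :=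
  1%:M + \sum_j (T j *m sys x j)^t* *m (T j *m sys x j).

(** The summand 1 makes [block_gram] positive definite. With S^* S its Cholesky factorization, both
    sides of the last identity are the trace of Z^* S^* S Z. *)
Lemma block_gram_factor x : exists S : 'M[C]_p,
  [/\ S \in unitmx, absdet (block_gram x) = gramdet S &
   forall Z : 'M[C]_p,
     mxnorm2 Z + \sum_j mxnorm2 (T j *m sys x j *m Z) = mxnorm2 (S *m Z)].
Proof.
have quad (q : nat) (Z : 'M[C]_(p, q)) : (Z^t* *m block_gram x *m Z) = Z^t* *m Z +
    \sum_j (T j *m sys x j *m Z)^t* *m (T j *m sys x j *m Z).
  rewrite /block_gram mulmxDr mulmx1 mulmxDl mulmx_sumr mulmx_suml; congr (_ + _).
  by apply: eq_bigr => j _; rewrite [in RHS]adjmxM !mulmxA.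
have pA : hermposdefmx (block_gram x).
  split.
    rewrite hermsymmxE /block_gram adjmxD adjmx1; apply/eqP; congr (_ + _).
    rewrite raddf_sum /= map_mx_sum; apply: eq_bigr => j _.
    by rewrite [RHS]adjmxM adjmxK.
  move=> v v0; rewrite quad mxE gram_cV summxE.
  under eq_bigr do rewrite gram_cV.
  apply: ltr_pwDl; first by rewrite ltcR lt_def mxnorm2_ge0 mxnorm2_eq0 v0.
  by apply: sumr_ge0 => j _; rewrite lecR mxnorm2_ge0.
have [S uS AS] := cholesky pA; exists S; split => //; first by rewrite AS.
move=> Z; apply: complexI; rewrite -[RHS]trace_gram adjmxM mulmxA -(mulmxA (Z^t*)) -AS quad.
rewrite mxtraceD rmorphD; congr (_ + _); first exact/esym/trace_gram.
by rewrite !raddf_sum; apply: eq_bigr => j _; exact/esym/trace_gram.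
Qed.

(** Since p >= 1, the bound p - 1 is nonnegative, so adding the terms al_j + n_j can only increase
    the real part of [be]. *)
Lemma dirichlet_total_gt (al : 'I_k -> C) (be : C) : (0 < p)%N ->
  (forall j, p%:R - 1 < complex.Re (al j + (n j)%:R)) -> p%:R - 1 < complex.Re be ->
  p%:R - 1 < complex.Re (dirichlet_total n al be).
Proof.
move=> p0 al_gt be_gt; have p1 : (0 : R) <= p%:R - 1 by rewrite subr_ge0 ler1n.
have -> : dirichlet_total n al be = \sum_j (al j + (n j)%:R) + be.
  by rewrite big_split /= /dirichlet_total; ring.
rewrite raddfD raddf_sum /= ltr_wpDl// sumr_ge0// => j _.
exact: ltW (le_lt_trans p1 (al_gt j)).
Qed.

(** The integral of [dirichlet_gauss] is read in both orders. Over Z first it gives the integrand of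
    the statement times [mxgauss_val p p (g - p)]; over the family first it gives
    [mxgauss_val p p (be - p)] times the constants of the blocks. In the quotient the powers of pi
    and the values of [mvGamma] at p cancel. *)
Lemma has_cint_dirichlet_pw al be : (0 < p)%N ->
  (forall j, p%:R - 1 < complex.Re (al j + (n j)%:R)) -> p%:R - 1 < complex.Re be ->
  has_cint (lebesgue_tuple R #|rcoord p n|)
    (fun x => (\prod_j pw (gramdet (T j *m sys x j)) (al j)) *
      pw (absdet (block_gram x)) (- dirichlet_total n al be))
    (dirichlet_gauss_val al * (mvGamma p be / mvGamma p (dirichlet_total n al be))).
Proof.
move=> p0 al_gt be_gt; have := dirichlet_total_gt p0 al_gt be_gt.
set g := dirichlet_total n al be => g_gt.
have p_gt : p%:R - 1 < complex.Re (p%:R : C).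
  by rewrite -(rmorph_nat (real_complex R)) /= ltrBlDr ltrDl.
have G0 : mxgauss_val p p (g - p%:R) != 0.
  rewrite mxgauss_valE// subrK; apply: mulf_neq0; last exact/invr_neq0/mvGamma_neq0.
  by apply: mulf_neq0; [exact: pi_expC_neq0|exact: mvGamma_neq0].
have H := has_cint_fubini_inv (has_cint_dirichlet_gauss al_gt be_gt).
have {}H := H (fun x => (\prod_j pw (gramdet (T j *m sys x j)) (al j)) *
      (pw (absdet (block_gram x)) (- g) * mxgauss_val p p (g - p%:R))).
have {}H := has_cintZ (mxgauss_val p p (g - p%:R))^-1 (H _).
apply: (eq_has_cint (H _)) => [x|x|].
- have [S [uS -> SZ]] := block_gram_factor x.
  apply: (eq_has_cint (has_cintZ (\prod_j pw (gramdet (T j *m sys x j)) (al j))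
    (has_cint_gauss_form uS g_gt))) => // Z.
  rewrite -SZ opprD expRD realcM /dirichlet_gauss big_split /= -/g.
  have -> (F : 'I_k -> R) : (expR (- \sum_j F j))%:C = \prod_j (expR (- F j))%:C.
    by rewrite -sumrN expR_sum rmorph_prod.
  by rewrite /=; ring.
- by rewrite mulrC !mulrA mulfK.
- rewrite mulrC -mulrA !mxgauss_valE// !subrK -mulf_div -mulf_div divff ?pi_expC_neq0//.
  by rewrite mul1r divff ?mulr1// invr_eq0 mvGamma_neq0.
Qed.

End blocks.

End dirichlet_integral.

Theorem mainTheorem9 (R : realType) (p k : nat) (n : 'I_k -> nat)
    (B : forall j : 'I_k, 'M[R[i]]_(n j))
    (alpha : 'I_k -> R[i]) (beta delta : R[i])
    (p_ge1 : (1 <= p)%N) (k_ge1 : (1 <= k)%N)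
    (n_gep : forall j, (p <= n j)%N)
    (B_gt0 : forall j, hermposdefmx (B j))
    (alpha_gt : forall j, p%:R - 1 < complex.Re (alpha j + (n j)%:R))
    (beta_gt : p%:R - 1 < complex.Re beta)
    (beta_delta_gt : p%:R - 1 < complex.Re (beta + delta)) :
  let phi8 (X : mxfamily R p n) := cpow (absdet1D B X) (- delta) in
  let total := dirichlet_total n alpha beta in
  dirichlet_integrable B alpha beta phi8 /\
  dirichlet_average B alpha beta phi8 =
    mvGamma p (beta + delta) / mvGamma p beta *
    (mvGamma p total / mvGamma p (total + delta)).
Proof.
move=> phi8 total.
have chol j : exists T : 'M[R[i]]_(n j), T \in unitmx /\ B j = T^t* *m T.
  by have [T uT BT] := cholesky (B_gt0 j); exists T.
pose T j := sval (cid (chol j)).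
have uT j : T j \in unitmx by have [] := svalP (cid (chol j)).
have BT j : B j = (T j)^t* *m T j by have [] := svalP (cid (chol j)).
have quadE (X : mxfamily R p n) j : quadmx B X j = (T j *m X j)^t* *m (T j *m X j).
  by rewrite /quadmx BT adjmxM !mulmxA.
have detE (x : #|rcoord p n|.-tuple (measurableTypeR R)) :
    absdet1D B (mx_of_coords x) = absdet (block_gram T x).
  by congr (absdet (_ + _)); apply: eq_bigr => j _; exact: quadE.
have det_gt0 (x : #|rcoord p n|.-tuple (measurableTypeR R)) : 0 < absdet (block_gram T x).
  have [S [uS -> _]] := block_gram_factor T x.
  by rewrite gramdet_square exprn_gt0// absdet_gt0.
have totalD : dirichlet_total n alpha (beta + delta) = total + delta.
  by rewrite /total /dirichlet_total; ring.
have mD : measurable (@mx_of_coords R p k n @^-1` @fullrank R p k n).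
  rewrite (_ : _ @^-1` _ = \bigcap_(j in [set: 'I_k])
      ((fun x => gramdet (mx_of_coords x j)) @^-1` [set~ 0])).
    apply: fin_bigcap_measurable => // j _; rewrite -[X in measurable X]setTI.
    apply: (measurableT_comp (@measurable_gramdet R _ _) (@measurable_mx_of_coords R p k n j)) => //.
    exact: measurableC.
  apply/seteqP; split=> x /= Dx j => [_|].
    by apply/eqP; rewrite gramdet_neq0; apply/eqP; exact: Dx.
  by apply/eqP; rewrite -gramdet_neq0; apply/eqP; exact: Dx.
(* The power -delta in [phi8] merges with the density: the integral is the one with last parameter
   beta + delta, whereas the normalizing constant keeps beta. *)
have H := has_cintZ (dirichlet_const p B alpha beta)
  (has_cint_dirichlet_pw uT n_gep p_ge1 alpha_gt beta_delta_gt).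
have [x|x|Hi Hv] := has_cint_restrict
   (f := fun x => phi8 (mx_of_coords x) * dirichlet_density B alpha beta (mx_of_coords x)) mD _ _ H.
(* On full-rank families all the determinants are positive, so [pw] and [cpow] agree. *)
- move=> Dx; rewrite /phi8 /dirichlet_density -/total detE totalD -!pw_gt0//.
  rewrite opprD pwD.
  have -> : \prod_j cpow (absdet (quadmx B (mx_of_coords x) j)) (alpha j) =
     \prod_j pw (gramdet (T j *m mx_of_coords x j)) (alpha j).
    apply: eq_bigr => j _; rewrite quadE -pw_gt0// lt_def gramdet_ge0 andbT.
    by rewrite gramdetMl// gramdet_neq0; apply/eqP; exact: Dx.
  ring.
(* Off the domain some Gram determinant is zero, and the corresponding [pw] factor makes the
   extended integrand vanish. *)
- move=> nDx.
  have [j] : exists j, \rank (mx_of_coords x j) != p.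
    by apply: contra_notP nDx => h j; apply/eqP/negPn/negP => jp; apply: h; exists j.
  rewrite -gramdet_neq0 -(gramdetMl _ (uT j)) negbK => /eqP j0.
  by rewrite (bigD1 j)//= j0 pw_le0// !mul0r mulr0.
split=> //; rewrite [LHS]Hv totalD mulrA.
(* As B_j = T_j^* T_j, the factor |det B_j|^p equals |det T_j|^(2p) and cancels the Jacobian; the
   powers of pi and the values of [mvGamma] at n_j and alpha_j + n_j cancel against
   [mxgauss_val]. *)
have -> : dirichlet_const p B alpha beta * dirichlet_gauss_val p T alpha =
    mvGamma p total / mvGamma p beta.
  rewrite mulrAC -big_split /= big1 ?mul1r// => j _.
  have T0 : (absdet (T j) ^+ (2 * p))%:C != 0 :> R[i].
    by rewrite fmorph_eq0 expf_neq0// gt_eqF// absdet_gt0.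
  have al0 := mvGamma_neq0 (alpha_gt j).
  have n0 : mvGamma p (n j)%:R != 0 :> R[i].
    apply: mvGamma_neq0; rewrite -(rmorph_nat (real_complex R)) /= ltrBlDr natr1.
    by rewrite ltr_nat ltnS.
  have pi0 := pi_expC_neq0 R (n j * p).
  rewrite mxgauss_valE// BT -/(gramdet (T j)) gramdet_square -exprM fmorphV.
  by field; do !(apply/andP; split).
by rewrite !mulf_div; congr (_ / _); exact: mulrC.
Qed.
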